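(* Let $n\ge4$, $\widetilde{W}$ the affine Weyl group of type $\widetilde{D}_n$, and $w\in\widetilde{W}^S$. Then $w$ is palindromic if and only if the underlying (uncolored) shape of $\pi(w)$ is a one-row shape $(j)$ with $1\le j\le n-1$ or $j=2n-2$, or a staircase shape $(k,k-1,k-2,\dots,1)$ with $k\le n-1$. (When $j=n-1$ or $k=n-1$ there are two distinct such elements, corresponding to the two colors of parts of size $n-1$.)
   Context: $\widetilde{W}$ has generators $s_0,\dots,s_n$ with $m=3$ for $(s_0,s_2)$, $(s_1,s_2)$, $(s_i,s_{i+1})$ ($2\le i\le n-2$), $(s_{n-2},s_n)$, all others commuting. $S=\{s_1,\dots,s_n\}$, $S'=\{s_0,s_2,\dots,s_n\}$; $\widetilde{W}^S$, $\widetilde{W}^{S'}$ are the minimal length left coset representatives for $W_S$, $W_{S'}$. Colored segments (colors $b,c$ only at length $n-1$): $\sigma_1(j)=s_j\cdots s_2s_1$ ($1\le j\le n-2$), $\sigma_1^b(n-1)=s_{n-1}s_{n-2}\cdots s_1$, $\sigma_1^c(n-1)=s_ns_{n-2}\cdots s_1$, $\sigma_1(j)=s_{2n-j-1}\cdots s_{n-2}s_{n-1}s_ns_{n-2}\cdots s_2s_1$ ($n\le j\le 2n-2$); $\sigma_0^z(j)$ is obtained from $\sigma^z_1(j)$ by interchanging $s_0\leftrightarrow s_1$ and $s_{n-1}\leftrightarrow s_n$. Every $w\in\widetilde{W}^S$, $w\ne\mathrm{id}$, factors uniquely $w=uv$ with $u\in\widetilde{W}^{S'}$, $v\in W_{S'}$,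 lengths adding, and $v=\sigma^{c_1}_0(\lambda_1)$; if $u\ne\mathrm{id}$, $u=u'v'$ with $u'\in\widetilde{W}^S$, $v'=\sigma_1^{c_2}(\lambda_2)\in W_S$; alternating gives $w=\cdots\sigma_0^{c_3}(\lambda_3)\sigma_1^{c_2}(\lambda_2)\sigma_0^{c_1}(\lambda_1)$ and $\pi(w)=(\lambda_1^{c_1},\lambda_2^{c_2},\dots)$ ($\pi(\mathrm{id})=\emptyset$), whose underlying shape is a partition of $\ell(w)$ (the staircase with $k=0$ is the empty shape). $P_w(t)=\sum_{v\in\widetilde{W}^S,v\le w}t^{\ell(v)}$ (Bruhat order); $w$ is palindromic if its coefficients satisfy $a_i=a_{\ell(w)-i}$ for all $i$. *)

(* Defs.v *)
From HB Require Import structures.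
From mathcomp Require Import all_boot all_order all_algebra.
From mathcomp Require Import boolp classical_sets fsbigop.

Set Implicit Arguments.
Unset Strict Implicit.
Unset Printing Implicit Defensive.

Local Open Scope classical_set_scope.
Local Open Scope quotient_scope.
Local Open Scope group_scope.

Section CoxeterGroup.
Variables (I : choiceType) (m : I -> I -> nat).

(* The congruence on words in the generators spanned by s_i s_i = 1 and
   (s_i s_j)^(m i j) = 1; [m i j = 0] stands for an infinite exponent. *)
Inductive cox_equiv : seq I -> seq I -> Prop :=
| cox_refl x : cox_equiv x x
| cox_sym x y : cox_equiv x y -> cox_equiv y x
| cox_trans x y z : cox_equiv x y -> cox_equiv y z -> cox_equiv x z
| cox_invol x y i : cox_equiv (x ++ [:: i; i] ++ y) (x ++ y)
| cox_braid x y i j :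
    cox_equiv (x ++ flatten (nseq (m i j) [:: i; j]) ++ y) (x ++ y).

Definition cox_rel : rel (seq I) := fun x y => `[< cox_equiv x y >].

Fact cox_rel_refl : reflexive cox_rel.
Proof. by move=> x; apply/asboolP; exact: cox_refl. Qed.

Fact cox_rel_sym : symmetric cox_rel.
Proof. by move=> x y; apply/asboolP/asboolP; exact: cox_sym. Qed.

Fact cox_rel_trans : transitive cox_rel.
Proof.
by move=> y x z /asboolP xy /asboolP yz; apply/asboolP; exact: cox_trans xy yz.
Qed.

Canonical cox_equiv_rel :=
  EquivRel cox_rel cox_rel_refl cox_rel_sym cox_rel_trans.

Definition coxeter := {eq_quot cox_equiv_rel}.

HB.instance Definition _ := Choice.on coxeter.

Definition cox_class (x : seq I) : coxeter := \pi_coxeter x.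

Fact cox_classP x y : cox_class x = cox_class y <-> cox_equiv x y.
Proof.
split; first by move/eqquotP => /asboolP.
by move=> xy; apply/eqquotP/asboolP.
Qed.

Fact cox_class_repr w : cox_class (repr w) = w.
Proof. exact: reprK. Qed.

Definition cox_one := cox_class [::].
Definition cox_mul (u v : coxeter) := cox_class (repr u ++ repr v).
Definition cox_inv (u : coxeter) := cox_class (rev (repr u)).

Fact cox_equiv_catl z x y : cox_equiv x y -> cox_equiv (z ++ x) (z ++ y).
Proof.
elim=> {x y} [x|x y _ IH|x y t _ IH1 _ IH2|x y i|x y i j].
- exact: cox_refl.
- exact: cox_sym.
- exact: cox_trans IH1 IH2.
- by rewrite !(catA z); exact: cox_invol.
- by rewrite !(catA z); exact: cox_braid.
Qed.

Fact cox_equiv_catr z x y : cox_equiv x y -> cox_equiv (x ++ z) (y ++ z).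
Proof.
elim=> {x y} [x|x y _ IH|x y t _ IH1 _ IH2|x y i|x y i j].
- exact: cox_refl.
- exact: cox_sym.
- exact: cox_trans IH1 IH2.
- by rewrite -!catA; exact: cox_invol.
- by rewrite -!catA; exact: cox_braid.
Qed.

Fact cox_class_cat x y : cox_mul (cox_class x) (cox_class y) = cox_class (x ++ y).
Proof.
have eqx := cox_class_repr (cox_class x); have eqy := cox_class_repr (cox_class y).
apply/cox_classP; move/cox_classP: eqx => eqx; move/cox_classP: eqy => eqy.
exact: cox_trans (cox_equiv_catr _ eqx) (cox_equiv_catl _ eqy).
Qed.

Fact cox_equiv_revK x : cox_equiv (x ++ rev x) [::].
Proof.
elim: x => [|i x IH]; first exact: cox_refl.
rewrite rev_cons -cats1 catA cat_cons.
apply: (@cox_trans _ [:: i; i]); last exact: (cox_invol [::] [::] i).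
exact: (cox_equiv_catl [:: i] (cox_equiv_catr [:: i] IH)).
Qed.

Fact cox_mulA : associative cox_mul.
Proof.
move=> u v w.
by rewrite -(cox_class_repr u) -(cox_class_repr v) -(cox_class_repr w)
  !cox_class_cat catA.
Qed.

Fact cox_mul1 : left_id cox_one cox_mul.
Proof. by move=> u; rewrite -(cox_class_repr u) cox_class_cat. Qed.

Fact cox_mulr1 : right_id cox_one cox_mul.
Proof. by move=> u; rewrite -(cox_class_repr u) cox_class_cat cats0. Qed.

Fact cox_mulV : left_inverse cox_one cox_inv cox_mul.
Proof.
move=> u; rewrite -{2}(cox_class_repr u) cox_class_cat; apply/cox_classP.
by rewrite -{2}(revK (repr u)); exact: cox_equiv_revK.
Qed.

Fact cox_mulrV : right_inverse cox_one cox_inv cox_mul.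
Proof.
move=> u; rewrite -{1}(cox_class_repr u) cox_class_cat; apply/cox_classP.
exact: cox_equiv_revK.
Qed.

HB.instance Definition _ :=
  isGroup.Build coxeter cox_mulA cox_mul1 cox_mulr1 cox_mulV cox_mulrV.

Definition cox_gen (i : I) : coxeter := cox_class [:: i].

Definition word_prod (x : seq I) : coxeter := \prod_(i <- x) cox_gen i.

Fact word_prodE x : word_prod x = cox_class x.
Proof.
rewrite /word_prod; elim: x => [|i x IH]; first by rewrite big_nil.
by rewrite big_cons IH; exact: (cox_class_cat [:: i] x).
Qed.

Definition has_word_of_size (w : coxeter) : pred nat :=
  fun k => `[< exists2 x, size x = k & word_prod x = w >].

Fact has_word (w : coxeter) : exists k, has_word_of_size w k.
Proof.
exists (size (repr w)); apply/asboolP; exists (repr w) => //.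
by rewrite word_prodE cox_class_repr.
Qed.

Definition cox_length (w : coxeter) : nat := ex_minn (has_word w).

(* Generators are involutions, so words with letters in J exhaust the
   subgroup generated by J. *)
Definition parabolic (J : {pred I}) : set coxeter :=
  [set w | exists2 x, all (mem J) x & word_prod x = w].

Definition min_coset_rep (J : {pred I}) : set coxeter :=
  [set w | forall v, parabolic J v -> (cox_length w <= cox_length (w * v)%g)%N].

Definition cox_reflection : set coxeter :=
  [set t | exists w i, t = w * cox_gen i * w^-1].

Inductive bruhat_le (u : coxeter) : coxeter -> Prop :=
| bruhat_refl : bruhat_le u u
| bruhat_step v t : bruhat_le u v -> cox_reflection t ->
    (cox_length v < cox_length (v * t)%g)%N -> bruhat_le u (v * t).

End CoxeterGroup.

Local Close Scope group_scope.

(* Edges (i, j), listed in one direction only, of the Dynkin diagram of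
   affine type D_n. *)
Definition affD_edge (n i j : nat) : bool :=
  [|| (i == 0) && (j == 2), (i == 1) && (j == 2),
      (2 <= i <= n - 2) && (j == i.+1) | (i == n - 2) && (j == n)].

Definition affD_matrix (n : nat) (i j : 'I_n.+1) : nat :=
  if i == j then 1 else if affD_edge n i j || affD_edge n j i then 3 else 2.

Definition affD (n : nat) := coxeter (@affD_matrix n).

HB.instance Definition _ n := Group.on (affD n).

(* [gens_but n 0] is S and [gens_but n 1] is S'. *)
Definition gens_but (n e : nat) : {pred 'I_n.+1} := [pred i | val i != e].
Arguments gens_but : clear implicits.

Inductive color := color_b | color_c.

HB.instance Definition _ := gen_eqMixin color.
HB.instance Definition _ := gen_choiceMixin color.

Definition part : Type := nat * option color.

HB.instance Definition _ := Choice.on part.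

Definition valid_part (n : nat) (p : part) : Prop :=
  1 <= p.1 <= 2 * n - 2 /\ (p.2 <> None <-> p.1 = n - 1).

(* Only meant for valid parts. *)
Definition segment1 (n : nat) (p : part) : seq nat :=
  let j := p.1 in
  if j <= n - 2 then rev (iota 1 j)
  else if j == n - 1 then
    (if p.2 is Some color_b then n - 1 else n) :: rev (iota 1 (n - 2))
  else iota (2 * n - j - 1) (j - n + 1) ++ n :: rev (iota 1 (n - 2)).

Definition swap_ends (n i : nat) : nat :=
  if i == 0 then 1 else if i == 1 then 0
  else if i == n - 1 then n else if i == n then n - 1 else i.

Definition segment (n : nat) (e : bool) (p : part) : seq nat :=
  if e then segment1 n p else map (swap_ends n) (segment1 n p).

Definition sigma (n : nat) (e : bool) (p : part) : affD n :=
  word_prod (@affD_matrix n) (map inord (segment n e p)).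

(* [factors_as e w ps] : w, a minimal representative for the subgroup omitting
   s_e, has iterated factorization ... sigma_(1-e)(ps_2) sigma_e(ps_1); the
   bool e is read as the index 0 or 1. *)
Fixpoint factors_as (n : nat) (e : bool) (w : affD n) (ps : seq part) : Prop :=
  if ps is p :: ps' then
    w <> 1%g /\
    exists u v : affD n,
      [/\ w = (u * v)%g,
          min_coset_rep (gens_but n (~~ e)) u,
          parabolic (gens_but n (~~ e)) v &
          cox_length w = cox_length u + cox_length v] /\
      [/\ valid_part n p, v = sigma n e p & factors_as (~~ e) u ps']
  else w = 1%g.

(* The colored partition of w, the sequence being unique for w in W^S. *)
Definition colored_partition (n : nat) (w : affD n) : seq part :=
  xget [::] [set ps | factors_as false w ps].

Definition underlying_shape (ps : seq part) : seq nat := map fst ps.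

Definition staircase (k : nat) : seq nat := rev (iota 1 k).

(* The coloring of a shape by z : only parts of size n - 1 carry a color. *)
Definition color_shape (n : nat) (z : color) (sh : seq nat) : seq part :=
  [seq (j, if j == n - 1 then Some z else None) | j <- sh].

Definition lower_interval (n : nat) (w : affD n) : set (affD n) :=
  [set v | min_coset_rep (gens_but n 0) v /\ bruhat_le v w].

Definition poincare (n : nat) (w : affD n) : {poly int} :=
  (\sum_(v \in lower_interval w) ('X^(cox_length v) : {poly int}))%R.

Definition palindromic (n : nat) (w : affD n) : Prop :=
  forall i, (i <= cox_length w)%N ->
    ((poincare w)`_i = (poincare w)`_(cox_length w - i))%R.

(* Main.v *)
Require Import Defs.
From mathcomp Require Import all_boot all_order all_algebra.
From mathcomp Require Import boolp classical_sets fsbigop.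
From mathcomp Require Import zify.

(* W acts on integer labelings of its diagram by the numbers game, and the
   labels of w x, for x dominant, show the left descents of w. In coordinates
   the game for the labeling concentrated on one of the nodes 0, 1 becomes an
   insertion procedure: a segment lets the first coordinate x_1 travel past
   x_2, x_3, ..., x_n, and then past -x_(n-1), ..., -x_2 on its way back, and
   each step is an ascent iff x_1 is larger than what it passes. Between
   consecutive segments the map x_1 -> 1 - x_1, x_n -> - x_n exchanges the
   roles of the nodes 0 and 1. It follows that the elements of W^S are the
   sequences of colored parts in which each part is smaller than the previous
   one, or equal to it if it is at least n - 1. By the subword property,
   containment of such sequences implies Bruhat order.

   A palindromic w <> 1 has as few elements of colength 1 and 2 below it as of
   length 1 and 2, that is, at most one of each. Removing boxes produces two
   such elements unless the shape has one row, or is (n-1)^r, or is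
   (n-1)^r, n-2, ..., 1 or a smaller staircase. For r >= 2 the elements of shape
   (n-1)^r and (n-1)^r, n-2, ..., 1, whose points in coordinates are balanced
   vectors with entries of absolute value c and c + 1, have further elements of
   colength 1 or 2 below them, depending on the residue of r modulo n. For one
   row of length between n and 2n - 3 the two colors of n - 1 break the
   symmetry.

   Conversely one-row elements have explicit lower intervals, and the elements
   below a staircase are the strict partitions with parts at most k, on which
   complementation in {1, ..., k} reverses lengths. The two colors are exchanged
   by a diagram automorphism. *)


Set Implicit Arguments.
Unset Strict Implicit.
Unset Printing Implicit Defensive.

(** * Coxeter groups *)

Section CoxeterGroups.
Local Open Scope group_scope.
Variables (I : choiceType) (m : I -> I -> nat).
Implicit Types (i j : I) (u v w t : coxeter m) (x y : seq I) (J : {pred I}).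

Local Notation W := (coxeter m).
Local Notation s := (cox_gen m).
Local Notation wp := (word_prod m).
Local Notation len w := (@cox_length I m w%g).

Lemma word_prod_nil : wp [::] = 1.
Proof. by rewrite /word_prod big_nil. Qed.

Lemma word_prod_cons i x : wp (i :: x) = s i * wp x.
Proof. by rewrite /word_prod big_cons. Qed.

Lemma word_prod_cat x y : wp (x ++ y) = wp x * wp y.
Proof. by rewrite /word_prod big_cat. Qed.

Lemma word_prod_seq1 i : wp [:: i] = s i.
Proof. by rewrite word_prod_cons word_prod_nil mulg1. Qed.

Lemma word_prod_rcons x i : wp (rcons x i) = wp x * s i.
Proof. by rewrite -cats1 word_prod_cat word_prod_seq1. Qed.

Lemma word_prod_alternating i j k :
  wp (flatten (nseq k [:: i; j])) = (s i * s j) ^+ k.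
Proof.
elim: k => [|k IH]; first exact: word_prod_nil.
by rewrite /= !word_prod_cons IH mulgA expgS.
Qed.

Lemma word_prod_surj w : exists x, wp x = w.
Proof. by exists (repr w); rewrite word_prodE cox_class_repr. Qed.

Lemma word_prod_eqP x y : wp x = wp y <-> cox_equiv m x y.
Proof. by rewrite !word_prodE cox_classP. Qed.

Lemma cox_gen_sq i : s i * s i = 1.
Proof.
rewrite -word_prod_nil -!word_prod_seq1 -word_prod_cat; apply/word_prod_eqP.
exact: (cox_invol _ [::] [::] i).
Qed.

Lemma cox_gen_braid i j : (s i * s j) ^+ m i j = 1.
Proof.
rewrite -word_prod_alternating -word_prod_nil; apply/word_prod_eqP.
by have := cox_braid m [::] [::] i j; rewrite cats0.
Qed.

Lemma cox_genV i : (s i)^-1 = s i.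
Proof. by apply: mulg1_eq; exact: cox_gen_sq. Qed.

Lemma cox_genK i w : s i * (s i * w) = w.
Proof. by rewrite mulgA cox_gen_sq mul1g. Qed.

Lemma cox_genKr i w : w * s i * s i = w.
Proof. by rewrite -mulgA cox_gen_sq mulg1. Qed.

Lemma word_prod_rev x : wp (rev x) = (wp x)^-1.
Proof.
elim: x => [|i x IH]; first by rewrite word_prod_nil invg1.
by rewrite rev_cons word_prod_rcons IH word_prod_cons invgM cox_genV.
Qed.

Lemma cox_reflection_gen i : cox_reflection (s i : W).
Proof. by exists 1, i; rewrite mul1g invg1 mulg1. Qed.

Lemma cox_reflection_sq t : cox_reflection t -> t * t = 1.
Proof. by case=> b [i ->]; rewrite -!mulgA mulKg cox_genK mulgV. Qed.

Lemma reduced_word_exists w : exists2 x, size x = len w & wp x = w.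
Proof. by rewrite /cox_length; case: ex_minnP => k /asboolP. Qed.

Lemma cox_length_word x : (len (wp x) <= size x)%N.
Proof.
rewrite /cox_length; case: ex_minnP => k _; apply; apply/asboolP.
by exists x.
Qed.

Lemma cox_length1 : len 1 = 0%N.
Proof. by apply/eqP; rewrite -leqn0 -word_prod_nil cox_length_word. Qed.

Lemma cox_length_eq0 w : len w = 0%N -> w = 1.
Proof.
move=> w0; have [x + <-] := reduced_word_exists w.
by rewrite w0 => /size0nil ->; exact: word_prod_nil.
Qed.

Lemma cox_lengthV w : len w^-1 = len w.
Proof.
have lenV_le u : (len u^-1 <= len u)%N.
  have [x <- {1}<-] := reduced_word_exists u.
  by rewrite -word_prod_rev -(size_rev x) cox_length_word.
by apply/eqP; rewrite eqn_leq lenV_le -{1}(invgK w) lenV_le.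
Qed.

Lemma cox_lengthM u v : (len (u * v) <= len u + len v)%N.
Proof.
have [x <- <-] := reduced_word_exists u; have [y <- <-] := reduced_word_exists v.
by rewrite -word_prod_cat -size_cat cox_length_word.
Qed.

Lemma odd_size_word x y : wp x = wp y -> odd (size x) = odd (size y).
Proof.
move/word_prod_eqP; elim=> {x y} //= [x y z _ -> _ -> //|x y i|x y i j].
  by rewrite !size_cat /= !oddD /= negbK.
have odd_braid k : odd (size (flatten (nseq k [:: i; j]))) = false.
  by elim: k => //= k IH; rewrite negbK.
by rewrite !size_cat !oddD odd_braid.
Qed.

Lemma odd_cox_length x : odd (len (wp x)) = odd (size x).
Proof. by have [y <-] := reduced_word_exists (wp x) => /odd_size_word. Qed.

Lemma odd_cox_length_reflection w t : cox_reflection t ->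
  odd (len (w * t)) = ~~ odd (len w).
Proof.
case=> b [i ->]; have [x <-] := word_prod_surj w; have [y <-] := word_prod_surj b.
rewrite -word_prod_rev -!word_prod_seq1 -!word_prod_cat !odd_cox_length !size_cat size_rev /=.
by lia.
Qed.

Lemma cox_length_genM i w :
  len (s i * w) = (len w).+1 \/ len w = (len (s i * w)).+1.
Proof.
have le_genM u : (len (s i * u) <= (len u).+1)%N.
  have [x <- <-] := reduced_word_exists u.
  by rewrite -word_prod_cons; exact: (cox_length_word (i :: x)).
have := le_genM w; have := le_genM (s i * w); rewrite cox_genK.
have : odd (len (s i * w)) = ~~ odd (len w).
  by have [x <-] := word_prod_surj w; rewrite -word_prod_cons !odd_cox_length.
by lia.
Qed.

Lemma cox_length_gen i : len (s i) = 1%N.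
Proof. by have := cox_length_genM i 1; rewrite mulg1 cox_length1 => -[]. Qed.

Definition left_ascent i w := (len w < len (s i * w))%N.
Definition right_ascent w i := (len w < len (w * s i))%N.

Lemma left_ascent_length i w : left_ascent i w -> len (s i * w) = (len w).+1.
Proof. by rewrite /left_ascent; case: (cox_length_genM i w); lia. Qed.

Lemma left_descent_length i w : ~~ left_ascent i w -> len w = (len (s i * w)).+1.
Proof. by rewrite /left_ascent; case: (cox_length_genM i w); lia. Qed.

Lemma left_ascent_genM i w : left_ascent i (s i * w) = ~~ left_ascent i w.
Proof.
by rewrite /left_ascent cox_genK; case: (cox_length_genM i w); lia.
Qed.

Lemma left_ascentV i w : left_ascent i w^-1 = right_ascent w i.
Proof.
by rewrite /left_ascent -(cox_lengthV (s i * _)) invgM invgK cox_genV cox_lengthV.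
Qed.

Lemma right_descent_length w i :
  ~~ right_ascent w i -> len w = (len (w * s i)).+1.
Proof.
rewrite -left_ascentV => /left_descent_length.
by rewrite -(cox_lengthV (s i * _)) invgM invgK cox_genV cox_lengthV.
Qed.

Lemma left_descent_exists w : w <> 1 -> exists i, ~~ left_ascent i w.
Proof.
have [[|i x] size_x xw] := reduced_word_exists w; first by rewrite -xw word_prod_nil.
move=> _; exists i; rewrite /left_ascent -leqNgt -size_x -xw word_prod_cons cox_genK.
exact: leqW (cox_length_word x).
Qed.

Lemma right_descent_exists w : w <> 1 -> exists i, ~~ right_ascent w i.
Proof.
move=> w_neq1; have [|i] := @left_descent_exists w^-1.
  by move/eqP; rewrite invg_eq1 => /eqP.
by rewrite left_ascentV; exists i.
Qed.

Lemma left_ascent_commute i j w : m i j = 2 ->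
  left_ascent i (s j * w) -> left_ascent j w -> left_ascent i w.
Proof.
move=> mij up_i up_j; apply: contraLR up_i => /left_descent_length down_i.
have comm : s i * s j = s j * s i.
  apply: (mulIg (s i * s j)); rewrite -[LHS]/((s i * s j) ^+ 2) -mij cox_gen_braid.
  by rewrite -!mulgA cox_genK cox_gen_sq.
have -> : left_ascent i (s j * w) = (len (s j * w) < len (s j * (s i * w)))%N.
  by rewrite /left_ascent mulgA comm -mulgA.
by have := cox_lengthM (s j) (s i * w); rewrite cox_length_gen (left_ascent_length up_j); lia.
Qed.

Lemma left_ascent_braid i j w : m i j = 3 -> left_ascent i w ->
  left_ascent j (s i * w) -> left_ascent i (s j * (s i * w)) -> left_ascent j w.
Proof.
move=> mij up_i up_j up_iji; apply: contraLR up_iji => /left_descent_length down_j.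
have braid : s i * s j * s i = s j * s i * s j.
  apply: (mulIg (s j * s i * s j)).
  rewrite (_ : _ * _ = (s i * s j) ^+ 3); last by rewrite !expgS expg0 mulg1 !mulgA.
  by rewrite -mij cox_gen_braid -!mulgA !(cox_genK, cox_gen_sq).
rewrite /left_ascent (left_ascent_length up_j) (left_ascent_length up_i).
have -> : s i * (s j * (s i * w)) = s j * s i * (s j * w).
  by rewrite !mulgA braid.
have := cox_lengthM (s j * s i) (s j * w); have := cox_lengthM (s j) (s i).
by rewrite !cox_length_gen; lia.
Qed.

(* The reflections t for which multiplying the product of x by t on the right
   amounts to deleting one letter. *)
Fixpoint word_refls x : seq W :=
  if x is i :: x' then s i ^ wp x' :: word_refls x' else [::].

Definition refl_parity x t := odd (count_mem t (word_refls x)).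

Lemma word_refls_cat x y :
  word_refls (x ++ y) = [seq t ^ wp y | t <- word_refls x] ++ word_refls y.
Proof. by elim: x => //= i x ->; rewrite word_prod_cat conjgM. Qed.

Lemma refl_parity_cat x y t :
  refl_parity (x ++ y) t = refl_parity x (t ^ (wp y)^-1) (+) refl_parity y t.
Proof.
rewrite /refl_parity word_refls_cat count_cat oddD count_map; congr (odd _ (+) _).
by apply: eq_count => r /=; rewrite (can2_eq (conjgK _) (conjgKV _)).
Qed.

Lemma word_refls_alternating i j k :
  word_refls (flatten (nseq k [:: i; j])) =
  rev (mkseq (fun p => (s i * s j) ^- p * s j) (k + k)).
Proof.
pose a := (s i * s j)^-1.
have aE : a = s j * s i by rewrite /a invgM !cox_genV.
have conj_gen l : a ^+ l * s j = s j * (s i * s j) ^+ l.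
  elim: l => [|l IH]; first by rewrite mul1g mulg1.
  by rewrite expgS -mulgA IH aE expgS !mulgA.
rewrite (eq_mkseq (g := fun p => a ^+ p * s j)); last by move=> p; rewrite expVgn.
elim: k => [|k IH] //; rewrite addnS addSn !mkseqS !rev_rcons -IH /=.
rewrite word_prod_cons word_prod_alternating; congr [:: _, _ & _].
  rewrite conjgE invgM cox_genV -expVgn -/a -conj_gen !mulgA.
  by rewrite -(mulgA (a ^+ k) (s j) (s i)) -aE -expgSr -expgnDr addSn.
by rewrite conjgE -expVgn -/a -conj_gen mulgA -expgnDr.
Qed.

Lemma refl_parity_periodic i j k t : (s i * s j) ^+ k = 1 ->
  refl_parity (flatten (nseq k [:: i; j])) t = false.
Proof.
move=> k_period; rewrite /refl_parity word_refls_alternating count_rev /mkseq.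
have -> : iota 0 (k + k) = iota 0 k ++ map (addn k) (iota 0 k).
  by rewrite iotaD -iotaDl addn0.
rewrite map_cat -map_comp count_cat oddD.
rewrite (eq_map (g := fun p => (s i * s j) ^- p * s j)) ?addbb // => p /=.
by rewrite expgnDr k_period mul1g.
Qed.

Lemma refl_parity_equiv x y : cox_equiv m x y -> refl_parity x =1 refl_parity y.
Proof.
have cancel_mid x' y' z t : wp z = 1 -> (forall r, refl_parity z r = false) ->
    refl_parity (x' ++ z ++ y') t = refl_parity (x' ++ y') t.
  by move=> z1 z0; rewrite !refl_parity_cat word_prod_cat z1 mul1g z0 addFb.
elim=> {x y} [//|x y _ IH t|x y z _ IHxy _ IHyz t|x y i t|x y i j t].
- by rewrite IH.
- by rewrite IHxy.
- have square_word : [:: i; i] = flatten (nseq 1 [:: i; i]) by [].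
  apply: cancel_mid => [|r]; rewrite square_word.
    by rewrite word_prod_alternating expg1 cox_gen_sq.
  by apply: refl_parity_periodic; rewrite expg1 cox_gen_sq.
- apply: cancel_mid => [|r]; first by rewrite word_prod_alternating cox_gen_braid.
  exact: refl_parity_periodic (cox_gen_braid i j).
Qed.

Lemma mem_word_refls x t : t \in word_refls x ->
  exists x1 i x2, x = x1 ++ i :: x2 /\ wp x * t = wp (x1 ++ x2).
Proof.
elim: x => //= i x IH; rewrite inE => /orP[/eqP->|/IH[x1 [j [x2 [-> del]]]]].
  exists [::], i, x; split=> //.
  by rewrite word_prod_cons conjgE !mulgA mulgK cox_gen_sq mul1g.
by exists (i :: x1), j, x2; split=> //; rewrite /= !word_prod_cons -mulgA del.
Qed.

Lemma refl_parity_reflection x t : cox_reflection t -> wp x = t -> refl_parity x t.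
Proof.
case=> b [i ->]; have [y <-] := word_prod_surj b => xE.
have /refl_parity_equiv-> : cox_equiv m x (y ++ [:: i] ++ rev y).
  by apply/word_prod_eqP; rewrite xE !word_prod_cat word_prod_seq1 word_prod_rev mulgA.
have conj_t : (wp y * s i * (wp y)^-1) ^ wp y = s i.
  by rewrite conjgE -!mulgA mulKg mulVg mulg1.
have : refl_parity (y ++ rev y) (wp y * s i * (wp y)^-1) = false.
  by rewrite (refl_parity_equiv (cox_equiv_revK m y)).
rewrite !refl_parity_cat word_prod_cat word_prod_seq1 word_prod_rev invgM invgK cox_genV.
rewrite conjgM !conj_t conjgE cox_genV cox_genK.
by rewrite /refl_parity /= word_prod_nil conjg1 eqxx; case: odd; case: odd.
Qed.

Lemma strong_exchange w t x : cox_reflection t -> (len (w * t) < len w)%N -> wp x = w ->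
  exists x1 i x2, x = x1 ++ i :: x2 /\ w * t = wp (x1 ++ x2).
Proof.
move=> t_refl lt_wt xw; rewrite -xw; apply: mem_word_refls.
rewrite -has_pred1 has_count; apply: odd_gt0; rewrite -/(refl_parity x t).
apply: contraPT lt_wt => even_x; apply/negP; rewrite -leqNgt.
have [y size_y yE] := reduced_word_exists (w * t); have [z zE] := word_prod_surj t.
have odd_y : refl_parity y t.
  rewrite (@refl_parity_equiv y (x ++ z)); last first.
    by apply/word_prod_eqP; rewrite yE word_prod_cat xw zE.
  rewrite refl_parity_cat zE conjgE invgK mulgV mulg1 (negbTE even_x) addFb.
  exact: refl_parity_reflection.
have /mem_word_refls[y1 [i [y2 [y12 del]]]] : t \in word_refls y.
  by rewrite -has_pred1 has_count odd_gt0.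
have := cox_length_word (y1 ++ y2); rewrite -del yE -mulgA cox_reflection_sq // mulg1.
by move: size_y; rewrite y12 !size_cat /=; lia.
Qed.

Lemma left_exchange i w x : ~~ left_ascent i w -> wp x = w ->
  exists x1 j x2, x = x1 ++ j :: x2 /\ s i * w = wp (x1 ++ x2).
Proof.
move=> /left_descent_length down; have -> : s i * w = w * (w^-1 * s i * w).
  by rewrite !mulgA mulgV mul1g.
apply: strong_exchange; first by exists w^-1, i; rewrite invgK.
by rewrite !mulgA mulgV mul1g [ltnRHS]down.
Qed.

Lemma subword_shorter x : (len (wp x) < size x)%N ->
  exists y : seq I, [/\ subseq y x, (size y < size x)%N & wp y = wp x].
Proof.
elim: x => [|i x IHx] //= lt_x; rewrite word_prod_cons in lt_x *.
have [lt_x'|size_x] := ltnP (len (wp x)) (size x).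
  have [y [sub_yx lt_yx yE]] := IHx lt_x'; exists (i :: y).
  by split; rewrite ?eqxx // word_prod_cons yE.
have [|x1 [j [x2 [xE del]]]] := @left_exchange i (wp x) x _ erefl.
  by rewrite -leqNgt (leq_trans _ size_x).
exists (x1 ++ x2); split; last by rewrite del.
  rewrite xE -cat_rcons; apply: (@cat_subseq _ x1 x2 (i :: rcons x1 j)) => //.
  by apply: subseq_trans (subseq_cons _ _); rewrite -cats1 prefix_subseq.
by rewrite xE !size_cat /=; lia.
Qed.

Lemma reduced_subword x :
  exists y : seq I, [/\ subseq y x, wp y = wp x & size y = len (wp x)].
Proof.
have [k] := ubnP (size x); elim: k x => // k IHk x lexk.
have := cox_length_word x; rewrite leq_eqVlt => /orP[/eqP red_x|]; first by exists x.
case/subword_shorter => y [sub_yx lt_yx yE].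
have [|z [sub_zy zE size_z]] := IHk y; first exact: leq_trans lt_yx lexk.
by exists z; rewrite -yE; split=> //; exact: subseq_trans sub_yx.
Qed.

Lemma reduced_behead i x : len (s i * wp x) = (size x).+1 -> len (wp x) = size x.
Proof. by have := cox_length_word x; case: (cox_length_genM i (wp x)); lia. Qed.

(** * Parabolic subgroups and Bruhat order *)

Lemma parabolic1 J : parabolic J (1 : W).
Proof. by exists [::]; rewrite ?word_prod_nil. Qed.

Lemma parabolicM J u v : parabolic J u -> parabolic J v -> parabolic J (u * v).
Proof.
move=> [x Jx <-] [y Jy <-].
by exists (x ++ y); rewrite ?all_cat ?Jx ?word_prod_cat.
Qed.

Lemma parabolicV J u : parabolic J u -> parabolic J u^-1.
Proof. by move=> [x Jx <-]; exists (rev x); rewrite ?all_rev ?word_prod_rev. Qed.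

Lemma parabolic_gen J i : i \in J -> parabolic J (s i).
Proof. by move=> Ji; exists [:: i]; rewrite ?word_prod_seq1 /= ?andbT. Qed.

Lemma parabolic_reduced J v : parabolic J v ->
  exists x, [/\ all (mem J) x, wp x = v & size x = len v].
Proof.
move=> [x Jx <-]; have [y [sub_yx yE size_y]] := reduced_subword x; exists y; split=> //.
by apply/allP => i /(mem_subseq sub_yx); exact: (allP Jx).
Qed.

Lemma min_coset_repM J u v : min_coset_rep J u -> parabolic J v ->
  len (u * v) = (len u + len v)%N.
Proof.
move=> uJ vJ; have [x size_x xu] := reduced_word_exists u.
have [y [Jy yv size_y]] := parabolic_reduced vJ.
have [z [/subseqP[b size_b zE] z_prod size_z]] := reduced_subword (x ++ y).
rewrite word_prod_cat xu yv in z_prod size_z.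
move: zE; rewrite -(cat_take_drop (size x) b) mask_cat; last first.
  by rewrite size_takel // size_b size_cat leq_addr.
set z1 := mask _ x; set z2 := mask _ y => zE.
have z2J : parabolic J (wp z2).
  by exists z2 => //; apply/allP => i /mem_mask; exact: (allP Jy).
have z1E : wp z1 = u * (v * (wp z2)^-1).
  by rewrite mulgA -z_prod zE word_prod_cat mulgK.
have le_u_z1 : (len u <= size z1)%N.
  apply: leq_trans (cox_length_word z1); rewrite z1E; apply: uJ.
  exact: parabolicM vJ (parabolicV z2J).
have z1x : z1 = x.
  apply/eqP; rewrite -(size_subseq_leqif (mask_subseq _ _)) eqn_leq -/z1 size_x le_u_z1.
  by rewrite andbT -size_x size_subseq // mask_subseq.
have z2v : wp z2 = v.
  by apply: (mulgI u); rewrite -z_prod zE word_prod_cat z1x xu.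
apply/eqP; rewrite eqn_leq cox_lengthM -size_z zE size_cat z1x size_x leq_add2l.
by rewrite -z2v cox_length_word.
Qed.

Lemma parabolic_decomp J w : exists u v,
  [/\ w = u * v, min_coset_rep J u, parabolic J v & len w = (len u + len v)%N].
Proof.
pose P := [pred k | `[< exists2 v, parabolic J v & len (w * v) = k >]].
have exP : exists k, P k.
  by exists (len w); apply/asboolP; exists 1; rewrite ?mulg1 //; exact: parabolic1.
case: (ex_minnP exP) => k /asboolP[v vJ lenk] kmin.
have wvJ : min_coset_rep J (w * v).
  move=> v' v'J; rewrite lenk; apply: kmin; apply/asboolP.
  by exists (v * v'); rewrite ?mulgA //; exact: parabolicM.
exists (w * v), v^-1; split=> //; first by rewrite mulgK.
  exact: parabolicV.
by rewrite -(min_coset_repM wvJ (parabolicV vJ)) mulgK.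
Qed.

Lemma min_coset_rep_eq1 J u v : min_coset_rep J u -> min_coset_rep J (u * v) ->
  parabolic J v -> v = 1.
Proof.
move=> uJ uvJ vJ; apply: cox_length_eq0.
have := min_coset_repM uJ vJ; have := min_coset_repM uvJ (parabolicV vJ).
by rewrite mulgK; lia.
Qed.

Lemma parabolic_decomp_uniq J u v u' v' :
  min_coset_rep J u -> min_coset_rep J u' -> parabolic J v -> parabolic J v' ->
  u * v = u' * v' -> u = u' /\ v = v'.
Proof.
move=> uJ u'J vJ v'J uvE.
have u'E : u' = u * (v * v'^-1) by rewrite mulgA uvE mulgK.
have vv' : v * v'^-1 = 1.
  apply: min_coset_rep_eq1 uJ _ _; first by rewrite -u'E.
  exact: parabolicM (parabolicV _).
split; first by rewrite u'E vv' mulg1.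
by rewrite -[v'](mul1g) -vv' mulgVK.
Qed.

Lemma min_coset_rep_right_ascent J w i : min_coset_rep J w -> i \in J -> right_ascent w i.
Proof.
by move=> wJ Ji; rewrite /right_ascent (min_coset_repM wJ (parabolic_gen Ji)) cox_length_gen addn1.
Qed.

Lemma right_ascent_min_coset_rep J w :
  (forall i, i \in J -> right_ascent w i) -> min_coset_rep J w.
Proof.
move=> up; have [u [v [wE uJ vJ _]]] := parabolic_decomp J w.
suff v1 : v = 1 by rewrite wE v1 mulg1.
have [x [Jx xv size_x]] := parabolic_reduced vJ.
case/lastP: x => [|x i] in Jx xv size_x; first by rewrite -xv word_prod_nil.
move: Jx; rewrite all_rcons => /andP[Ji Jx].
have vsi : v * s i = wp x by rewrite -xv word_prod_rcons cox_genKr.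
have := up i Ji; rewrite /right_ascent wE -mulgA !(min_coset_repM uJ) //; last first.
  exact: parabolicM (parabolic_gen _).
rewrite ltn_add2l vsi -size_x size_rcons => /leq_trans/(_ (cox_length_word x)).
by rewrite ltnNge leqnSn.
Qed.

Lemma min_coset_rep1 J : min_coset_rep J (1 : W).
Proof. by move=> v _; rewrite cox_length1. Qed.

Lemma min_coset_rep_suffix J u v : len (u * v) = (len u + len v)%N ->
  min_coset_rep J (u * v) -> min_coset_rep J v.
Proof.
move=> len_uv uvJ v' v'J; have := uvJ v' v'J; rewrite len_uv -mulgA.
by move/leq_trans/(_ (cox_lengthM _ _)); rewrite leq_add2l.
Qed.

Lemma min_coset_rep_genM J w i : min_coset_rep J w ->
  min_coset_rep J (s i * w) \/ exists2 j, j \in J & s i * w = w * s j.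
Proof.
move=> wJ; have [up|/left_descent_length down] := boolP (left_ascent i w); last first.
  left; apply: (@min_coset_rep_suffix J (s i)); rewrite cox_genK //.
  by rewrite cox_length_gen.
have [[j Jj down_j]|no_descent] := pselect (exists2 j, j \in J & ~~ right_ascent (s i * w) j).
  right; exists j => //; have [x size_x xw] := reduced_word_exists w.
  have lt_j : (len (s i * w * s j) < len (s i * w))%N.
    by rewrite [ltnRHS](right_descent_length down_j).
  have ixE : wp (i :: x) = s i * w by rewrite word_prod_cons xw.
  have [x1 [k [x2 [+ del]]]] := strong_exchange (cox_reflection_gen j) lt_j ixE.
  case: x1 del => [|k' x1] del [ik xE].
    by apply: (mulIg (s j)); rewrite del -xE xw cox_genKr.
  have wsjE : w * s j = wp (x1 ++ x2).
    by apply: (mulgI (s i)); rewrite mulgA del ik -word_prod_cons.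
  have := min_coset_rep_right_ascent wJ Jj; rewrite /right_ascent wsjE.
  by have := cox_length_word (x1 ++ x2); move: size_x; rewrite xE !size_cat /=; lia.
left; apply: right_ascent_min_coset_rep => j Jj; apply/negPn/negP => down_j.
by apply: no_descent; exists j.
Qed.

Lemma bruhat_trans u v w : bruhat_le u v -> bruhat_le v w -> bruhat_le u w.
Proof. by move=> le_uv; elim=> // w' t _ IH tR; exact: bruhat_step IH tR. Qed.

Lemma bruhat_length u w : bruhat_le u w -> (len u <= len w)%N.
Proof. by elim=> // v t _ le_uv _ lt_v; exact: leq_trans le_uv (ltnW lt_v). Qed.

Lemma bruhat_eq u w : bruhat_le u w -> len u = len w -> u = w.
Proof. by case=> // v t /bruhat_length le_uv _ lt_v; lia. Qed.

Lemma bruhat_left_ascent i w : left_ascent i w -> bruhat_le w (s i * w).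
Proof.
have -> : s i * w = w * s i ^ w by rewrite conjgE mulVKg.
move=> up; apply: bruhat_step (bruhat_refl _) _ _.
  by exists w^-1, i; rewrite invgK conjgE mulgA.
by rewrite conjgE mulVKg.
Qed.

Lemma reflection_step_genM i v t : cox_reflection t -> (len v < len (v * t))%N ->
  s i * v = v * t \/ (len (s i * v) < len (s i * (v * t)))%N.
Proof.
move=> t_refl lt_v; have [|le_len] := ltnP (len (s i * v)) (len (s i * (v * t))); first by right.
have odd_svt : odd (len (s i * (v * t))) = ~~ odd (len (s i * v)).
  by rewrite mulgA; exact: odd_cox_length_reflection.
have [lt_len up_v] : (len (s i * (v * t)) < len (s i * v))%N /\ len (s i * v) = (len v).+1.
  by case: (cox_length_genM i v); case: (cox_length_genM i (v * t)); lia.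
rewrite mulgA in lt_len.
have [x size_x xv] := reduced_word_exists v.
have ixE : wp (i :: x) = s i * v by rewrite word_prod_cons xv.
have [x1 [k [x2 [+ del]]]] := strong_exchange t_refl lt_len ixE.
case: x1 del => [|k' x1] del [ik xE].
  by left; apply: (mulgI (s i)); rewrite cox_genK mulgA del -xE xv.
have vtE : v * t = wp (x1 ++ x2) by apply: (mulgI (s i)); rewrite mulgA del ik -word_prod_cons.
have := cox_length_word (x1 ++ x2); rewrite -vtE.
by move: size_x; rewrite xE !size_cat /=; lia.
Qed.

Lemma bruhat_genM i u v : bruhat_le u v ->
  bruhat_le (s i * u) v \/ bruhat_le (s i * u) (s i * v).
Proof.
elim=> [|v' t le_uv IH t_refl lt_v]; first by right; exact: bruhat_refl.
have [le_sv|le_ssv] := IH; first by left; exact: bruhat_step le_sv t_refl lt_v.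
have [vtE|lt_sv] := reflection_step_genM i t_refl lt_v; first by left; rewrite -vtE.
by right; rewrite mulgA; apply: bruhat_step le_ssv t_refl _; rewrite -mulgA.
Qed.

Lemma bruhat_subword x y : len (wp x) = size x -> len (wp y) = size y ->
  subseq x y -> bruhat_le (wp x) (wp y).
Proof.
elim: y x => [|j y IH] x red_x.
  by case: x red_x => // _ _ _; exact: bruhat_refl.
rewrite word_prod_cons => red_jy; have red_y := reduced_behead red_jy.
have up_y : left_ascent j (wp y) by rewrite /left_ascent red_jy red_y.
case: x red_x => [|i x] red_x /=.
  by move=> _; apply: bruhat_trans (IH [::] red_x red_y (sub0seq _)) (bruhat_left_ascent up_y).
case: eqP => [ij|_] sub_xy; last first.
  exact: bruhat_trans (IH _ red_x red_y sub_xy) (bruhat_left_ascent up_y).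
rewrite word_prod_cons ij in red_x *.
have [|//] := bruhat_genM j (IH x (reduced_behead red_x) red_y sub_xy).
by move/bruhat_trans; apply; exact: bruhat_left_ascent.
Qed.

Lemma bruhat_parabolic J u w : bruhat_le u w -> parabolic J w -> parabolic J u.
Proof.
elim=> // v t _ IH t_refl lt_v /parabolic_reduced[x [Jx xE _]]; apply: IH.
have vtt : v * t * t = v by rewrite -mulgA cox_reflection_sq // mulg1.
have [|x1 [i [x2 [x12 del]]]] := @strong_exchange (v * t) t x t_refl _ xE.
  by rewrite vtt.
rewrite -vtt del; exists (x1 ++ x2) => //.
by move: Jx; rewrite x12 !all_cat /= => /and3P[-> _ ->].
Qed.

Lemma reduced_word_letters J x : injective s -> size x = len (wp x) ->
  parabolic J (wp x) -> all (mem J) x.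
Proof.
move=> s_inj; elim: x => // i x IH; rewrite word_prod_cons => size_x Jx.
have red_x : size x = len (wp x) by rewrite (reduced_behead (esym size_x)).
have Jx' : parabolic J (wp x).
  have [y [Jy yE _]] := parabolic_reduced Jx.
  have [|y1 [j [y2 [y12 del]]]] := @left_exchange i (s i * wp x) y _ yE.
    by rewrite left_ascent_genM negbK /left_ascent -size_x /= red_x.
  rewrite cox_genK in del; exists (y1 ++ y2) => //.
  by move: Jy; rewrite y12 !all_cat /= => /and3P[-> _ ->].
apply/andP; split; last exact: IH.
have : parabolic J (s i).
  by rewrite -[s i](mulgK (wp x)); exact: parabolicM (parabolicV _).
case/parabolic_reduced => y [Jy yE]; rewrite cox_length_gen.
case: y Jy yE => [|j []] //=; rewrite andbT word_prod_seq1 => Jj /s_inj <- _ //.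
Qed.

(** * Diagram automorphisms *)

Section DiagramAutomorphism.
Variable f : I -> I.
Hypothesis fK : involutive f.
Hypothesis m_f : forall i j, m (f i) (f j) = m i j.

Definition cox_map w : W := wp (map f (repr w)).

Lemma cox_equiv_map x y : cox_equiv m x y -> cox_equiv m (map f x) (map f y).
Proof.
elim=> {x y} [x|x y _ IH|x y z _ IHxy _ IHyz|x y i|x y i j].
- exact: cox_refl.
- exact: cox_sym.
- exact: cox_trans IHxy IHyz.
- by rewrite !map_cat; exact: cox_invol.
- by rewrite !map_cat map_flatten map_nseq /= -m_f; exact: cox_braid.
Qed.

Lemma cox_map_word x : cox_map (wp x) = wp (map f x).
Proof.
apply/word_prod_eqP/cox_equiv_map/cox_classP.
by rewrite cox_class_repr word_prodE.
Qed.

Lemma cox_mapM u v : cox_map (u * v) = cox_map u * cox_map v.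
Proof.
have [x <-] := word_prod_surj u; have [y <-] := word_prod_surj v.
by rewrite -word_prod_cat !cox_map_word map_cat word_prod_cat.
Qed.

Lemma cox_mapV u : cox_map u^-1 = (cox_map u)^-1.
Proof.
have [x <-] := word_prod_surj u.
by rewrite -word_prod_rev !cox_map_word map_rev word_prod_rev.
Qed.

Lemma cox_mapK : involutive cox_map.
Proof. by move=> u; have [x <-] := word_prod_surj u; rewrite !cox_map_word mapK. Qed.

Lemma cox_length_map u : len (cox_map u) = len u.
Proof.
have len_map_le w : (len (cox_map w) <= len w)%N.
  have [x <- {1}<-] := reduced_word_exists w.
  by rewrite cox_map_word -(size_map f x) cox_length_word.
by apply/eqP; rewrite eqn_leq len_map_le -{1}(cox_mapK u) len_map_le.
Qed.

Lemma cox_reflection_map t : cox_reflection t -> cox_reflection (cox_map t).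
Proof.
case=> b [i ->]; exists (cox_map b), (f i).
by rewrite !cox_mapM cox_mapV -!word_prod_seq1 cox_map_word.
Qed.

Lemma bruhat_map u w : bruhat_le u w -> bruhat_le (cox_map u) (cox_map w).
Proof.
elim=> [|v t _ IH t_refl lt_v]; first exact: bruhat_refl.
rewrite cox_mapM; apply: bruhat_step IH (cox_reflection_map t_refl) _.
by rewrite -cox_mapM !cox_length_map.
Qed.

Lemma min_coset_rep_map J w : (forall i, (f i \in J) = (i \in J)) ->
  min_coset_rep J w -> min_coset_rep J (cox_map w).
Proof.
move=> fJ wJ v [x Jx <-]; rewrite -(cox_mapK (wp x)) -cox_mapM !cox_length_map cox_map_word.
by apply: wJ; exists (map f x); rewrite // all_map (eq_all (a2 := mem J)).
Qed.

End DiagramAutomorphism.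
End CoxeterGroups.

(** * The numbers game on simply laced diagrams *)

Definition simply_laced (I : finType) (m : I -> I -> nat) : Prop :=
  [/\ forall i, m i i = 1%N, forall i j, m i j = m j i
    & forall i j, i != j -> m i j = 2 \/ m i j = 3].

Section NumbersGame.
Local Open Scope group_scope.
Import GRing.Theory Num.Theory Order.TTheory.
Variables (I : finType) (m : I -> I -> nat).
Hypothesis laced : simply_laced m.
Implicit Types (i j k e : I) (u v w : coxeter m) (x y : seq I) (c : I -> int) (J : {pred I}).

Local Notation s := (cox_gen m).
Local Notation wp := (word_prod m).
Local Notation len w := (@cox_length I m w%g).

Let m_diag i : m i i = 1%N.
Proof. by case: laced. Qed.

Let m_sym i j : m i j = m j i.
Proof. by case: laced. Qed.

Let m_laced i j : i != j -> m i j = 2 \/ m i j = 3.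
Proof. by case: laced => _ _; apply. Qed.

Definition fire i c : I -> int :=
  fun j => if j == i then (- c i)%R else if m i j == 3 then (c j + c i)%R else c j.

Definition game x c := foldr fire c x.

Lemma game_cat x y c : game (x ++ y) c = game x (game y c).
Proof. exact: foldr_cat. Qed.

Lemma fireK i : involutive (fire i).
Proof.
move=> c; apply/funext => j; rewrite /fire eqxx.
by case: eqP => [->|_]; [rewrite opprK | case: (m i j == 3) => //=; lia].
Qed.

Lemma fire_neq i j c : i != j -> fire j c i = if m i j == 3 then (c i + c j)%R else c i.
Proof. by move=> /negbTE ne_ij; rewrite /fire ne_ij m_sym. Qed.

Lemma fire_eq0 i c : c i = 0%R -> fire i c = c.
Proof.
move=> ci0; apply/funext => j; rewrite /fire ci0 oppr0 addr0.
by case: eqP => [->|_]; rewrite ?ci0 //; case: ifP.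
Qed.

Lemma game_braid i j c : game (flatten (nseq (m i j) [:: i; j])) c = c.
Proof.
have [<-|ne_ij] := eqVneq i j; first by rewrite m_diag /= fireK.
have ne_ji : (j == i) = false by rewrite eq_sym (negbTE ne_ij).
have mji := m_sym j i.
case: (m_laced ne_ij) => mij; rewrite mij in mji; rewrite mij /=; apply/funext => k;
  rewrite /fire !eqxx (negbTE ne_ij) ne_ji mij mji /=;
  (case: (eqVneq k i) => [->|ki]; last case: (eqVneq k j) => [->|kj]);
  rewrite ?eqxx ?(negbTE ne_ij) ?ne_ji ?mij ?mji /=;
  try (case: (m i k == 3); case: (m j k == 3)); rewrite /=; lia.
Qed.

Lemma game_equiv x y : wp x = wp y -> game x = game y.
Proof.
move/word_prod_eqP; elim=> {x y} [//|x y _ -> //|x y z _ -> _ -> //|x y i|x y i j];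
  apply/funext => c; rewrite !game_cat; congr game.
  exact: fireK.
exact: game_braid.
Qed.

Definition cox_game w := game (repr w).

Lemma cox_gameE x : cox_game (wp x) = game x.
Proof. by apply: game_equiv; rewrite [LHS]word_prodE cox_class_repr. Qed.

Lemma cox_gameM u v c : cox_game (u * v) c = cox_game u (cox_game v c).
Proof.
have [x <-] := word_prod_surj u; have [y <-] := word_prod_surj v.
by rewrite -word_prod_cat !cox_gameE game_cat.
Qed.

Lemma cox_game1 c : cox_game 1 c = c.
Proof. by rewrite -word_prod_nil cox_gameE. Qed.

Lemma cox_game_gen i c : cox_game (s i) c = fire i c.
Proof. by rewrite -word_prod_seq1 cox_gameE. Qed.

(* Induction on the length of w = s_j w', inside the dihedral group of s_i and
   s_j: the label at i is a sum of labels at ascents of w' or of s_i w'. *)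
Lemma cox_game_sign (P : int -> bool) c w i :
  (forall a b : int, P a -> P b -> P (a + b)%R) -> (forall j, P (c j)) ->
  left_ascent i w -> P (cox_game w c i).
Proof.
move=> PD Pc; have [k] := ubnP (len w); elim: k w i => // k IH w i lewk up_i.
have [->|/eqP w_neq1] := eqVneq w 1; first by rewrite cox_game1.
have [j down_j] := left_descent_exists w_neq1.
have ne_ij : i != j by apply: contraTneq up_i => ->.
have [w' wE] : exists w', w = s j * w' by exists (s j * w); rewrite cox_genK.
have up_j : left_ascent j w' by rewrite -[_ j w']negbK -left_ascent_genM -wE.
have len_w : len w = (len w').+1 by rewrite wE left_ascent_length.
have Pj : P (cox_game w' c j) by apply: IH up_j; rewrite -ltnS -len_w.
rewrite wE cox_gameM cox_game_gen fire_neq //.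
have [up_i'|down_i'] := boolP (left_ascent i w').
  have Pi : P (cox_game w' c i) by apply: IH up_i'; rewrite -ltnS -len_w.
  by case: ifP => // _; exact: PD.
rewrite wE in up_i; case: (m_laced ne_ij) => mij.
  by case/negP: down_i'; exact: left_ascent_commute up_i up_j.
have [w2 w'E] : exists w2, w' = s i * w2 by exists (s i * w'); rewrite cox_genK.
have up_i2 : left_ascent i w2 by rewrite w'E left_ascent_genM negbK in down_i'.
have up_j2 : left_ascent j w2.
  by rewrite w'E in up_i up_j; exact: left_ascent_braid up_i2 up_j up_i.
have -> : (cox_game w' c i + cox_game w' c j = cox_game w2 c j)%R.
  rewrite w'E cox_gameM cox_game_gen {1}/fire eqxx fire_neq 1?eq_sym //.
  by rewrite m_sym mij /=; lia.
rewrite mij /=; apply: IH up_j2.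
by move: lewk; rewrite len_w w'E (left_ascent_length up_i2); lia.
Qed.

Lemma cox_game_ge0 c w i : (forall j, 0 <= c j)%R ->
  left_ascent i w -> (0 <= cox_game w c i)%R.
Proof.
by move=> c0; apply: (cox_game_sign (P := fun a => 0 <= a)%R) => // a b; exact: addr_ge0.
Qed.

Lemma cox_game_gt0 c w i : (forall j, 0 < c j)%R ->
  left_ascent i w -> (0 < cox_game w c i)%R.
Proof.
by move=> c0; apply: (cox_game_sign (P := fun a => 0 < a)%R) => // a b; exact: addr_gt0.
Qed.

Lemma cox_game_le0 c w i : (forall j, 0 <= c j)%R ->
  ~~ left_ascent i w -> (cox_game w c i <= 0)%R.
Proof.
rewrite -left_ascent_genM => c0 /(cox_game_ge0 c0).
by rewrite cox_gameM cox_game_gen /fire eqxx oppr_ge0.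
Qed.

Lemma right_ascent_game c w i : (forall j, 0 < c j)%R ->
  (0 <= cox_game w^-1%g c i)%R -> right_ascent w i.
Proof.
rewrite -left_ascentV => c0; apply: contraLR; rewrite -left_ascent_genM -ltNge.
by move/(cox_game_gt0 c0); rewrite cox_gameM cox_game_gen /fire eqxx oppr_gt0.
Qed.

Lemma cox_gen_inj : injective s.
Proof.
move=> i j eq_ij; have := cox_game_gen i (fun=> 1%R); rewrite eq_ij cox_game_gen.
move/(congr1 (@^~ i)); rewrite /fire eqxx; case: eqVneq => // _.
by case: ifP.
Qed.

Definition delta e : I -> int := fun j => ((j == e)%:R)%R.

Lemma delta_ge0 e j : (0 <= delta e j)%R.
Proof. exact: ler0n. Qed.

Lemma fire_sum i c (F : I -> I -> int) :
  fire i (fun j => \sum_l c l * F l j)%R = (fun j => \sum_l c l * fire i (F l) j)%R.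
Proof.
apply/funext => j; rewrite /fire; case: eqP => _; last case: ifP => _ //.
  by rewrite -sumrN; apply: eq_bigr => l _; rewrite mulrN.
by rewrite -big_split; apply: eq_bigr => l _; rewrite mulrDr.
Qed.

Lemma cox_game_sum w c k : cox_game w c k = (\sum_l c l * cox_game w (delta l) k)%R.
Proof.
have [x <-] := word_prod_surj w; rewrite cox_gameE; elim: x k => [|i x IH] k.
  rewrite (bigD1 k) //= /delta eqxx mulr1 big1 ?addr0 // => l ne_lk.
  by rewrite eq_sym (negbTE ne_lk) mulr0.
have gE : game x c = (fun j => \sum_l c l * game x (delta l) j)%R by apply/funext.
by rewrite /= gE fire_sum.
Qed.

Lemma cox_game_parabolic J v c : (forall i, i \in J -> c i = 0%R) ->
  parabolic J v -> cox_game v c = c.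
Proof.
move=> c0 [x + <-]; rewrite cox_gameE; elim: x => //= i x IH /andP[Ji /IH->].
exact: fire_eq0 (c0 i Ji).
Qed.

Section MaximalParabolic.
Variables (J : {pred I}) (e : I).
Hypothesis Je : forall i, (i \in J) = (i != e).

Lemma delta_parabolic v : parabolic J v -> cox_game v (delta e) = delta e.
Proof. by apply: cox_game_parabolic => i; rewrite Je /delta => /negbTE->. Qed.

Lemma min_coset_rep_stab w : min_coset_rep J w -> cox_game w (delta e) = delta e -> w = 1.
Proof.
move=> wJ we; have [//|/eqP w_neq1] := eqVneq w 1.
have [i down_i] := right_descent_exists w_neq1.
have ie : i = e.
  by apply/eqP; rewrite -[_ == _]negbK -Je; apply: contra down_i; exact: min_coset_rep_right_ascent.
rewrite -left_ascentV in down_i; have := cox_game_le0 (delta_ge0 e) down_i.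
by rewrite -{1}we -cox_gameM mulVg cox_game1 ie /delta eqxx.
Qed.

Lemma min_coset_rep_inj u w : min_coset_rep J u -> min_coset_rep J w ->
  cox_game u (delta e) = cox_game w (delta e) -> u = w.
Proof.
move=> uJ wJ uw; have [a [b [uwE aJ bJ _]]] := parabolic_decomp J (u^-1 * w).
have a1 : a = 1.
  apply: min_coset_rep_stab => //; have <- : u^-1 * w * b^-1 = a by rewrite uwE mulgK.
  rewrite !cox_gameM (delta_parabolic (parabolicV bJ)) -uw.
  by rewrite -cox_gameM mulVg cox_game1.
have wE : w = u * b by rewrite -[b]mul1g -a1 -uwE mulgA mulgV mul1g.
by rewrite wE (@min_coset_rep_eq1 _ _ J u b) ?mulg1 // -wE.
Qed.

Lemma min_coset_rep_ascent w i : min_coset_rep J w -> (0 < cox_game w (delta e) i)%R ->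
  min_coset_rep J (s i * w) /\ left_ascent i w.
Proof.
move=> wJ pos; split; last first.
  by apply: contraTT pos => /(cox_game_le0 (delta_ge0 e)); rewrite leNgt.
have [//|[j Jj /(congr1 (@cox_game^~ (delta e)))]] := min_coset_rep_genM i wJ.
rewrite !cox_gameM (delta_parabolic (parabolic_gen m Jj)) cox_game_gen.
by move/(congr1 (@^~ i)); rewrite /fire eqxx; lia.
Qed.

Lemma ascent_min_coset_rep w i : min_coset_rep J w -> min_coset_rep J (s i * w) ->
  left_ascent i w -> (0 < cox_game w (delta e) i)%R.
Proof.
move=> wJ siwJ up; rewrite lt_def (cox_game_ge0 (delta_ge0 e) up) andbT.
apply: contraTneq up => c0; rewrite /left_ascent (@min_coset_rep_inj (s i * w) w) ?ltnn //.
by rewrite cox_gameM cox_game_gen fire_eq0.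
Qed.

(* The hypothesis on a says that the root a(alpha_f) does not involve alpha_e;
   u sends the other simple roots to positive roots. *)
Lemma min_coset_repM_ascent a u f : min_coset_rep J u -> right_ascent a f ->
  cox_game a^-1 (delta e) f = 0%R -> right_ascent (u * a) f.
Proof.
move=> uJ up_a ae; apply: (@right_ascent_game (fun=> 1%R)) => //.
rewrite invgM cox_gameM cox_game_sum; apply: sumr_ge0 => l _.
have [->|ne_le] := eqVneq l e; first by rewrite ae mulr0.
apply: mulr_ge0.
  apply/ltW/cox_game_gt0 => //; rewrite left_ascentV.
  by apply: min_coset_rep_right_ascent uJ _; rewrite Je.
by apply: cox_game_ge0; [exact: delta_ge0 | rewrite left_ascentV].
Qed.

Fixpoint ascending x c : bool :=
  if x is i :: x' then ascending x' c && (0 < game x' c i)%R else true.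

Lemma ascending_cat x y c : ascending (x ++ y) c = ascending x (game y c) && ascending y c.
Proof. by elim: x => //= i x ->; rewrite game_cat andbAC. Qed.

Lemma ascendingP x :
  ascending x (delta e) <-> min_coset_rep J (wp x) /\ len (wp x) = size x.
Proof.
elim: x => [|i x IH] /=.
  by rewrite word_prod_nil cox_length1; split=> // _; split=> //; exact: min_coset_rep1.
rewrite word_prod_cons -cox_gameE; split=> [/andP[/IH[xJ size_x] pos]|[ixJ size_ix]].
  have [ixJ up] := min_coset_rep_ascent xJ pos.
  by rewrite (left_ascent_length up) size_x.
have size_x := reduced_behead size_ix.
have xJ : min_coset_rep J (wp x).
  by apply: min_coset_rep_suffix ixJ; rewrite size_ix size_x cox_length_gen.
apply/andP; split; first exact/IH.
by apply: ascent_min_coset_rep; rewrite // /left_ascent size_ix size_x.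
Qed.

End MaximalParabolic.
End NumbersGame.

Import GRing.Theory Num.Theory Order.TTheory.

(** * Coordinates for the numbers game of affine type D *)

Ltac split_ifs := rewrite /=; repeat (case: ifP => ?; try (exfalso; lia); rewrite /=).

Ltac merge_indices x :=
  match goal with |- context [x ?a] => match goal with |- context [x ?b] =>
    tryif constr_eq a b then fail else (rewrite (_ : x b = x a); last by (congr x; lia))
  end end.

(* Linear arithmetic on entries of x whose indices are only provably equal. *)
Ltac coords x := split_ifs; repeat merge_indices x; try lia.

Section Coordinates.
Local Open Scope ring_scope.
Variables (n : nat) (hn : (4 <= n)%N).
Implicit Types (N : int) (x y : nat -> int) (i j k : nat) (ws : seq nat) (e : bool).

Local Notation M := (@affD_matrix n).

Definition affD_adj i j := affD_edge n i j || affD_edge n j i.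

Lemma affD_laced : simply_laced M.
Proof.
rewrite /simply_laced /affD_matrix; split=> [i|i j|i j /negbTE->]; first by rewrite eqxx.
  by rewrite eq_sym orbC.
by case: ifP; [right | left].
Qed.

Lemma affD_matrix_adj (i j : 'I_n.+1) : i != j -> (M i j == 3%N) = affD_adj i j.
Proof. by rewrite /affD_matrix /affD_adj => /negbTE->; case: ifP. Qed.

(* The simple affine roots, evaluated at the point with coordinates
   x 1, ..., x n; the affine one vanishes on the hyperplane x 1 + x 2 = N. *)
Definition affD_root N i x : int :=
  if i == 0%N then N - x 1%N - x 2%N
  else if i == n then x (n - 1)%N + x n else x i - x i.+1.

Definition affD_act N i x : nat -> int := fun k =>
  if i == 0%N then (if k == 1%N then N - x 2%N else if k == 2%N then N - x 1%N else x k)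
  else if i == n then (if k == (n - 1)%N then - x n else if k == n then - x (n - 1)%N else x k)
  else if k == i then x i.+1 else if k == i.+1 then x i else x k.

Lemma affD_root_act N i k x : (i <= n)%N -> (k <= n)%N ->
  affD_root N k (affD_act N i x) =
  if k == i then - affD_root N i x
  else if affD_adj i k then affD_root N k x + affD_root N i x else affD_root N k x.
Proof.
move=> le_in le_kn; rewrite /affD_root /affD_act /affD_adj /affD_edge.
have [i0|i0] := eqVneq i 0%N; last have [iN|iN] := eqVneq i n.
all: have [k0|k0] := eqVneq k 0%N; last have [kN|kN] := eqVneq k n.
all: have [ki|ki] := eqVneq k i.
all: try (exfalso; lia).
all: coords x.
Qed.

Lemma swap_ends_le i : (i <= n)%N -> (swap_ends n i <= n)%N.
Proof. by rewrite /swap_ends => ?; split_ifs; lia. Qed.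

Lemma swap_endsK i : (i <= n)%N -> swap_ends n (swap_ends n i) = i.
Proof. by rewrite {2}/swap_ends => ?; split_ifs; rewrite /swap_ends; split_ifs; lia. Qed.

Lemma swap_ends_pred_last : swap_ends n (n - 1) = n.
Proof. by rewrite /swap_ends; split_ifs. Qed.

Lemma swap_ends_last : swap_ends n n = (n - 1)%N.
Proof. by rewrite /swap_ends; split_ifs. Qed.

(* The diagram automorphisms that may exchange the nodes of either fork. *)
Definition fork_swap (b c : bool) i : nat :=
  if (i <= 1)%N then if b then (1 - i)%N else i
  else if c && (n - 1 <= i <= n)%N then (2 * n - 1 - i)%N else i.

Lemma swap_endsE i : swap_ends n i = fork_swap true true i.
Proof. by rewrite /swap_ends /fork_swap; split_ifs; lia. Qed.

Lemma fork_swap_le b c i : (i <= n)%N -> (fork_swap b c i <= n)%N.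
Proof. by case: b c => [] [] => ?; rewrite /fork_swap; split_ifs; lia. Qed.

Lemma fork_swapK b c : involutive (fork_swap b c).
Proof.
by case: b c => [] [] i; rewrite {2}/fork_swap; split_ifs; rewrite /fork_swap; split_ifs; lia.
Qed.

Lemma affD_edge_fork_swap b c i k :
  affD_edge n i k -> affD_adj (fork_swap b c i) (fork_swap b c k).
Proof.
have mid l : (2 <= l <= n - 2)%N -> fork_swap b c l = l.
  by rewrite /fork_swap => ln; split_ifs; lia.
have fork l : (n - 1 <= l <= n)%N -> (n - 1 <= fork_swap b c l <= n)%N.
  by rewrite /fork_swap => ln; split_ifs; lia.
have low l : (l <= 1)%N -> (fork_swap b c l <= 1)%N.
  by rewrite /fork_swap => l_le1; split_ifs; lia.
rewrite /affD_adj /affD_edge; case/or4P=> /andP[].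
- by move=> /eqP-> /eqP->; rewrite (mid 2%N); have := low 0%N; lia.
- by move=> /eqP-> /eqP->; rewrite (mid 2%N); have := low 1%N; lia.
- move=> in2 /eqP->; rewrite (mid i) //; have [->|ne_i] := eqVneq i (n - 2)%N.
    by have := fork (n - 2).+1; lia.
  by rewrite mid; lia.
- by move=> /eqP-> /eqP->; rewrite (mid (n - 2)%N); have := fork n; lia.
Qed.

Lemma affD_adj_fork_swap b c i k :
  affD_adj (fork_swap b c i) (fork_swap b c k) = affD_adj i k.
Proof.
have swap_adj l l' : affD_adj l l' -> affD_adj (fork_swap b c l) (fork_swap b c l').
  by case/orP => /(affD_edge_fork_swap b c) //; rewrite /affD_adj orbC.
by apply/idP/idP => [/swap_adj|/swap_adj //]; rewrite !fork_swapK.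
Qed.

Definition relabel e i := if e then i else swap_ends n i.

Lemma relabel_le e i : (i <= n)%N -> (relabel e i <= n)%N.
Proof. by case: e => //; exact: swap_ends_le. Qed.

Lemma relabelK e i : (i <= n)%N -> relabel e (relabel e i) = i.
Proof. by case: e => //; exact: swap_endsK. Qed.

Lemma relabel_eq e i k : (i <= n)%N -> (k <= n)%N -> (relabel e i == k) = (i == relabel e k).
Proof. by move=> le_in le_kn; apply/eqP/eqP => [<-|->]; rewrite relabelK. Qed.

Lemma affD_adj_relabel e i k : (i <= n)%N -> (k <= n)%N ->
  affD_adj (relabel e i) k = affD_adj i (relabel e k).
Proof.
case: e => // le_in le_kn; rewrite /relabel -{1}(swap_endsK le_kn).
by rewrite !swap_endsE affD_adj_fork_swap -!swap_endsE.
Qed.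

Definition affD_labels e N x : 'I_n.+1 -> int :=
  fun k : 'I_n.+1 => affD_root N (relabel e k) x.

Lemma affD_labels_inord e N x i : (i <= n)%N ->
  affD_labels e N x (inord (relabel e i)) = affD_root N i x.
Proof. by move=> le_in; rewrite /affD_labels inordK ?relabelK // ltnS relabel_le. Qed.

Lemma fire_labels e N i x : (i <= n)%N ->
  fire M (inord (relabel e i)) (affD_labels e N x) = affD_labels e N (affD_act N i x).
Proof.
move=> le_in; apply/funext => k; have le_kn : (k <= n)%N by rewrite -ltnS.
have lab_le := relabel_le e le_in; have labk_le := relabel_le e le_kn.
rewrite /fire affD_labels_inord // /affD_labels affD_root_act //.
have eq_k : (k == inord (relabel e i)) = (relabel e k == i).
  by rewrite -val_eqE /= inordK // eq_sym relabel_eq // eq_sym.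
rewrite eq_k; case: (eqVneq (relabel e k) i) => // ne_ki.
rewrite affD_matrix_adj ?inordK ?affD_adj_relabel //.
by rewrite eq_sym eq_k.
Qed.

Definition letters ws := map (inord : nat -> 'I_n.+1) ws.

Lemma letters_cat ws ws' : letters (ws ++ ws') = letters ws ++ letters ws'.
Proof. exact: map_cat. Qed.

Lemma letters_relabel e (z : seq 'I_n.+1) :
  letters (map (relabel e) [seq relabel e i | i : 'I_n.+1 <- z]) = z.
Proof.
rewrite /letters -!map_comp -[RHS]map_id; apply: eq_map => i /=.
by rewrite relabelK ?inord_val // -ltnS.
Qed.

Definition affD_acts N ws x := foldr (affD_act N) x ws.

Fixpoint affD_ascending N ws x : bool :=
  if ws is i :: ws' then
    [&& affD_ascending N ws' x, (i <= n)%N & 0 < affD_root N i (affD_acts N ws' x)]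
  else true.

Lemma affD_acts_cat N ws ws' x :
  affD_acts N (ws ++ ws') x = affD_acts N ws (affD_acts N ws' x).
Proof. exact: foldr_cat. Qed.

Lemma affD_ascending_cat N ws ws' x :
  affD_ascending N (ws ++ ws') x =
  affD_ascending N ws (affD_acts N ws' x) && affD_ascending N ws' x.
Proof. by elim: ws => //= i ws ->; rewrite affD_acts_cat andbAC. Qed.

Lemma affD_ascending_le N ws x : affD_ascending N ws x -> all (leq^~ n) ws.
Proof. by elim: ws => //= i ws IH /and3P[/IH-> ->]. Qed.

Lemma game_labels e N ws x : all (leq^~ n) ws ->
  game M (letters (map (relabel e) ws)) (affD_labels e N x) = affD_labels e N (affD_acts N ws x).
Proof. by elim: ws => //= i ws IH /andP[le_in /IH->]; exact: fire_labels. Qed.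

Lemma ascending_labels e N ws x : all (leq^~ n) ws ->
  ascending M (letters (map (relabel e) ws)) (affD_labels e N x) = affD_ascending N ws x.
Proof.
elim: ws => //= i ws IH /andP[le_in le_ws].
by rewrite IH // game_labels // affD_labels_inord // le_in.
Qed.

Lemma cox_game_labels e N x (w : affD n) :
  exists y, cox_game w (affD_labels e N x) = affD_labels e N y.
Proof.
have [z <-] := word_prod_surj w; rewrite (cox_gameE affD_laced) -(letters_relabel e z).
exists (affD_acts N [seq relabel e i | i : 'I_n.+1 <- z] x); apply: game_labels.
by rewrite all_map; apply/allP => i _ /=; rewrite relabel_le // -ltnS.
Qed.

Definition swap_coords N x : nat -> int :=
  fun k => if k == 1%N then N - x 1%N else if k == n then - x n else x k.

Lemma affD_root_swap N k x : (k <= n)%N ->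
  affD_root N (swap_ends n k) (swap_coords N x) = affD_root N k x.
Proof.
move=> le_kn; move E: (swap_ends n k) => k'; move: E; rewrite /swap_ends.
by split_ifs => <- {k'}; rewrite /affD_root /swap_coords; coords x.
Qed.

Lemma affD_labels_swap e N x : affD_labels (~~ e) N (swap_coords N x) = affD_labels e N x.
Proof.
apply/funext => k; have le_kn : (k <= n)%N by rewrite -ltnS.
rewrite /affD_labels; case: e; rewrite /relabel /=; first exact: affD_root_swap.
by rewrite -{1}(swap_endsK le_kn) affD_root_swap // swap_ends_le.
Qed.

Definition base_point : nat -> int := fun k => (k == 1%N)%:R.

Definition node e : 'I_n.+1 := inord e.

Lemma val_node e : node e = e :> nat.
Proof. by rewrite inordK //; case: e => //; lia. Qed.

Lemma gens_but_node e (i : 'I_n.+1) : (i \in gens_but n e) = (i != node e).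
Proof. by rewrite inE -val_eqE /= val_node. Qed.

Lemma node_neq e : node (~~ e) != node e.
Proof. by rewrite -val_eqE /= !val_node //; case: e. Qed.

Lemma inord_relabel1 e : inord (relabel e 1) = node e.
Proof. by case: e; rewrite /relabel /swap_ends. Qed.

Lemma inord_relabel0 e : inord (relabel e 0) = node (~~ e).
Proof. by case: e; rewrite /relabel /swap_ends. Qed.

Lemma relabel_node e i : (i <= n)%N -> (relabel e i == ~~ e :> nat) = (i == 0%N).
Proof. by move=> le_in; case: e; rewrite /relabel /swap_ends; split_ifs; lia. Qed.

Lemma affD_labels_base_point e : affD_labels e 1 base_point = delta (node e).
Proof.
apply/funext => k; have : (k <= n)%N by rewrite -ltnS.
rewrite /delta -val_eqE /= val_node /affD_labels; move: (nat_of_ord k) => {}k le_kn.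
case: e; rewrite /relabel; first by rewrite /affD_root /base_point; split_ifs; lia.
move E: (swap_ends n k) => k'; move: E; rewrite /swap_ends.
by split_ifs => <- {k'}; rewrite /affD_root /base_point; split_ifs; lia.
Qed.

Lemma affD_labels_inj e N x y : affD_labels e N x = affD_labels e N y ->
  forall k, (1 <= k <= n)%N -> x k = y k.
Proof.
move=> exy.
have root_eq i : (i <= n)%N -> affD_root N i x = affD_root N i y.
  by move=> le_in; rewrite -!(affD_labels_inord e) // exy.
have last_eq : x n = y n.
  have := root_eq n (leqnn _); have := root_eq (n - 1)%N (leq_subr _ _).
  by rewrite /affD_root; split_ifs; rewrite (_ : (n - 1).+1 = n); lia.
suff from_last d : (d < n)%N -> x (n - d)%N = y (n - d)%N.
  by move=> k kn; rewrite -(@subKn k n) ?from_last; lia.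
elim: d => [|d IH] lt_dn; first by rewrite subn0.
have := root_eq (n - d.+1)%N; rewrite /affD_root.
split_ifs; rewrite (_ : (n - d.+1).+1 = (n - d)%N); last by lia.
by rewrite IH => [/(_ (leq_subr _ _))|]; lia.
Qed.

End Coordinates.

(** * Segments *)

Definition run (m d : nat) : seq nat := rev (iota m d).

Lemma runS m d : run m d.+1 = (m + d) :: run m d.
Proof. by rewrite /run -addn1 iotaD rev_cat. Qed.

Lemma run_rcons m d : run m d.+1 = rcons (run m.+1 d) m.
Proof. by rewrite /run /= rev_cons. Qed.

Lemma run_cat m d d' : run m (d + d') = run (m + d) d' ++ run m d.
Proof. by rewrite /run iotaD rev_cat. Qed.

Lemma mem_run m d i : (i \in run m d) = (m <= i < m + d).
Proof. by rewrite mem_rev mem_iota. Qed.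

Lemma size_run m d : size (run m d) = d.
Proof. by rewrite size_rev size_iota. Qed.

Section Segments.
Local Open Scope ring_scope.
Variables (n : nat) (hn : (4 <= n)%N).
Implicit Types (N : int) (x : nat -> int) (i j k m d : nat) (ws : seq nat)
  (bk : bool * nat) (p q r : part).

Local Notation acts := (affD_acts n).
Local Notation asc := (affD_ascending n).

Lemma acts_run N m d x k : (0 < m)%N -> (m + d <= n)%N -> acts N (run m d) x k =
  if (m <= k < m + d)%N then x k.+1 else if k == (m + d)%N then x m else x k.
Proof.
elim: d k => [|d IH] k m_gt0 md; first by split_ifs; coords x.
by rewrite runS /= /affD_act !IH; [coords x | lia..].
Qed.

Lemma asc_run N m d x : (0 < m)%N -> (m + d <= n)%N ->
  asc N (run m d) x <-> (forall k, (m <= k < m + d)%N -> x k.+1 < x m).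
Proof.
elim: d => [|d IH] m_gt0 md; first by split=> // _ k; lia.
rewrite runS /= (_ : affD_root n N (m + d) (acts N (run m d) x) = x m - x (m + d).+1); last first.
  by rewrite /affD_root !acts_run; [coords x | lia..].
rewrite subr_gt0; split=> [/and3P[/IH passed _ last] k kmd|passed].
  have [->|ne_k] := eqVneq k (m + d)%N; first exact: last.
  by apply: passed; lia.
apply/and3P; split; [apply/IH; [lia..|] | lia | by apply: passed; lia].
by move=> k kmd; apply: passed; lia.
Qed.

Lemma acts_iota N m d x k : (0 < m)%N -> (m + d)%N = n -> acts N (iota m d) x k =
  if (k < m)%N then x k else if k == m then x n
  else if (k <= n)%N then x (k - 1)%N else x k.
Proof.
elim: d m k => [|d IH] m k m_gt0 md; first by split_ifs; coords x.
by rewrite /= /affD_act !IH; [coords x | lia..].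
Qed.

Lemma asc_iota N m d x : (0 < m)%N -> (m + d)%N = n ->
  asc N (iota m d) x <-> (forall k, (m <= k < n)%N -> x n < x k).
Proof.
elim: d m => [|d IH] m m_gt0 md; first by split=> // _ k; lia.
rewrite /= (_ : affD_root n N m (acts N (iota m.+1 d) x) = x m - x n); last first.
  by rewrite /affD_root !acts_iota; [coords x | lia..].
rewrite subr_gt0; split=> [/and3P[/IH passed _ first] k kmn|passed].
  have [->|ne_k] := eqVneq k m; first exact: first.
  by apply: passed; lia.
apply/and3P; split; [apply/IH; [lia..|] | lia | by apply: passed; lia].
by move=> k kmd; apply: passed; lia.
Qed.

Lemma acts_fork N x k : acts N (n :: run 1 (n - 2)) x k =
  if (1 <= k <= n - 2)%N then x k.+1 else if k == (n - 1)%N then - x n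
  else if k == n then - x 1%N else x k.
Proof. by rewrite /= /affD_act !acts_run; [coords x | lia..]. Qed.

Lemma asc_fork N x : asc N (n :: run 1 (n - 2)) x <->
  (forall k, (1 <= k <= n - 2)%N -> x k.+1 < x 1%N) /\ - x n < x 1%N.
Proof.
rewrite /= leqnn /= (_ : affD_root n N n _ = x 1%N + x n); last first.
  by rewrite /affD_root !acts_run; [coords x | lia..].
have [down_to down_from] : asc N (run 1 (n - 2)) x <->
    (forall k, (1 <= k < 1 + (n - 2))%N -> x k.+1 < x 1%N) by apply: asc_run; lia.
split=> [/andP[/down_to passed last]|[passed last]].
  by split; [move=> k kn; apply: passed|]; lia.
by apply/andP; split; [apply: down_from => k kn; apply: passed|]; lia.
Qed.

Lemma segment1_low p : (p.1 <= n - 2)%N -> segment1 n p = run 1 p.1.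
Proof. by rewrite /segment1 => ->. Qed.

Lemma segment1_b : segment1 n ((n - 1)%N, Some color_b) = run 1 (n - 1).
Proof.
rewrite /segment1 /= (_ : (n - 1 <= n - 2)%N = false) ?eqxx; last by lia.
by rewrite (_ : (n - 1)%N = (n - 2).+1) ?runS //; lia.
Qed.

Lemma segment1_c : segment1 n ((n - 1)%N, Some color_c) = n :: run 1 (n - 2).
Proof. by rewrite /segment1 /= (_ : (n - 1 <= n - 2)%N = false) ?eqxx //; lia. Qed.

Lemma segment1_high p : (n <= p.1)%N ->
  segment1 n p = iota (2 * n - p.1 - 1) (p.1 - n + 1) ++ n :: run 1 (n - 2).
Proof. by move=> le_np; rewrite /segment1; split_ifs. Qed.

Lemma acts_high N p x k : (n <= p.1 <= 2 * n - 2)%N -> acts N (segment1 n p) x k =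
  if (1 <= k < 2 * n - p.1 - 1)%N then x k.+1 else if k == (2 * n - p.1 - 1)%N then - x 1%N
  else if k == n then - x n else x k.
Proof.
move=> np; rewrite segment1_high ?affD_acts_cat ?acts_iota; try lia.
by rewrite !acts_fork; coords x.
Qed.

Lemma asc_high N p x : (n <= p.1 <= 2 * n - 2)%N -> asc N (segment1 n p) x <->
  [/\ forall k, (2 <= k <= n)%N -> x k < x 1%N, - x n < x 1%N
    & forall k, (2 * n - p.1 <= k < n)%N -> - x k < x 1%N].
Proof.
move=> np; rewrite segment1_high ?affD_ascending_cat; last by lia.
set z := acts N _ x.
have zE k : z k = if (1 <= k <= n - 2)%N then x k.+1 else if k == (n - 1)%N then - x n
  else if k == n then - x 1%N else x k by exact: acts_fork.
have up : asc N (iota (2 * n - p.1 - 1) (p.1 - n + 1)) z <->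
    (forall k, (2 * n - p.1 - 1 <= k < n)%N -> z n < z k) by apply: asc_iota; lia.
have zn : z n = - x 1%N by rewrite zE; split_ifs.
split=> [/andP[/up back /asc_fork[forth turn]]|[forth turn back]].
  split=> // -[|k] kn; try lia; last by have := back k; rewrite zn zE; split_ifs; lia.
  have [->|ne_k] := eqVneq k.+1 n; last by apply: forth; lia.
  by have := back (n - 1)%N; rewrite zn zE; split_ifs; lia.
apply/andP; split; last by apply/asc_fork; split=> // k kn; apply: forth; lia.
apply/up => k kn; rewrite zn zE; split_ifs.
- by have := back k.+1; lia.
- by have := forth n; lia.
Qed.

Lemma valid_part_cases p : valid_part n p ->
  [\/ (1 <= p.1 <= n - 2)%N /\ p = (p.1, None), p = ((n - 1)%N, Some color_b),
      p = ((n - 1)%N, Some color_c) | (n <= p.1 <= 2 * n - 2)%N /\ p = (p.1, None)].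
Proof.
case: p => j c [/= jn colorP]; have [jE|ne_j] := eqVneq j (n - 1)%N.
  case: c colorP => [[]|] colorP; [by constructor 2; rewrite jE | by constructor 3; rewrite jE |].
  by case: colorP => _ /(_ jE).
have -> : c = None.
  by case: c colorP => // c [some_color _]; case/eqP: ne_j; exact: some_color.
have [le_j|gt_j] := leqP j (n - 2)%N; [constructor 1 | constructor 4]; split=> //; lia.
Qed.

Lemma valid_part_ge1 p : valid_part n p -> (1 <= p.1)%N.
Proof. by case=> /andP[]. Qed.

Lemma valid_part_leq p : valid_part n p -> (p.1 <= 2 * n - 2)%N.
Proof. by case=> /andP[]. Qed.

Lemma valid_uncolored j : (1 <= j <= 2 * n - 2)%N -> j != (n - 1)%N -> valid_part n (j, None).
Proof. by move=> jn /eqP ne_j; split=> //=; split. Qed.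

Lemma valid_mid c : valid_part n ((n - 1)%N, Some c).
Proof. by split=> /=; [lia | split]. Qed.

Lemma valid_color z j : (1 <= j <= n - 1)%N ->
  valid_part n (j, if j == (n - 1)%N then Some z else None).
Proof.
by move=> jn; case: eqP => [->|/eqP ne_j]; [exact: valid_mid | apply: valid_uncolored; lia].
Qed.

Lemma size_segment1 p : valid_part n p -> size (segment1 n p) = p.1.
Proof.
case/valid_part_cases => [[pn _]|->|->|[pn _]].
- by rewrite segment1_low ?size_run //; lia.
- by rewrite segment1_b size_run.
- by rewrite segment1_c /= size_run; lia.
- by rewrite segment1_high ?size_cat /= ?size_run ?size_iota; lia.
Qed.

(* The entries of a point are listed as x_k, encoded (true, k), and - x_k,
   encoded (false, k). The segment of p moves x_1 to the position of p. *)
Definition part_position p : bool * nat :=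
  if (p.1 <= n - 2)%N then (true, p.1.+1)
  else if p.1 == (n - 1)%N then (if p.2 is Some color_b then true else false, n)
  else (false, 2 * n - p.1 - 1)%N.

Definition entry bk x : int := if bk.1 then x bk.2 else - x bk.2.

Definition unit_vector bk : nat -> int :=
  fun l => if l == bk.2 then (if bk.1 then 1 else -1) else 0.

Lemma part_position_low p : (p.1 <= n - 2)%N -> part_position p = (true, p.1.+1).
Proof. by rewrite /part_position => ->. Qed.

Lemma part_position_b : part_position ((n - 1)%N, Some color_b) = (true, n).
Proof. by rewrite /part_position eqxx; case: ifP => //=; lia. Qed.

Lemma part_position_c : part_position ((n - 1)%N, Some color_c) = (false, n).
Proof. by rewrite /part_position eqxx; case: ifP => //=; lia. Qed.

Lemma part_position_high p : (n <= p.1)%N -> part_position p = (false, 2 * n - p.1 - 1)%N.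
Proof. by move=> le_np; rewrite /part_position; split_ifs. Qed.

Lemma part_position_bounds p : valid_part n p ->
  (1 <= (part_position p).2 <= n)%N /\ part_position p <> (true, 1%N).
Proof.
case/valid_part_cases => [[pn _]|->|->|[pn _]].
- by rewrite part_position_low /=; [split; [lia | case; lia] | lia].
- by rewrite part_position_b /=; split; [lia | case; lia].
- by rewrite part_position_c /=; split=> //; lia.
- by rewrite part_position_high /=; [split=> //; lia | lia].
Qed.

Lemma part_position_inj p q : valid_part n p -> valid_part n q ->
  part_position p = part_position q -> p = q.
Proof.
case/valid_part_cases => [[pn ->]|->|->|[pn ->]];
  case/valid_part_cases => [[qn ->]|->|->|[qn ->]] //; rewrite /part_position /=;
  split_ifs; case; try (by lia); move=> eq_pos; congr (_, _); lia.
Qed.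

Lemma part_position_surj bk : (1 <= bk.2 <= n)%N -> bk <> (true, 1%N) ->
  exists2 p, valid_part n p & part_position p = bk.
Proof.
case: bk => [[] k] /= kn not_base; have [kN|kN] := eqVneq k n.
- by exists ((n - 1)%N, Some color_b); [exact: valid_mid | rewrite part_position_b kN].
- have k_neq1 : k != 1%N by apply: contra_notN not_base => /eqP->.
  exists ((k - 1)%N, None); first by apply: valid_uncolored; lia.
  by rewrite part_position_low /=; [congr (_, _); lia | lia].
- by exists ((n - 1)%N, Some color_c); [exact: valid_mid | rewrite part_position_c kN].
- exists ((2 * n - k - 1)%N, None); first by apply: valid_uncolored; lia.
  by rewrite part_position_high /=; [congr (_, _); lia | lia].
Qed.

Lemma unit_vector_inj bk bk' : (1 <= bk.2 <= n)%N ->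
  (forall l, (1 <= l <= n)%N -> unit_vector bk l = unit_vector bk' l) -> bk = bk'.
Proof.
case: bk bk' => [b k] [b' k'] /= kn /(_ k kn); rewrite /unit_vector /= eqxx.
by case: eqP => [->|_]; case: b; case: b'.
Qed.

Lemma acts_base_point p : valid_part n p ->
  acts 1 (segment1 n p) base_point = unit_vector (part_position p).
Proof.
move=> vp; apply/funext => k; case/valid_part_cases: vp => [[pn _]|->|->|[pn _]].
- rewrite segment1_low ?part_position_low ?acts_run ?/base_point ?/unit_vector; try lia.
  by split_ifs; lia.
- by rewrite segment1_b part_position_b acts_run /base_point /unit_vector /=; split_ifs; lia.
- by rewrite segment1_c part_position_c acts_fork /base_point /unit_vector /=; split_ifs; lia.
- by rewrite acts_high ?part_position_high ?/base_point ?/unit_vector; split_ifs; lia.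
Qed.

Definition passes q r := (r.1 < q.1)%N || (r == q) && (q.1 <= n - 1)%N.

Lemma passes_lt q r : (r.1 < q.1)%N -> passes q r.
Proof. by rewrite /passes => ->. Qed.

Lemma entry_low r x : (r.1 <= n - 2)%N -> entry (part_position r) x = x r.1.+1.
Proof. by move=> rn; rewrite part_position_low. Qed.

Lemma entry_high r x : (n <= r.1)%N -> entry (part_position r) x = - x (2 * n - r.1 - 1)%N.
Proof. by move=> rn; rewrite part_position_high. Qed.

Lemma low_passed q x k : (forall r, valid_part n r -> passes q r ->
    entry (part_position r) x < x 1%N) -> (1 <= k < q.1)%N -> (k <= n - 2)%N ->
  x k.+1 < x 1%N.
Proof.
move=> passed kq kn; have := passed (k, None); rewrite entry_low //.
by apply; [apply: valid_uncolored; lia | apply: passes_lt => /=; lia].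
Qed.

Lemma asc_segment1_high N q x : (n <= q.1 <= 2 * n - 2)%N -> asc N (segment1 n q) x <->
  (forall r, valid_part n r -> passes q r -> entry (part_position r) x < x 1%N).
Proof.
move=> qn; rewrite asc_high //; split=> [[forth turn back] r vr|passed].
  move=> qr; have rq : (r.1 < q.1)%N by case/orP: qr => // /andP[_]; lia.
  case/valid_part_cases: vr rq {qr} => [[rn _]|->|->|[rn _]] rq.
  - by rewrite entry_low; [apply: forth | ]; lia.
  - by rewrite part_position_b /entry /=; apply: forth; lia.
  - by rewrite part_position_c.
  - by rewrite entry_high; [apply: back; lia | lia].
have b_passed := passed _ (valid_mid color_b) (passes_lt _).
have c_passed := passed _ (valid_mid color_c) (passes_lt _).
rewrite part_position_b in b_passed; rewrite part_position_c in c_passed.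
split=> [[|k] kn||k kn]; try lia; last 1 first.
- have := passed (2 * n - k - 1, None)%N; rewrite entry_high /=; last by lia.
  rewrite (_ : 2 * n - (2 * n - k - 1) - 1 = k)%N; last by lia.
  by apply; [apply: valid_uncolored; lia | apply: passes_lt => /=; lia].
- have [->|ne_k] := eqVneq k.+1 n; first by apply: b_passed => /=; lia.
  by apply: (low_passed passed); lia.
- by apply: c_passed => /=; lia.
Qed.

(* A segment q >= n makes x_1 pass the entries - x_k as far as k = 2n - q, the
   position of q - 1: hence the second clause of [passes]. *)
Lemma asc_segment1 N q x : valid_part n q -> asc N (segment1 n q) x <->
  (forall r, valid_part n r -> passes q r -> entry (part_position r) x < x 1%N).
Proof.
move=> vq; case/valid_part_cases: (vq) => [[qn _]|->|->|[qn _]]; last exact: asc_segment1_high.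
- rewrite segment1_low ?asc_run; try lia; split=> [passed r vr|passed k kq].
    rewrite /passes => qr; have rq : (r.1 <= q.1)%N by case/orP: qr => [|/andP[/eqP->]]; lia.
    by rewrite entry_low; [apply: passed; have := valid_part_ge1 vr; lia | lia].
  have [->|ne_k] := eqVneq k q.1; last by apply: (low_passed passed); lia.
  by rewrite -entry_low; [apply: passed; rewrite // /passes eqxx /=; lia | lia].
- rewrite segment1_b asc_run; try lia; split=> [passed r vr|passed k kn].
    case/orP=> /= [rn|/andP[/eqP-> _]].
      by rewrite entry_low; [apply: passed; have := valid_part_ge1 vr; lia | lia].
    by rewrite part_position_b /entry /=; have := passed (n - 1)%N; rewrite subn1 prednK; lia.
  have [kE|ne_k] := eqVneq k (n - 1)%N; last by apply: (low_passed passed) => /=; lia.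
  have := passed _ (valid_mid color_b); rewrite part_position_b /entry /=.
  rewrite (_ : k.+1 = n); last by lia.
  by apply; rewrite /passes eqxx /= leqnn orbT.
- rewrite segment1_c asc_fork; split=> [[passed turn] r vr|passed].
    case/orP=> /= [rn|/andP[/eqP-> _]]; last by rewrite part_position_c.
    by rewrite entry_low; [apply: passed; have := valid_part_ge1 vr; lia | lia].
  split=> [k kn|]; first by apply: (low_passed passed) => /=; lia.
  have := passed _ (valid_mid color_c); rewrite part_position_c; apply.
  by rewrite /passes eqxx /= leqnn orbT.
Qed.

Lemma asc_base_point p : valid_part n p -> asc 1 (segment1 n p) base_point.
Proof.
move=> vp; apply/asc_segment1 => // r /part_position_bounds[_] + _.
by rewrite /entry /base_point; case: (part_position r) => [[] [|[|k]]].
Qed.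

(* [stackable p q]: a row q may follow the row p. *)
Definition stackable p q := (q.1 < p.1)%N || (q == p) && (n - 1 <= p.1)%N.

Definition opposite_part p : part :=
  (p.1, omap (fun c => if c is color_b then color_c else color_b) p.2).

Lemma valid_opposite p : valid_part n p -> valid_part n (opposite_part p).
Proof. by case: p => j [c|] // [jn mid]; split=> //; split=> // _; exact/mid. Qed.

Lemma opposite_partK : involutive opposite_part.
Proof. by case=> j [[]|]. Qed.

Lemma entry_unit_vector bk bk' : entry bk (unit_vector bk') =
  if bk == bk' then 1 else if bk.2 == bk'.2 then -1 else 0.
Proof.
case: bk bk' => [b k] [b' k']; rewrite /entry /unit_vector -pair_eqE /pair_eq /=.
by case: (k == k'); case: b; case: b'.
Qed.

Lemma entry_swap_coords r x : valid_part n r -> (r.1 < 2 * n - 2)%N ->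
  entry (part_position r) (swap_coords n 1 x) = entry (part_position (opposite_part r)) x.
Proof.
case/valid_part_cases => [[rn ->]|->|->|[rn ->]] /= lt_r; rewrite /opposite_part /=.
- by rewrite part_position_low /entry /swap_coords /=; [split_ifs | lia].
- by rewrite part_position_b part_position_c /entry /swap_coords /=; split_ifs.
- by rewrite part_position_b part_position_c /entry /swap_coords /=; split_ifs; lia.
- by rewrite part_position_high /entry /swap_coords /=; [split_ifs | lia].
Qed.

Lemma entry_stacked p r : valid_part n p -> valid_part n r -> (r.1 < 2 * n - 2)%N ->
  let y := swap_coords n 1 (unit_vector (part_position p)) in
  (entry (part_position r) y < y 1%N) = (r != opposite_part p).
Proof.
move=> vp vr lt_r /=; rewrite entry_swap_coords // entry_unit_vector.
have -> : (part_position (opposite_part r) == part_position p) = (r == opposite_part p).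
  apply/eqP/eqP=> [/part_position_inj eq_rp|->]; last by rewrite opposite_partK.
  by rewrite -eq_rp ?opposite_partK //; exact: valid_opposite.
have [_ not_base] := part_position_bounds vp.
rewrite /swap_coords /unit_vector /= [1%N == _]eq_sym; case: (eqVneq r) => [rE|_] /=.
  have /negbTE-> : (part_position p).2 != 1%N.
    rewrite rE /= in lt_r; have := valid_part_ge1 vp.
    by rewrite /part_position; split_ifs; lia.
  by [].
case: (part_position p) not_base => [[] k] /=; by case: (k =P 1%N) => [->|] //= _; case: ifP.
Qed.

Lemma asc_stackable p q : valid_part n p -> valid_part n q ->
  asc 1 (segment1 n q) (swap_coords n 1 (unit_vector (part_position p))) = stackable p q.
Proof.
move=> vp vq; transitivity (~~ passes q (opposite_part p)).
  have top_last r : passes q r -> (r.1 < 2 * n - 2)%N.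
    by have := valid_part_leq vq => qn /orP[|/andP[/eqP->]]; lia.
  apply/idP/idP => [/(asc_segment1 _ _ vq) passed|not_passed].
    apply/negP => qp; have := passed _ (valid_opposite vp) qp.
    by rewrite entry_stacked ?eqxx ?top_last //; exact: valid_opposite.
  apply/asc_segment1 => // r vr qr; rewrite entry_stacked ?top_last //.
  by apply: contraNneq not_passed => <-.
have bc : (Some color_b == Some color_c) = false by apply/eqP.
have cb : (Some color_c == Some color_b) = false by apply/eqP.
case/valid_part_cases: vp => [[pn ->]|->|->|[pn ->]];
  case/valid_part_cases: vq => [[qn ->]|->|->|[qn ->]];
  rewrite /passes /stackable /opposite_part -!pair_eqE /pair_eq /= ?bc ?cb ?eqxx; lia.
Qed.

Lemma affD_act_unit_vector i bk : (1 <= i <= n)%N -> (1 <= bk.2 <= n)%N ->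
  exists2 bk', (1 <= bk'.2 <= n)%N & affD_act n 1 i (unit_vector bk) = unit_vector bk'.
Proof.
case: bk => b k /= iN kN.
exists (if i == n then if k == n then (~~ b, (n - 1)%N)
                       else if k == (n - 1)%N then (~~ b, n) else (b, k)
        else (b, if k == i then i.+1 else if k == i.+1 then i else k)).
  by split_ifs; lia.
by case: (i =P n) => iE; (case: eqP => kE; last case: eqP => kE'); apply/funext => l;
  rewrite /affD_act /unit_vector; split_ifs; case: (b); lia.
Qed.

Lemma acts_unit_vector ws : all (fun i => 1 <= i <= n)%N ws ->
  exists2 bk, (1 <= bk.2 <= n)%N & acts 1 ws base_point = unit_vector bk.
Proof.
elim: ws => [_|i ws IH /= /andP[iN /IH[bk kN ->]]]; last exact: affD_act_unit_vector.
exists (true, 1%N) => /=; first lia.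
by apply/funext => k; rewrite /base_point /unit_vector /=; case: eqP.
Qed.

End Segments.

(** * Colored partitions *)

Section ColoredPartitions.
Local Open Scope ring_scope.
Variables (n : nat) (hn : (4 <= n)%N).
Implicit Types (x : nat -> int) (e : bool) (p q : part) (ps : seq part) (ss : seq (seq nat)).

Local Notation M := (@affD_matrix n).
Local Notation wp := (word_prod M).
Local Notation s := (cox_gen M).
Local Notation len w := (@cox_length _ M w%g).
Local Notation laced := (affD_laced n).
Local Notation Jnode := (gens_but_node hn).
Implicit Types u v w : affD n.

(* Rows are listed from right to left, as in [colored_partition], and written
   in the letters of [segment1]; [relabel] exchanges 0, 1 and n - 1, n from
   each row to the next. *)
Fixpoint rows_word e ss : seq nat :=
  if ss is s :: ss' then rows_word (~~ e) ss' ++ map (relabel n e) s else [::].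

Definition rows_prod e ss : affD n := wp (letters n (rows_word e ss)).

Definition row_point s x : nat -> int := swap_coords n 1 (affD_acts n 1 s x).

Fixpoint rows_point ss x :=
  if ss is s :: ss' then rows_point ss' (row_point s x) else x.

Fixpoint rows_ascending ss x : bool :=
  if ss is s :: ss' then affD_ascending n 1 s x && rows_ascending ss' (row_point s x)
  else true.

Lemma size_rows_word e ss : size (rows_word e ss) = sumn (map size ss).
Proof. by elim: ss e => //= s ss IH e; rewrite size_cat IH size_map addnC. Qed.

Lemma rows_word_le e ss : all (all (leq^~ n)) ss -> all (leq^~ n) (rows_word e ss).
Proof.
elim: ss e => //= s ss IH e /andP[le_s le_ss]; rewrite all_cat IH //= all_map.
by apply: sub_all le_s => i; exact: relabel_le.
Qed.

Lemma rows_point_cat ss ss' x : rows_point (ss ++ ss') x = rows_point ss' (rows_point ss x).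
Proof. by elim: ss x => //= s ss IH x; rewrite IH. Qed.

Lemma rows_ascending_cat ss ss' x :
  rows_ascending (ss ++ ss') x = rows_ascending ss x && rows_ascending ss' (rows_point ss x).
Proof. by elim: ss x => //= s ss IH x; rewrite IH andbA. Qed.

Lemma rows_ascending_le ss x : rows_ascending ss x -> all (all (leq^~ n)) ss.
Proof. by elim: ss x => //= s ss IH x /andP[/affD_ascending_le-> /IH]. Qed.

Lemma game_rows e ss x : all (all (leq^~ n)) ss ->
  game M (letters n (rows_word e ss)) (affD_labels e 1 x) =
  affD_labels (odd (size ss) (+) e) 1 (rows_point ss x).
Proof.
elim: ss e x => //= s ss IH e x /andP[le_s le_ss].
rewrite letters_cat game_cat game_labels // -(affD_labels_swap hn) IH //.
by rewrite addNb addbN.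
Qed.

Lemma ascending_rows e ss x : all (all (leq^~ n)) ss ->
  ascending M (letters n (rows_word e ss)) (affD_labels e 1 x) = rows_ascending ss x.
Proof.
elim: ss e x => //= s ss IH e x /andP[le_s le_ss].
rewrite letters_cat ascending_cat game_labels // ascending_labels // andbC.
by rewrite -(affD_labels_swap hn) IH.
Qed.

Lemma rows_ascendingP e ss : all (all (leq^~ n)) ss -> rows_ascending ss base_point <->
  min_coset_rep (gens_but n e) (rows_prod e ss) /\ len (rows_prod e ss) = sumn (map size ss).
Proof.
move=> le_ss; rewrite -(ascending_rows e) // (affD_labels_base_point hn).
rewrite -(size_rows_word e) -(size_map (inord : nat -> 'I_n.+1)).
exact: (ascendingP laced (Jnode e)).
Qed.

Lemma rows_prod_min e ss : rows_ascending ss base_point ->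
  min_coset_rep (gens_but n e) (rows_prod e ss).
Proof. by move=> asc; case: (iffLR (rows_ascendingP e (rows_ascending_le asc)) asc). Qed.

Lemma rows_prod_length e ss : rows_ascending ss base_point ->
  len (rows_prod e ss) = sumn (map size ss).
Proof. by move=> asc; case: (iffLR (rows_ascendingP e (rows_ascending_le asc)) asc). Qed.

Lemma cox_game_rows e ss : all (all (leq^~ n)) ss ->
  cox_game (rows_prod e ss) (delta (node n e)) =
  affD_labels (odd (size ss) (+) e) 1 (rows_point ss base_point).
Proof. by move=> le_ss; rewrite (cox_gameE laced) -(affD_labels_base_point hn) game_rows. Qed.

Lemma rows_prod_neq e ss1 ss2 k : rows_ascending ss1 base_point ->
  rows_ascending ss2 base_point -> size ss1 = size ss2 -> (1 <= k <= n)%N ->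
  rows_point ss1 base_point k <> rows_point ss2 base_point k ->
  rows_prod e ss1 <> rows_prod e ss2.
Proof.
move=> /rows_ascending_le le_ss1 /rows_ascending_le le_ss2 size_eq kn ne eq_prod; apply: ne.
have := cox_game_rows e le_ss1; rewrite eq_prod cox_game_rows // size_eq => labels_eq.
by rewrite (affD_labels_inj hn labels_eq).
Qed.

Definition partition_elt e ps : affD n := rows_prod e (map (segment1 n) ps).

Fixpoint is_colored_partition ps : Prop :=
  if ps is p :: ps' then
    [/\ valid_part n p, (if ps' is q :: _ then stackable n p q else true)
      & is_colored_partition ps']
  else True.

Lemma colored_partition_valid ps : is_colored_partition ps -> {in ps, forall p, valid_part n p}.
Proof. by elim: ps => //= p ps IH [vp _ /IH valid] q; rewrite inE => /predU1P[->|/valid]. Qed.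

Lemma partition_elt_nil e : partition_elt e [::] = 1%g.
Proof. exact: word_prod_nil. Qed.

Lemma partition_elt1 e p : partition_elt e [:: p] = sigma n e p.
Proof.
rewrite /partition_elt /rows_prod /sigma /=; congr (wp (map _ _)).
by case: e => //; rewrite map_id.
Qed.

Lemma partition_elt_cons e p ps :
  partition_elt e (p :: ps) = (partition_elt (~~ e) ps * sigma n e p)%g.
Proof. by rewrite -partition_elt1 -word_prod_cat -letters_cat. Qed.

Lemma partition_elt_pair e p q :
  (sigma n (~~ e) q * sigma n e p)%g = partition_elt e [:: p; q].
Proof. by rewrite !partition_elt_cons partition_elt_nil mul1g. Qed.

Lemma segment1_le p : valid_part n p -> all (leq^~ n) (segment1 n p).
Proof. by move/(asc_base_point hn)/affD_ascending_le. Qed.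

Lemma segments_le ps : {in ps, forall p, valid_part n p} ->
  all (all (leq^~ n)) (map (segment1 n) ps).
Proof. by move=> valid; rewrite all_map; apply/allP => p /valid/segment1_le. Qed.

Lemma ascending_row p : valid_part n p -> rows_ascending [:: segment1 n p] base_point.
Proof. by move=> vp; rewrite /= asc_base_point. Qed.

Lemma ascending_pair p q : valid_part n p -> valid_part n q ->
  rows_ascending (map (segment1 n) [:: p; q]) base_point = stackable n p q.
Proof.
move=> vp vq; rewrite /= /row_point asc_base_point // acts_base_point //.
by rewrite asc_stackable ?andbT.
Qed.

Lemma sigma_min e p : valid_part n p -> min_coset_rep (gens_but n e) (sigma n e p).
Proof. by move=> vp; rewrite -partition_elt1; exact: rows_prod_min (ascending_row vp). Qed.

Lemma sigma_length e p : valid_part n p -> len (sigma n e p) = p.1.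
Proof.
move=> vp; rewrite -partition_elt1; have := rows_prod_length e (ascending_row vp).
by rewrite /= addn0 size_segment1.
Qed.

Lemma cox_game_sigma e p : valid_part n p ->
  cox_game (sigma n e p) (delta (node n e)) = affD_labels e 1 (unit_vector (part_position n p)).
Proof.
move=> vp; rewrite -partition_elt1 cox_game_rows /= ?segment1_le //.
by rewrite /row_point acts_base_point // affD_labels_swap.
Qed.

Lemma sigma_inj e p q : valid_part n p -> valid_part n q -> sigma n e p = sigma n e q -> p = q.
Proof.
move=> vp vq eq_sigma; apply: (part_position_inj hn vp vq).
apply: (unit_vector_inj (part_position_bounds hn vp).1).
by apply: (affD_labels_inj hn (e := e) (N := 1)); rewrite -!cox_game_sigma // eq_sigma.
Qed.

Lemma segment1_letters p : valid_part n p -> all (fun i => 1 <= i <= n)%N (segment1 n p).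
Proof.
have run_letters j : (j <= n)%N -> all (fun i => 1 <= i <= n)%N (run 1 j).
  by move=> jn; apply/allP => i; rewrite mem_run; lia.
case/(valid_part_cases hn) => [[pn _]|->|->|[pn _]].
- by rewrite segment1_low ?run_letters //; lia.
- by rewrite segment1_b // run_letters //; lia.
- by rewrite segment1_c //= run_letters ?leqnn ?andbT; lia.
- rewrite segment1_high ?all_cat //= ?run_letters ?leqnn ?andbT; try lia.
  by apply/andP; split; [apply/allP => i; rewrite mem_iota|]; lia.
Qed.

Lemma sigma_parabolic e p : valid_part n p -> parabolic (gens_but n (~~ e)) (sigma n e p).
Proof.
move=> vp; rewrite -partition_elt1; eexists; last by [].
rewrite all_map all_map; apply: sub_all (segment1_letters vp) => i /= /andP[i1 le_in].
by rewrite inE /= inordK ?relabel_node // -?lt0n // ltnS relabel_le.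
Qed.

Lemma parabolic_min_sigma e v : parabolic (gens_but n (~~ e)) v ->
  min_coset_rep (gens_but n e) v -> v = 1%g \/ exists2 p, valid_part n p & v = sigma n e p.
Proof.
move=> [z Jz zv] vJ; pose ws := [seq relabel n e i | i : 'I_n.+1 <- z].
have ws_letters : all (fun i => 1 <= i <= n)%N ws.
  rewrite all_map; apply: sub_all Jz => i; rewrite inE /= => ne_i.
  have le_in : (i <= n)%N by rewrite -ltnS.
  rewrite relabel_le // andbT lt0n; apply: contra ne_i => /eqP i0.
  by have := relabel_node hn e (relabel_le hn e le_in); rewrite relabelK // i0 eqxx => ->.
have [bk kn bkE] := acts_unit_vector hn ws_letters.
have vE : cox_game v (delta (node n e)) = affD_labels e 1 (unit_vector bk).
  rewrite -zv -(letters_relabel hn e z) (cox_gameE laced) -(affD_labels_base_point hn).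
  by rewrite game_labels ?bkE //; apply: sub_all ws_letters => i /andP[].
have [bk_base|/eqP not_base] := eqVneq bk (true, 1%N).
  left; apply: (min_coset_rep_stab laced (Jnode e)) => //; rewrite vE -(affD_labels_base_point hn).
  rewrite bk_base; congr affD_labels; apply/funext => l.
  by rewrite /unit_vector /base_point /=; case: eqP.
have [p vp pE] := part_position_surj hn kn not_base; right; exists p => //.
apply: (min_coset_rep_inj laced (Jnode e)) => //; first exact: sigma_min.
by rewrite vE cox_game_sigma // pE.
Qed.

Lemma segment1_last_letter p : valid_part n p -> (p.1 < 2 * n - 2)%N ->
  exists2 z, segment1 n p = rcons z 1%N & all (fun i => 2 <= i <= n)%N z.
Proof.
have run_last j : (0 < j)%N -> run 1 j = rcons (run 2 j.-1) 1%N.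
  by case: j => // j _; rewrite run_rcons.
have run_letters j : (j < n)%N -> all (fun i => 2 <= i <= n)%N (run 2 j).
  by move=> jn; apply/allP => i; rewrite mem_run; lia.
case/(valid_part_cases hn) => [[pn _]|->|->|[pn _]] lt_p.
- by exists (run 2 p.1.-1); rewrite ?run_letters ?segment1_low ?run_last //; lia.
- by exists (run 2 (n - 1).-1); rewrite ?run_letters ?segment1_b ?run_last //; lia.
- exists (n :: run 2 (n - 2).-1); first by rewrite segment1_c // run_last ?rcons_cons //; lia.
  by rewrite /= run_letters; lia.
- exists (iota (2 * n - p.1 - 1) (p.1 - n + 1) ++ n :: run 2 (n - 2).-1).
    by rewrite segment1_high ?run_last ?rcons_cat //; lia.
  rewrite all_cat /= run_letters; last by lia.
  by rewrite andbT; apply/andP; split; [apply/allP => i; rewrite mem_iota|]; lia.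
Qed.

Lemma sigma_last_gen e p : valid_part n p -> (p.1 < 2 * n - 2)%N ->
  exists2 v, parabolic (gens_but n e) v & sigma n e p = (v * s (node n e))%g.
Proof.
move=> vp lt_p; have [z zE z_letters] := segment1_last_letter vp lt_p.
exists (wp (letters n (map (relabel n e) z))); last first.
  rewrite -partition_elt1 /partition_elt /rows_prod /= zE map_rcons /letters map_rcons.
  by rewrite word_prod_rcons inord_relabel1.
eexists; last by [].
rewrite !all_map; apply: sub_all z_letters => i /= i2n.
rewrite Jnode -inord_relabel1 -val_eqE /=.
have [le_in le1n] : (i <= n)%N /\ (1 <= n)%N by lia.
by rewrite !inordK ?ltnS ?relabel_le // relabel_eq ?relabel_le // relabelK //; lia.
Qed.

Lemma node_in_gens e : node n e \in gens_but n (~~ e).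
Proof. by rewrite Jnode eq_sym node_neq. Qed.

(* 2n - 2 exceeds the height 2n - 3 of the highest root. *)
Lemma affD_labels_rho e (k : 'I_n.+1) : 0 < affD_labels e (2 * n%:Z - 2) (fun j => n%:Z - j%:Z) k.
Proof.
have : (k <= n)%N by rewrite -ltnS.
rewrite /affD_labels => /(relabel_le hn e); move: (relabel n e k) => i le_in.
by rewrite /affD_root; split_ifs; lia.
Qed.

(* The segment 2n - 2 changes the affine root N - x_1 - x_2 into N + x_1 - x_2,
   the sum of the null root N and of the root x_1 - x_2 of the other parabolic. *)
Lemma sigma_top_ascent e u p : min_coset_rep (gens_but n (~~ e)) u ->
  valid_part n p -> p.1 = (2 * n - 2)%N ->
  right_ascent (u * sigma n e p)%g (node n (~~ e)).
Proof.
move=> uJ vp pn; set v := sigma n e p; set N := 2 * n%:Z - 2.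
apply: (right_ascent_game laced (affD_labels_rho e)).
rewrite invgM (cox_gameM laced).
have [y yE] := cox_game_labels hn e N (fun j => n%:Z - j%:Z) u^-1%g.
have [z zE] := cox_game_labels hn e N y v^-1%g.
have root1_y : 0 < affD_root n N 1 y.
  rewrite -(affD_labels_inord hn e N y) ?inord_relabel1; last by lia.
  rewrite -yE; apply: (cox_game_gt0 laced (affD_labels_rho e)); rewrite left_ascentV.
  exact: min_coset_rep_right_ascent uJ (node_in_gens e).
rewrite yE zE -inord_relabel0 affD_labels_inord //.
have labels_y : @affD_labels n e N y = affD_labels e N (affD_acts n N (segment1 n p) z).
  rewrite -(game_labels hn e N z (segment1_le vp)) -zE -(cox_gameE laced) -/(rows_prod e [:: _]).
  by rewrite -/(partition_elt e [:: p]) partition_elt1 -(cox_gameM laced) mulgV (cox_game1 laced).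
have p_high : (n <= p.1 <= 2 * n - 2)%N by lia.
have := affD_labels_inj hn labels_y (k := 1%N); have := affD_labels_inj hn labels_y (k := 2%N).
rewrite !acts_high // pn; move: root1_y; rewrite /affD_root /N.
by split_ifs; lia.
Qed.

(* The rows p and q involve the generator of node e only once, at the end, so
   that the root to be controlled does not involve the simple root of node e. *)
Lemma stacked_right_ascent e u p q : min_coset_rep (gens_but n e) u ->
  valid_part n p -> valid_part n q -> stackable n p q -> (p.1 < 2 * n - 2)%N ->
  right_ascent (u * partition_elt e [:: p; q])%g (node n (~~ e)).
Proof.
move=> uJ vp vq pq lt_p; apply: (min_coset_repM_ascent laced (Jnode e)) => //.
  apply: (@min_coset_rep_right_ascent _ _ (gens_but n e)); last by rewrite Jnode node_neq.
  by apply: rows_prod_min; rewrite ascending_pair.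
rewrite -partition_elt_pair invgM (cox_gameM laced) (delta_parabolic laced (Jnode e)); last first.
  by apply: parabolicV; rewrite -{1}(negbK e); exact: sigma_parabolic.
have [v vJ ->] := sigma_last_gen e vp lt_p.
rewrite invgM cox_genV (cox_gameM laced) (delta_parabolic laced (Jnode e)); last exact: parabolicV.
rewrite (cox_game_gen laced) /fire (negbTE (node_neq hn e)).
rewrite affD_matrix_adj; last by rewrite eq_sym node_neq.
rewrite /affD_adj !val_node // /affD_edge /delta (negbTE (node_neq hn e)).
by case: ifP => //; case: (e) => /=; lia.
Qed.

Lemma partition_elt_min e ps : is_colored_partition ps ->
  min_coset_rep (gens_but n e) (partition_elt e ps).
Proof.
have [k] := ubnP (size ps); elim: k ps e => // k IH [|p ps] e lek /=.
  by rewrite partition_elt_nil => _; exact: min_coset_rep1.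
case=> vp pq cps; have uJ := IH ps (~~ e) lek cps.
have vJ : forall i, i \in gens_but n e -> right_ascent (sigma n e p) i.
  by move=> i; exact: min_coset_rep_right_ascent (sigma_min vp).
have vP := sigma_parabolic e vp.
apply: right_ascent_min_coset_rep => i Ji; rewrite partition_elt_cons.
have [iJ|] := boolP (i \in gens_but n (~~ e)).
  rewrite /right_ascent -mulgA (min_coset_repM uJ vP) (min_coset_repM uJ) ?ltn_add2l.
    exact: vJ.
  exact: parabolicM vP (parabolic_gen _ iJ).
rewrite Jnode negbK => /eqP iE; rewrite {}iE in Ji *.
case: ps lek pq cps uJ => [|q ps] lek pq cps uJ.
  by rewrite partition_elt_nil mul1g; exact: vJ.
have [lt_p|ge_p] := ltnP p.1 (2 * n - 2); last first.
  by apply: sigma_top_ascent => //; have := valid_part_leq vp; lia.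
case: cps => vq _ cps; rewrite partition_elt_cons negbK -mulgA partition_elt_pair.
exact: stacked_right_ascent (IH ps e (ltnW lek) cps) vp vq pq lt_p.
Qed.

Lemma partition_elt_length e ps : is_colored_partition ps ->
  len (partition_elt e ps) = sumn (map fst ps).
Proof.
elim: ps e => [|p ps IH] e; first by rewrite partition_elt_nil cox_length1.
case=> vp _ cps; rewrite partition_elt_cons.
rewrite (min_coset_repM (@partition_elt_min (~~ e) _ cps) (sigma_parabolic e vp)).
by rewrite IH // sigma_length // addnC.
Qed.

Lemma partition_elt_factors e ps : is_colored_partition ps ->
  factors_as e (partition_elt e ps) ps.
Proof.
elim: ps e => [|p ps IH] e; first by rewrite /= partition_elt_nil.
move=> cpps; have [vp _ cps] := cpps; split.
  move=> w1; have := partition_elt_length e cpps; rewrite w1 cox_length1 /=.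
  by have := valid_part_ge1 vp; lia.
exists (partition_elt (~~ e) ps), (sigma n e p); split; last by split=> //; exact: IH.
have [uJ vP] := (@partition_elt_min (~~ e) _ cps, sigma_parabolic e vp).
by rewrite partition_elt_cons; split=> //; exact: min_coset_repM uJ vP.
Qed.

Lemma factors_uniq e w ps ps' : factors_as e w ps -> factors_as e w ps' -> ps = ps'.
Proof.
elim: ps e w ps' => [|p ps IH] e w [|p' ps'] //=; first by move=> -> [].
  by move=> [w_neq1 _] w1.
move=> [_ [u [v [[wE uJ vJ _] [vp vE fu]]]]] [_ [u' [v' [[wE' u'J v'J _] [vp' vE' fu']]]]].
have [uu' vv'] : u = u' /\ v = v' by apply: parabolic_decomp_uniq uJ u'J vJ v'J _; rewrite -wE.
congr (_ :: _); first by apply: (sigma_inj (e := e)) => //; rewrite -vE vv'.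
by apply: IH fu _; rewrite uu'.
Qed.

Lemma stackable_of_min e p q : valid_part n p -> valid_part n q ->
  min_coset_rep (gens_but n e) (partition_elt e [:: p; q]) ->
  len (partition_elt e [:: p; q]) = (q.1 + p.1)%N -> stackable n p q.
Proof.
move=> vp vq pqJ len_pq; rewrite -ascending_pair //; apply/(rows_ascendingP e).
  by rewrite /= !segment1_le.
by split=> //; rewrite [LHS]len_pq /= !size_segment1 // addn0 addnC.
Qed.

Lemma factors_partition e w ps : min_coset_rep (gens_but n e) w -> factors_as e w ps ->
  w = partition_elt e ps /\ is_colored_partition ps.
Proof.
elim: ps e w => [|p ps IH] e w wJ /=; first by move=> ->; rewrite partition_elt_nil.
move=> [_ [u [v [[wE uJ vP len_w] [vp vE fu]]]]].
have [uE cps] := IH _ _ uJ fu; split; first by rewrite partition_elt_cons -uE -vE.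
split=> //; case: ps {IH fu} uE cps => // q ps uE [vq qps cps].
have len_u := @partition_elt_length (~~ e) (q :: ps) (And3 vq qps cps).
have len_rest := partition_elt_length e cps.
have wa : w = (partition_elt e ps * partition_elt e [:: p; q])%g.
  by rewrite -partition_elt_pair wE uE vE partition_elt_cons negbK mulgA.
have len_a : len (partition_elt e [:: p; q]) = (q.1 + p.1)%N.
  apply/eqP; rewrite eqn_leq -{1}partition_elt_pair.
  rewrite -{1}(sigma_length (~~ e) vq) -{1}(sigma_length e vp) cox_lengthM.
  have := cox_lengthM (partition_elt e ps) (partition_elt e [:: p; q]).
  by rewrite -wa len_w vE uE len_u len_rest (sigma_length e vp) /= (addnC q.1) -addnA leq_add2l.
apply: stackable_of_min (len_a) => //; apply: (@min_coset_rep_suffix _ _ _ (partition_elt e ps)).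
  rewrite -wa len_w vE uE len_u len_rest (sigma_length e vp) len_a /=.
  by rewrite (addnC q.1) -addnA.
by rewrite -wa.
Qed.

Lemma factors_exist e w : min_coset_rep (gens_but n e) w -> exists ps, factors_as e w ps.
Proof.
have [k] := ubnP (len w); elim: k w e => // k IH w e lek wJ.
have [->|/eqP w_neq1] := eqVneq w 1%g; first by exists [::].
have [u [v [wE uJ vP len_w]]] := parabolic_decomp (gens_but n (~~ e)) w.
have vJ : min_coset_rep (gens_but n e) v.
  by apply: (@min_coset_rep_suffix _ _ _ u); rewrite -wE.
have [v1|[p vp vE]] := parabolic_min_sigma vP vJ.
  have [i down] := right_descent_exists w_neq1; rewrite v1 mulg1 in wE.
  have : i \notin gens_but n e by apply: contra down; exact: min_coset_rep_right_ascent.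
  have : i \notin gens_but n (~~ e).
    by apply: contra down; rewrite wE; exact: min_coset_rep_right_ascent.
  by rewrite !Jnode !negbK => /eqP->; rewrite (negbTE (node_neq hn e)).
have [|ps fu] := IH u (~~ e) _ uJ.
  rewrite -ltnS; apply: leq_trans lek; rewrite len_w vE sigma_length //.
  by have := valid_part_ge1 vp; lia.
by exists (p :: ps); split=> //; exists u, v.
Qed.

Lemma colored_partitionP w : min_coset_rep (gens_but n 0) w ->
  w = partition_elt false (colored_partition w) /\ is_colored_partition (colored_partition w).
Proof.
move=> wJ; apply: (@factors_partition false) => //.
have : exists ps, [set ps | factors_as false w ps]%classic ps by exact: (@factors_exist false).
exact: xgetPex.
Qed.

Lemma colored_partition_elt ps : is_colored_partition ps ->
  colored_partition (partition_elt false ps) = ps.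
Proof.
move=> /(partition_elt_factors false) fps.
apply: (@factors_uniq false (partition_elt false ps)) => //.
by apply: (@xgetPex _ _ [set qs | factors_as false (partition_elt false ps) qs]%classic); exists ps.
Qed.

Lemma partition_elt_inj ps ps' : is_colored_partition ps -> is_colored_partition ps' ->
  partition_elt false ps = partition_elt false ps' -> ps = ps'.
Proof.
by move=> cps cps' eq_elt; rewrite -(colored_partition_elt cps) eq_elt colored_partition_elt.
Qed.

End ColoredPartitions.

(** * Palindromic Poincaré polynomials *)

Section Palindromic.
Local Open Scope ring_scope.
Variable n : nat.
Implicit Types (u v w : affD n) (r : seq (affD n)).

Lemma lower_interval_enum w :
  exists2 r, uniq r & forall v, v \in r <-> lower_interval w v.
Proof.
pose words k := [seq tval t | t : k.-tuple 'I_n.+1].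
pose r : seq (affD n) := flatten
  [seq map (word_prod (@affD_matrix n)) (words k) | k <- iota 0 (cox_length w).+1].
exists (undup [seq v <- r | `[< lower_interval w v >]]); first exact: undup_uniq.
move=> v; rewrite mem_undup mem_filter; split=> [/andP[/asboolP]//|vw].
apply/andP; split; first exact/asboolP.
have [x size_x xv] := reduced_word_exists v.
apply/flattenP; exists (map (word_prod (@affD_matrix n)) (words (size x))).
  apply/mapP; exists (size x) => //; rewrite mem_iota /= size_x add0n ltnS.
  by case: vw => _; exact: bruhat_length.
rewrite -xv; apply: map_f; apply/mapP; exists (in_tuple x) => //.
by rewrite mem_enum.
Qed.

Lemma poincare_coef w r i : uniq r -> (forall v, v \in r <-> lower_interval w v) ->
  (poincare w)`_i = (count (fun v => cox_length v == i) r)%:R.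
Proof.
move=> r_uniq rP; rewrite /poincare (_ : lower_interval w = [set` r]%classic); last first.
  by apply/seteqP; split=> v /rP.
rewrite -fsbig_seq // coef_sum -sum1_count natr_sum [RHS]big_mkcond /=.
by apply: eq_bigr => v _; rewrite coefXn eq_sym; case: eqP.
Qed.

Lemma involution_palindromic w (c : affD n -> affD n) :
  (forall v, lower_interval w v -> [/\ lower_interval w (c v), c (c v) = v
     & (cox_length (c v) + cox_length v = cox_length w)%N]) -> palindromic w.
Proof.
move=> cP i le_iw; have [r r_uniq rP] := lower_interval_enum w.
rewrite !(poincare_coef _ r_uniq rP); congr (_%:R).
have perm_r : perm_eq r (map c r).
  apply: uniq_perm => //.
    by rewrite map_inj_in_uniq // => u v /rP/cP[_ cu _] /rP/cP[_ cv _] cuv; rewrite -cu cuv cv.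
  move=> v; apply/idP/mapP=> [/rP vw|[u /rP uw ->]]; last by apply/rP; case: (cP u uw).
  by have [cvw cc _] := cP v vw; exists (c v) => //; apply/rP.
rewrite (permP perm_r) count_map; apply: eq_in_count => v /rP/cP[_ _ /= lens].
by apply/eqP/eqP; lia.
Qed.

Definition lower_colength w k v := lower_interval w v /\ (cox_length v + k = cox_length w)%N.

Lemma not_palindromic w v1 v2 k : lower_colength w k v1 -> lower_colength w k v2 -> v1 <> v2 ->
  (forall u v, lower_interval w u -> lower_interval w v ->
    cox_length u = k -> cox_length v = k -> u = v) -> ~ palindromic w.
Proof.
move=> [v1w len1] [v2w len2] v12 uniq_k /(_ k); have [r r_uniq rP] := lower_interval_enum w.
rewrite !(poincare_coef _ r_uniq rP) => eq_count.
have le1 : (count (fun v => cox_length v == k) r <= 1)%N.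
  rewrite -size_filter; case E: (filter _ r) => [|u [|v l]] //.
  have in_lower z : z \in filter (fun v => cox_length v == k) r ->
      lower_interval w z /\ cox_length z = k by rewrite mem_filter => /andP[/eqP ? /rP].
  have [|uw lu] := in_lower u; first by rewrite E mem_head.
  have [|vw lv] := in_lower v; first by rewrite E !inE eqxx orbT.
  have := filter_uniq (fun v => cox_length v == k) r_uniq.
  by rewrite E /= inE (uniq_k u v) // eqxx.
have le2 : (2 <= count (fun v => cox_length v == (cox_length w - k)%N) r)%N.
  rewrite -size_filter; apply: (@uniq_leq_size _ [:: v1; v2]).
    by rewrite /= inE andbT; apply/eqP.
  move=> v; rewrite !inE mem_filter => /orP[]/eqP->; apply/andP; split; try exact/rP.
    by rewrite -len1 addnK.
  by rewrite -len2 addnK.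
move: eq_count => /(_ ltac:(lia))/eqP; rewrite eqr_nat => /eqP count_eq.
by move: le2; rewrite -count_eq ltnNge le1.
Qed.

End Palindromic.

Section Recoloring.
Local Open Scope ring_scope.
Variables (n : nat) (hn : (4 <= n)%N).
Implicit Types (e : bool) (j : nat) (ws : seq nat) (ss : seq (seq nat)) (v w : affD n).

Definition last_swap (i : 'I_n.+1) : 'I_n.+1 := inord (fork_swap n false true i).

Lemma val_last_swap (i : 'I_n.+1) : last_swap i = fork_swap n false true i :> nat.
Proof. by rewrite inordK // ltnS fork_swap_le // -ltnS. Qed.

Lemma last_swapK : involutive last_swap.
Proof. by move=> i; apply: val_inj; rewrite /= !val_last_swap fork_swapK. Qed.

Lemma affD_matrix_last_swap (i j : 'I_n.+1) :
  affD_matrix (last_swap i) (last_swap j) = affD_matrix i j.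
Proof.
rewrite /affD_matrix (inj_eq (inv_inj last_swapK)) -!/(affD_adj n _ _) !val_last_swap.
by rewrite affD_adj_fork_swap.
Qed.

Definition recolor : affD n -> affD n := @cox_map _ (@affD_matrix n) last_swap.

Lemma recolorK : involutive recolor.
Proof. exact: cox_mapK last_swapK affD_matrix_last_swap. Qed.

Lemma recolor_inj : injective recolor.
Proof. exact: inv_inj recolorK. Qed.

Lemma recolor_length w : cox_length (recolor w) = cox_length w.
Proof. exact: cox_length_map last_swapK affD_matrix_last_swap w. Qed.

Lemma recolor_lower_interval w v :
  lower_interval w v -> lower_interval (recolor w) (recolor v).
Proof.
move=> [vJ le_vw]; split; last exact: bruhat_map last_swapK affD_matrix_last_swap _ _ le_vw.
apply: min_coset_rep_map last_swapK affD_matrix_last_swap _ _ _ vJ => i.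
by rewrite !inE /= val_last_swap /fork_swap; split_ifs; lia.
Qed.

Lemma palindromic_recolor w : palindromic (recolor w) <-> palindromic w.
Proof.
have pal_recolor u : palindromic u -> palindromic (recolor u).
  move=> pal_u i; rewrite recolor_length => /pal_u.
  have [r r_uniq rP] := lower_interval_enum u.
  have rcP v : v \in map recolor r <-> lower_interval (recolor u) v.
    split=> [/mapP[z /rP zu ->]|vu]; first exact: recolor_lower_interval.
    rewrite -(recolorK v) (mem_map recolor_inj); apply/rP.
    by rewrite -(recolorK u); exact: recolor_lower_interval.
  rewrite !(poincare_coef _ r_uniq rP) !(poincare_coef _ _ rcP) ?(map_inj_uniq recolor_inj) //.
  have countE k : count (fun v => cox_length v == k) (map recolor r) =
      count (fun v => cox_length v == k) r.
    by rewrite count_map; apply: eq_count => v /=; rewrite recolor_length.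
  by rewrite !countE.
by split=> /pal_recolor; rewrite ?recolorK.
Qed.

Lemma segment1_recolor z j : (1 <= j <= n - 1)%N ->
  segment1 n (j, if j == (n - 1)%N then Some z else None) =
  map (if z is color_b then id else fork_swap n false true)
    (segment1 n (j, if j == (n - 1)%N then Some color_b else None)).
Proof.
case: z => jn; first by rewrite map_id.
have run_fixed k : (k <= n - 2)%N -> map (fork_swap n false true) (run 1 k) = run 1 k.
  move=> kn; rewrite -[RHS]map_id; apply/eq_in_map => i; rewrite mem_run /fork_swap => ik.
  by split_ifs.
case: eqP => [->|ne_j]; last by rewrite !segment1_low /= ?run_fixed //; lia.
rewrite segment1_b // segment1_c // (_ : (n - 1)%N = (n - 2).+1); last by lia.
by rewrite runS /= run_fixed //; congr (_ :: _); rewrite /fork_swap; split_ifs; lia.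
Qed.

Lemma rows_word_recolor e ss :
  rows_word n e (map (map (fork_swap n false true)) ss) =
  map (fork_swap n false true) (rows_word n e ss).
Proof.
elim: ss e => //= s ss IH e; rewrite IH map_cat -!map_comp; congr (_ ++ _).
apply: eq_map => i /=; case: e => //.
by rewrite /relabel !swap_endsE // {2 4}/fork_swap; split_ifs; rewrite /fork_swap; split_ifs; lia.
Qed.

Lemma letters_recolor ws : all (leq^~ n) ws ->
  letters n (map (fork_swap n false true) ws) = map last_swap (letters n ws).
Proof.
move=> /allP le_ws; rewrite /letters -!map_comp; apply/eq_in_map => i /le_ws le_in.
by apply: val_inj; rewrite /= val_last_swap !inordK // ltnS fork_swap_le.
Qed.

Lemma color_shape_recolor sh : all (fun j => 1 <= j <= n - 1)%N sh ->
  partition_elt n false (color_shape n color_c sh) =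
  recolor (partition_elt n false (color_shape n color_b sh)).
Proof.
move=> /allP sh_bounds; pose segs z := map (segment1 n) (color_shape n z sh).
have segs_c : segs color_c = map (map (fork_swap n false true)) (segs color_b).
  rewrite /segs -!map_comp; apply/eq_in_map => j /sh_bounds jn /=.
  by rewrite (segment1_recolor color_c).
have segs_le : all (all (leq^~ n)) (segs color_b).
  rewrite all_map all_map; apply/allP => j /sh_bounds jn /=; apply: segment1_le => //.
  exact: valid_color.
rewrite /partition_elt -!/(segs _) segs_c /rows_prod rows_word_recolor.
rewrite letters_recolor; last exact: rows_word_le.
by rewrite /recolor (cox_map_word affD_matrix_last_swap).
Qed.

Lemma palindromic_color_shape z sh : all (fun j => 1 <= j <= n - 1)%N sh ->
  palindromic (partition_elt n false (color_shape n z sh)) <->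
  palindromic (partition_elt n false (color_shape n color_b sh)).
Proof. by case: z => // sh_bounds; rewrite color_shape_recolor //; exact: palindromic_recolor. Qed.

End Recoloring.

(** * Containment of colored partitions *)

Section Rowwise.
Variables (T : Type) (le : rel T).
Implicit Types s t : seq T.

Fixpoint rowwise s t : bool :=
  match s, t with
  | [::], _ => true
  | x :: s', y :: t' => le x y && rowwise s' t'
  | _, _ => false
  end.

Lemma rowwise_catl s t u : reflexive le -> rowwise (u ++ s) (u ++ t) = rowwise s t.
Proof. by move=> le_refl; elim: u => //= x u ->; rewrite le_refl. Qed.

Lemma rowwise_refl : reflexive le -> reflexive rowwise.
Proof. by move=> le_refl; elim=> //= x s ->; rewrite le_refl. Qed.

End Rowwise.

Section Containment.
Local Open Scope ring_scope.
Variables (n : nat) (hn : (4 <= n)%N).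
Implicit Types (e : bool) (p q : part) (ps qs : seq part) (ss : seq (seq nat)).

Local Notation elt := (partition_elt n false).
Local Notation total ps := (sumn (map fst ps)).
Local Notation is_cp := (is_colored_partition n).
Implicit Type w : affD n.

Lemma rows_word_subseq e ss ss' :
  rowwise subseq ss' ss -> subseq (rows_word n e ss') (rows_word n e ss).
Proof.
elim: ss ss' e => [|s1 ss IH] [|s2 ss'] e //=; first by rewrite sub0seq.
by case/andP=> sub_s /IH sub_ss; rewrite cat_subseq ?map_subseq.
Qed.

Lemma rows_bruhat e ss ss' : rows_ascending n ss base_point ->
  rows_ascending n ss' base_point -> rowwise subseq ss' ss ->
  bruhat_le (rows_prod n e ss') (rows_prod n e ss).
Proof.
move=> asc asc' sub; apply: bruhat_subword; last exact/map_subseq/rows_word_subseq.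
  by rewrite [LHS](rows_prod_length hn e asc') size_map size_rows_word.
by rewrite [LHS](rows_prod_length hn e asc) size_map size_rows_word.
Qed.

Lemma total_segments ps : {in ps, forall p, valid_part n p} ->
  sumn (map size (map (segment1 n) ps)) = total ps.
Proof.
by move=> valid; rewrite -map_comp; congr sumn; apply/eq_in_map => p /valid/(size_segment1 hn).
Qed.

Lemma partition_ascending ps :
  is_cp ps -> rows_ascending n (map (segment1 n) ps) base_point.
Proof.
move=> cps; have valid := colored_partition_valid cps.
apply/(rows_ascendingP hn false (segments_le hn valid)); rewrite total_segments //.
by split; [exact: partition_elt_min | exact: partition_elt_length].
Qed.

Definition part_le q p := (q.1 < p.1)%N || (q == p).

Lemma part_le_refl : reflexive part_le.
Proof. by move=> p; rewrite /part_le eqxx orbT. Qed.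

Lemma contained_catl ps qs qs' :
  rowwise part_le (ps ++ qs) (ps ++ qs') = rowwise part_le qs qs'.
Proof. exact: rowwise_catl part_le_refl. Qed.

Lemma lower_row_contained ps p q qs : (q.1 < p.1)%N ->
  rowwise part_le (ps ++ q :: qs) (ps ++ p :: qs).
Proof.
move=> qp; rewrite contained_catl /= rowwise_refl ?andbT; last exact: part_le_refl.
by rewrite /part_le qp.
Qed.

Lemma run_subseq m d d' : (d <= d')%N -> subseq (run m d) (run m d').
Proof. by move=> le_d; rewrite -(subnKC le_d) run_cat suffix_subseq. Qed.

Lemma segment1_subseq p q : valid_part n p -> valid_part n q -> part_le q p ->
  subseq (segment1 n q) (segment1 n p).
Proof.
move=> vp vq /orP[qp|/eqP-> //].
have top_b : run 1 (n - 1) = (n - 1)%N :: run 1 (n - 2).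
  by rewrite (_ : (n - 1)%N = (n - 2).+1) ?runS //; lia.
case/(valid_part_cases hn): vp qp => [[pn _]|->|->|[pn _]] /= qp.
- by rewrite !segment1_low ?run_subseq; lia.
- by rewrite segment1_b // segment1_low ?run_subseq; lia.
- rewrite segment1_c // segment1_low; last by lia.
  by apply: subseq_trans (subseq_cons _ _); apply: run_subseq; lia.
rewrite (segment1_high hn (p := p)); last by lia.
case/(valid_part_cases hn): vq qp => [[qn _]|->|->|[qn _]] /= qp.
- rewrite segment1_low; last by lia.
  apply: subseq_trans (suffix_subseq _ _); apply: subseq_trans (subseq_cons _ _).
  by apply: run_subseq; lia.
- rewrite segment1_b // top_b; apply: (@cat_subseq _ [:: (n - 1)%N]); last exact: subseq_cons.
  by rewrite sub1seq mem_iota; lia.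
- by rewrite segment1_c // suffix_subseq.
rewrite segment1_high; try lia; apply: cat_subseq => //.
rewrite (_ : p.1 - n + 1 = (p.1 - q.1) + (q.1 - n + 1))%N ?iotaD; last by lia.
by rewrite (_ : 2 * n - p.1 - 1 + (p.1 - q.1) = 2 * n - q.1 - 1)%N ?suffix_subseq; last by lia.
Qed.

Lemma partition_bruhat ps qs : is_cp ps -> is_cp qs ->
  rowwise part_le qs ps -> bruhat_le (elt qs) (elt ps).
Proof.
move=> cps cqs sub; apply: rows_bruhat; try exact: partition_ascending.
elim: ps qs cps cqs sub => [|p ps IH] [|q qs] //= [vp _ cps] [vq _ cqs] /andP[qp sub].
by rewrite segment1_subseq // IH.
Qed.

Lemma partition_lower_interval ps qs : is_cp ps -> is_cp qs ->
  rowwise part_le qs ps -> lower_interval (elt ps) (elt qs).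
Proof.
by move=> cps cqs sub; split; [exact: (@partition_elt_min _ hn false) | exact: partition_bruhat].
Qed.

Lemma partition_involution_palindromic ps (c : seq part -> seq part) : is_cp ps ->
  (forall qs, is_cp qs -> bruhat_le (elt qs) (elt ps) ->
     [/\ is_cp (c qs), rowwise part_le (c qs) ps, c (c qs) = qs
       & (total (c qs) + total qs = total ps)%N]) -> palindromic (elt ps).
Proof.
move=> cps cP; apply: (involution_palindromic (c := fun v => elt (c (colored_partition v)))).
move=> v [vJ le_v]; have [vE cqs] := colored_partitionP hn vJ.
move: (colored_partition v) vE cqs le_v => qs -> cqs le_qs.
have [ccqs sub cc total_c] := cP qs cqs le_qs; rewrite colored_partition_elt // cc.
split=> //; first exact: partition_lower_interval.
by rewrite !(partition_elt_length hn).
Qed.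

Lemma low_part p : valid_part n p -> (p.1 <= n - 2)%N -> p = (p.1, None).
Proof. by case/(valid_part_cases hn) => [[_ ->]|->|->|[? ->]] //=; lia. Qed.

Lemma mid_part p : valid_part n p -> p.1 = (n - 1)%N -> exists z, p = ((n - 1)%N, Some z).
Proof. by case/(valid_part_cases hn) => [[? _]|->|->|[? _]] pn; try lia; eexists. Qed.

Lemma small_partition ps k : (1 <= k <= 2)%N -> is_cp ps -> total ps = k -> ps = [:: (k, None)].
Proof.
case: ps => [|p [|q ps]] kn /=; first by lia.
  by move=> [vp _ _]; rewrite addn0 => pk; rewrite (low_part vp) pk //; lia.
move=> [vp pq [vq _ _]]; have := valid_part_ge1 vp; have := valid_part_ge1 vq.
by move: pq; rewrite /stackable => /orP[|/andP[_]]; lia.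
Qed.

(* W^S has a single element of length 1 and a single element of length 2. *)
Lemma two_lower_not_palindromic w v1 v2 k : (1 <= k <= 2)%N ->
  lower_colength w k v1 -> lower_colength w k v2 -> v1 <> v2 -> ~ palindromic w.
Proof.
move=> kn low1 low2 ne; apply: (not_palindromic low1 low2 ne).
have small u : min_coset_rep (gens_but n 0) u -> cox_length u = k -> u = elt [:: (k, None)].
  move=> uJ len_u; have [uE cu] := colored_partitionP hn uJ.
  by rewrite [LHS]uE (small_partition kn cu) // -(partition_elt_length hn false cu) -uE.
by move=> u v [uJ _] [vJ _] len_u len_v; rewrite (small u) // (small v).
Qed.

Lemma two_contained_not_palindromic k ps ps1 ps2 : (1 <= k <= 2)%N ->
  is_cp ps -> is_cp ps1 -> is_cp ps2 -> rowwise part_le ps1 ps -> rowwise part_le ps2 ps ->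
  (total ps1 + k = total ps)%N -> (total ps2 + k = total ps)%N -> ps1 <> ps2 ->
  ~ palindromic (elt ps).
Proof.
move=> kn cps cps1 cps2 sub1 sub2 total1 total2 ne.
apply: (two_lower_not_palindromic (v1 := elt ps1) (v2 := elt ps2) kn).
- by split; [exact: partition_lower_interval | rewrite !(partition_elt_length hn)].
- by split; [exact: partition_lower_interval | rewrite !(partition_elt_length hn)].
- by move/(partition_elt_inj hn cps1 cps2).
Qed.

End Containment.

(** * One-row shapes *)

Section OneRow.
Variables (n : nat) (hn : 4 <= n).
Implicit Types (p q : part) (qs : seq part).

Local Notation elt := (partition_elt n false).
Local Notation is_cp := (is_colored_partition n).

Lemma row_lower p qs : valid_part n p -> is_cp qs -> bruhat_le (elt qs) (elt [:: p]) ->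
  qs = [::] \/ exists2 q, qs = [:: q] & part_le q p.
Proof.
move=> vp cqs le_qp; have qsJ := partition_elt_min hn (e := false) cqs.
have qsP : parabolic (gens_but n 1) (elt qs).
  by apply: bruhat_parabolic le_qp _; rewrite partition_elt1; exact: (sigma_parabolic hn false vp).
have [qs1|[q vq qsE]] := parabolic_min_sigma hn (e := false) qsP qsJ; [left | right].
  by apply: (partition_elt_inj hn cqs (ps' := [::])) => //; rewrite partition_elt_nil.
have cp r : valid_part n r -> is_cp [:: r] by [].
have {qsE}qsE : qs = [:: q].
  by apply: (partition_elt_inj hn cqs (cp q vq)); rewrite partition_elt1.
exists q => //; rewrite qsE in le_qp; have := bruhat_length le_qp.
rewrite !(partition_elt_length hn) //= !addn0 /part_le leq_eqVlt => /orP[/eqP qp|-> //].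
suff -> : q = p by rewrite eqxx orbT.
have : elt [:: q] = elt [:: p].
  by apply: bruhat_eq le_qp _; rewrite !(partition_elt_length hn) //= qp.
by case/(partition_elt_inj hn (cp q vq) (cp p vp)).
Qed.

(* For p = 2n - 2 the two parts of size n - 1 are in the middle degree. *)
Definition row_complement p qs : seq part :=
  if qs is q :: _ then
    if q == p then [::] else if q.1 == n - 1 then [:: q] else [:: (p.1 - q.1, None)]
  else [:: p].

Lemma row_palindromic p : valid_part n p -> p.1 <= n - 1 \/ p.1 = 2 * n - 2 ->
  palindromic (elt [:: p]).
Proof.
move=> vp pn; have p_gt0 := valid_part_ge1 vp.
apply: (partition_involution_palindromic hn (c := row_complement p)) => // qs cqs.
case/(row_lower vp cqs) => [->|[q qsE]]; first by rewrite /= part_le_refl eqxx; split=> //; lia.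
rewrite {}qsE in cqs *; have [vq _ _] := cqs; have q_gt0 := valid_part_ge1 vq.
rewrite /part_le /=; case: eqP => [->|/eqP ne_qp]; first by rewrite addn0.
rewrite orbF => lt_qp; case: eqP => [qn|/eqP qn].
  by rewrite /= (negbTE ne_qp) qn eqxx /part_le; split=> //; lia.
have vc : valid_part n (p.1 - q.1, None) by apply: valid_uncolored; lia.
have q2 : q = (q.1, None) by case/(valid_part_cases hn): vq qn => [[_]|->|->|[_]] //=; lia.
rewrite /= (_ : ((p.1 - q.1, None) == p) = false); last first.
  by apply/eqP => /(congr1 fst) /=; lia.
rewrite (_ : (p.1 - q.1 == n - 1) = false); last by lia.
split=> //; rewrite ?/part_le /=; try lia.
by rewrite [in RHS]q2; congr [:: (_, _)]; lia.
Qed.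

Lemma row_not_palindromic p : valid_part n p -> n <= p.1 <= 2 * n - 3 ->
  ~ palindromic (elt [:: p]).
Proof.
move=> vp pn; have cp r : valid_part n r -> is_cp [:: r] by [].
have mid c : lower_colength (elt [:: p]) (p.1 - (n - 1)) (elt [:: (n - 1, Some c)]).
  split; last by rewrite !(partition_elt_length hn) /=; [lia | | apply/cp/valid_mid].
  apply: partition_lower_interval => //; first exact/cp/valid_mid.
  by rewrite /= /part_le /=; lia.
apply: (not_palindromic (mid color_b) (mid color_c)).
  by move/(partition_elt_inj hn (cp _ (valid_mid hn _)) (cp _ (valid_mid hn _))).
have low u : lower_interval (elt [:: p]) u -> cox_length u = p.1 - (n - 1) ->
    u = elt [:: (p.1 - (n - 1), None)].
  move=> [uJ le_up]; have [uE cqs] := colored_partitionP hn uJ.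
  move: (colored_partition u) uE cqs le_up => qs -> cqs le_up.
  rewrite (partition_elt_length hn) //.
  case: (row_lower vp cqs le_up) (cqs) => [->|[q -> _] [vq _ _]] /=; first by lia.
  by rewrite addn0 => qE; rewrite -qE -(low_part hn vq) //; lia.
by move=> u v uw vw len_u len_v; rewrite (low u) // (low v).
Qed.

End OneRow.

(** * Staircases *)

Section StrictShapes.
Implicit Types (i j k : nat) (sh : seq nat).

Definition strict_shape k sh :=
  sorted (fun i j => j < i) sh && all (fun j => 1 <= j <= k) sh.

Lemma staircaseS k : staircase k.+1 = k.+1 :: staircase k.
Proof. exact: (runS 1). Qed.

Lemma mem_staircase k j : (j \in staircase k) = (1 <= j <= k).
Proof. exact: (mem_run 1). Qed.

Let gt_trans : transitive (fun i j : nat => j < i).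
Proof. by move=> j i k ij jk; exact: ltn_trans jk ij. Qed.

Lemma strict_shape_cons k j sh :
  strict_shape k (j :: sh) = (1 <= j <= k) && strict_shape j.-1 sh.
Proof.
rewrite /strict_shape /= (path_sortedE gt_trans); apply/idP/idP.
  case/andP=> /andP[ltj ->] /andP[-> /allP shk] /=; apply/allP => i ish.
  by have := shk i ish; have := allP ltj i ish; lia.
case/andP=> jk /andP[-> /allP shj]; rewrite jk !andbT /=.
by apply/andP; split; apply/allP => i /shj; lia.
Qed.

Lemma strict_shape_leq k k' sh : k <= k' -> strict_shape k sh -> strict_shape k' sh.
Proof.
by move=> kk' /andP[srt /allP shk]; rewrite /strict_shape srt; apply/allP => i /shk; lia.
Qed.

Lemma strict_staircase k : strict_shape k (staircase k).
Proof. by elim: k => // k IH; rewrite staircaseS strict_shape_cons leqnn. Qed.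

Lemma strict_filter a k : strict_shape k (filter a (staircase k)).
Proof.
have /andP[srt /allP shk] := strict_staircase k; apply/andP; split.
  exact: sorted_filter.
by apply/allP => j; rewrite mem_filter => /andP[_ /shk].
Qed.

Lemma strict_shapeE k sh : strict_shape k sh -> [seq j <- staircase k | j \in sh] = sh.
Proof.
move=> /andP[srt /allP shk]; have /andP[srt' _] := strict_filter (mem sh) k.
apply: (irr_sorted_eq gt_trans) => //; first by move=> j; rewrite ltnn.
by move=> j; rewrite mem_filter mem_staircase andb_idr // => /shk.
Qed.

Definition shape_compl k sh := [seq j <- staircase k | j \notin sh].

Lemma shape_complK k sh : strict_shape k sh -> shape_compl k (shape_compl k sh) = sh.
Proof.
move=> strict_sh; rewrite -[RHS](strict_shapeE strict_sh); apply: eq_in_filter => j jk.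
by rewrite mem_filter jk andbT negbK.
Qed.

Lemma sumn_shape_compl k sh : strict_shape k sh ->
  sumn (shape_compl k sh) + sumn sh = sumn (staircase k).
Proof.
move=> strict_sh; rewrite -{2}(strict_shapeE strict_sh) !sumnE !big_filter addnC.
by rewrite [RHS](bigID (mem sh)).
Qed.

End StrictShapes.

Section Staircases.
Variables (n : nat) (hn : 4 <= n).
Implicit Types (e : bool) (p : part) (ps qs : seq part) (z : color) (j k : nat) (sh : seq nat).

Local Notation elt := (partition_elt n false).
Local Notation is_cp := (is_colored_partition n).
Local Notation segments ps := (map (segment1 n) ps).

Lemma color_shape_fst z sh : map fst (color_shape n z sh) = sh.
Proof. by rewrite /color_shape -map_comp map_id. Qed.

Lemma color_shape_partition z k sh :
  k <= n - 1 -> strict_shape k sh -> is_cp (color_shape n z sh).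
Proof.
elim: sh k => // j sh IH k kn; rewrite strict_shape_cons => /andP[jk strict_sh].
split; last by apply: IH strict_sh; lia.
  by apply: valid_color; lia.
case: sh strict_sh {IH} => // i sh; rewrite strict_shape_cons => /andP[ij _] /=.
by rewrite /stackable /=; lia.
Qed.

Lemma staircase_contains z k sh : strict_shape k sh ->
  rowwise part_le (color_shape n z sh) (color_shape n z (staircase k)).
Proof.
elim: k sh => [|k IH] [|j sh] //; first by rewrite strict_shape_cons; lia.
rewrite strict_shape_cons staircaseS => /andP[jk strict_sh] /=.
rewrite IH; last by apply: strict_shape_leq strict_sh; lia.
rewrite andbT /part_le /=; have [->|ne_j] := eqVneq j k.+1; first by rewrite eqxx orbT.
by apply/orP; left; lia.
Qed.

Lemma low_partition z p ps : is_cp (p :: ps) -> p.1 <= n - 2 ->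
  p :: ps = color_shape n z (map fst (p :: ps)) /\ strict_shape p.1 (map fst (p :: ps)).
Proof.
elim: ps p => [|q ps IH] p [vp pq cps] pn; have p_gt0 := valid_part_ge1 vp;
  have pE : p = (p.1, if p.1 == n - 1 then Some z else None)
    by rewrite {1}(low_part hn vp pn) ifF //; lia.
  by split; [rewrite /= -pE | rewrite strict_shape_cons leqnn p_gt0].
have qp : q.1 < p.1 by move: pq; rewrite /stackable; lia.
have [qE strict_q] := IH q cps ltac:(lia).
split; first by rewrite [in LHS]qE [in LHS]pE.
rewrite [map _ _]/= strict_shape_cons leqnn p_gt0 /=.
by apply: strict_shape_leq strict_q; lia.
Qed.

Lemma strict_partition_colored k ps : k <= n - 1 -> is_cp ps -> strict_shape k (map fst ps) ->
  exists z, ps = color_shape n z (map fst ps).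
Proof.
case: ps => [|p ps] kn cps; first by exists color_b.
rewrite [map _ _]/= strict_shape_cons => /andP[pk strict_ps]; have [vp _ cps'] := cps.
have [pn|pn] := leqP p.1 (n - 2).
  by have [psE _] := low_partition color_b cps pn; exists color_b.
have [z pE] := mid_part hn vp ltac:(lia); exists z; rewrite /= pE eqxx; congr (_ :: _).
case: ps strict_ps cps' {cps} => [//|q ps]; rewrite [map _ _]/= strict_shape_cons => strict_q cps.
by have [] := @low_partition z q ps cps ltac:(lia).
Qed.

(* For k = n - 1 and the color b the support misses s_(n-1) only: the first row
   ends with s_n, because its labels are exchanged. *)
Definition staircase_support k : pred nat := fun i =>
  if k <= n - 2 then i <= k else i != n - 1.

Lemma relabel_low e k i : 1 <= i <= k -> k <= n - 2 -> relabel n e i <= k.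
Proof. by move=> ik kn; case: e; rewrite /relabel ?/swap_ends; split_ifs; lia. Qed.

Lemma relabel_run_low e j k : j <= k -> k <= n - 2 ->
  all (leq^~ k) (map (relabel n e) (run 1 j)).
Proof.
move=> jk kn; rewrite all_map; apply/allP => i; rewrite mem_run => ij.
by apply: (@relabel_low e k); lia.
Qed.

Lemma low_strict_letters e z k sh : k <= n - 2 -> strict_shape k sh ->
  all (leq^~ k) (rows_word n e (segments (color_shape n z sh))).
Proof.
move=> kn /andP[_]; elim: sh e => //= j sh IH e /andP[jk shk].
by rewrite all_cat IH // segment1_low /= ?relabel_run_low //; lia.
Qed.

Lemma staircase_letters k : k <= n - 1 -> all (staircase_support k)
  (rows_word n false (segments (color_shape n color_b (staircase k)))).
Proof.
move=> kn; rewrite /staircase_support; have [kn'|kn'] := leqP k (n - 2).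
  by apply: low_strict_letters => //; exact: strict_staircase.
have -> : k = (n - 2).+1 by lia.
have avoid x : all (leq^~ (n - 2)) x -> all (fun i => i != n - 1) x.
  by apply: sub_all => i; lia.
rewrite staircaseS /= all_cat avoid; last exact: low_strict_letters (strict_staircase _).
rewrite (_ : (n - 2).+1 = n - 1) ?eqxx; last by lia.
rewrite segment1_b // (_ : n - 1 = (n - 2).+1); last by lia.
rewrite runS /= (_ : (1 + (n - 2)) = n - 1) ?swap_ends_pred_last //; last by lia.
by rewrite -(_ : n - 1 = (n - 2).+1) ?avoid ?relabel_run_low //; lia.
Qed.

Lemma segment1_mem_last p : valid_part n p -> n - 1 <= p.1 ->
  p = (n - 1, Some color_b) \/ n \in segment1 n p.
Proof.
case/(valid_part_cases hn) => [[pn _]|->|->|[pn _]] pn'; [by lia | by left | right..].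
  by rewrite segment1_c // mem_head.
by rewrite segment1_high ?mem_cat ?mem_head ?orbT //; lia.
Qed.

Lemma staircase_support_partition k ps : 1 <= k <= n - 1 -> is_cp ps ->
  all (staircase_support k) (rows_word n false (segments ps)) ->
  ps = color_shape n color_b (map fst ps) /\ strict_shape k (map fst ps).
Proof.
move=> kn; case: ps => [//|p ps] cps; have [vp pq cps'] := cps.
rewrite /= all_cat => /andP[/allP supp' /allP supp].
have supp_swap i : i \in segment1 n p -> staircase_support k (swap_ends n i).
  by move=> ip; apply: supp; exact: (map_f (relabel n false)).
have [pn|pn] := leqP p.1 (n - 2).
  have [pE strict_p] := low_partition color_b cps pn; split=> //.
  apply: strict_shape_leq strict_p; have [kn'|kn'] := leqP k (n - 2); last by lia.
  have p_gt0 := valid_part_ge1 vp; have := supp_swap p.1; rewrite segment1_low // mem_run.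
  by move/(_ ltac:(lia)); rewrite /staircase_support kn' /swap_ends; split_ifs; lia.
have [pE|/supp_swap] := segment1_mem_last vp ltac:(lia); last first.
  by rewrite swap_ends_last // /staircase_support; case: ifP; lia.
have := supp_swap (n - 1); rewrite pE segment1_b // mem_run swap_ends_pred_last //.
move/(_ ltac:(lia)); rewrite /staircase_support; case: ifP => kn' supp_last; first by lia.
have kE : k = n - 1 by lia.
case: ps cps pq cps' supp' => [|q ps] cps pq cps' supp'.
  by split; [rewrite /= eqxx | rewrite [map _ _]/= strict_shape_cons /strict_shape /=; lia].
have [qn|qn] := leqP q.1 (n - 2).
  have [qE strict_q] := low_partition color_b cps' qn.
  split; first by rewrite [in LHS]qE /= eqxx.
  rewrite [map _ _]/= strict_shape_cons /= kE leqnn; apply/andP; split; first lia.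
  by apply: strict_shape_leq strict_q; lia.
have qE : q = (n - 1, Some color_b).
  by move: pq; rewrite pE /stackable /= => /orP[|/andP[/eqP //]]; lia.
have : staircase_support k (n - 1).
  apply: supp'; rewrite /= mem_cat; apply/orP; right; apply: (map_f (relabel n true)).
  by rewrite qE segment1_b // mem_run; lia.
by rewrite /staircase_support kn' eqxx.
Qed.

Lemma staircase_lower k qs : k <= n - 1 -> is_cp qs ->
  bruhat_le (elt qs) (elt (color_shape n color_b (staircase k))) ->
  qs = color_shape n color_b (map fst qs) /\ strict_shape k (map fst qs).
Proof.
move=> kn cqs le_qs; have valid := colored_partition_valid cqs.
have [k0|k_gt0] := posnP k.
  move: le_qs => /bruhat_length; rewrite k0 [X in _ <= cox_length X]partition_elt_nil cox_length1.
  rewrite (partition_elt_length hn) //; case: qs cqs {valid} => [//|q qs [vq _ _]] /=.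
  by have := valid_part_ge1 vq; lia.
pose J : {pred 'I_n.+1} := [pred i : 'I_n.+1 | staircase_support k i].
have letters_J ps : {in ps, forall p, valid_part n p} ->
    all (mem J) (letters n (rows_word n false (segments ps))) =
    all (staircase_support k) (rows_word n false (segments ps)).
  move=> vps; rewrite all_map; apply: eq_in_all => i ips.
  by rewrite /= inE /= inordK // ltnS (allP (rows_word_le hn false (segments_le hn vps))).
have qsJ : parabolic J (elt qs).
  apply: (bruhat_parabolic le_qs); eexists; last by [].
  rewrite letters_J; first exact: staircase_letters.
  by apply: colored_partition_valid; exact: color_shape_partition kn (strict_staircase k).
apply: staircase_support_partition; rewrite ?k_gt0 // -letters_J //.
apply: (reduced_word_letters (cox_gen_inj (affD_laced n)) _ qsJ).
by rewrite [RHS](partition_elt_length hn) // size_map size_rows_word total_segments.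
Qed.

Lemma staircase_palindromic k z : k <= n - 1 -> palindromic (elt (color_shape n z (staircase k))).
Proof.
move=> kn; have stair_bounds : all (fun j => 1 <= j <= n - 1) (staircase k).
  by apply/allP => j; rewrite mem_staircase; lia.
apply/(palindromic_color_shape hn z stair_bounds).
pose c (qs : seq part) := color_shape n color_b (shape_compl k (map fst qs)).
have cp sh : strict_shape k sh -> is_cp (color_shape n color_b sh).
  exact: color_shape_partition.
apply: (partition_involution_palindromic hn (c := c)); first exact: cp (strict_staircase k).
move=> qs cqs /(staircase_lower kn cqs)[qsE strict_qs]; split.
- exact: cp (strict_filter _ _).
- exact: staircase_contains (strict_filter _ _).
- by rewrite /c color_shape_fst shape_complK // -qsE.
- by rewrite !color_shape_fst sumn_shape_compl.
Qed.

End Staircases.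

(** * Spirals *)

Ltac eval_at xE := split_ifs; rewrite ?xE; try lia; split_ifs; try lia.

Section Spirals.
Local Open Scope ring_scope.
Variables (n : nat) (hn : (4 <= n)%N).
Implicit Types (ss : seq (seq nat)) (x y : nat -> int) (c i j k l m d r : nat) (sh : seq nat).

Local Notation asc := (affD_ascending n 1).
Local Notation rows_ascending := (rows_ascending n).
Local Notation rows_point := (rows_point n).
Local Notation row_point := (row_point n).
Local Notation size_sum ss := (sumn (map size ss)).

Lemma rows_not_palindromic k j ss0 ss ss1 ss2 (x := rows_point ss0 base_point) :
  (1 <= k <= 2)%N -> rows_ascending (ss0 ++ ss) base_point ->
  rows_ascending ss1 x -> rows_ascending ss2 x ->
  rowwise subseq ss1 ss -> rowwise subseq ss2 ss -> size ss1 = size ss2 ->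
  (size_sum ss1 + k)%N = size_sum ss -> (size_sum ss2 + k)%N = size_sum ss ->
  (1 <= j <= n)%N -> rows_point ss1 x j <> rows_point ss2 x j ->
  ~ palindromic (rows_prod n false (ss0 ++ ss)).
Proof.
move=> kn asc_ss asc1 asc2 sub1 sub2 size_eq sum1 sum2 jn ne.
have asc0 : rows_ascending ss0 base_point by move: asc_ss; rewrite rows_ascending_cat => /andP[].
have low ss' : rows_ascending ss' x -> rowwise subseq ss' ss ->
    (size_sum ss' + k)%N = size_sum ss ->
    lower_colength (rows_prod n false (ss0 ++ ss)) k (rows_prod n false (ss0 ++ ss')).
  move=> asc' sub' sum'; have asc_ss' : rows_ascending (ss0 ++ ss') base_point.
    by rewrite rows_ascending_cat asc0.
  split; last first.
    by rewrite !(rows_prod_length hn false) // !map_cat !sumn_cat -addnA sum'.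
  split; first exact: (rows_prod_min hn (e := false) asc_ss').
  by apply: rows_bruhat; rewrite ?rowwise_catl //; exact: subseq_refl.
apply: (two_lower_not_palindromic hn kn (low _ asc1 sub1 sum1) (low _ asc2 sub2 sum2)).
apply: (rows_prod_neq hn _ _ _ jn); rewrite ?rows_ascending_cat ?asc0 //.
  by rewrite !size_cat size_eq.
by rewrite !rows_point_cat.
Qed.

Lemma row_point_run m d x k : (0 < m)%N -> (m + d <= n)%N -> row_point (run m d) x k =
  if k == 1%N then 1 - (if (m == 1%N) && (0 < d)%N then x 2%N else x 1%N)
  else if k == n then - (if (m + d == n)%N then x m else x n)
  else if (m <= k < m + d)%N then x k.+1 else if k == (m + d)%N then x m else x k.
Proof. by move=> m_gt0 md; rewrite /row_point /swap_coords !acts_run //; coords x. Qed.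

Definition low_rows sh : seq (seq nat) := map (run 1) sh.

Lemma low_rows_cat sh sh' : low_rows (sh ++ sh') = low_rows sh ++ low_rows sh'.
Proof. exact: map_cat. Qed.

Lemma segments_color_b sh : all (fun j => 1 <= j <= n - 1)%N sh ->
  map (segment1 n) (color_shape n color_b sh) = low_rows sh.
Proof.
move=> /allP sh_bounds; rewrite -map_comp; apply/eq_in_map => j /sh_bounds jn /=.
by case: eqP => [->|ne_j]; [exact: segment1_b | rewrite segment1_low //=; lia].
Qed.

Definition spiral_shape r l d : seq nat := nseq r (n - 1)%N ++ run l d.

Lemma spiral_shape_bounds r l d : (1 <= l)%N -> (l + d <= n - 1)%N ->
  all (fun j => 1 <= j <= n - 1)%N (spiral_shape r l d).
Proof.
move=> l_gt0 ld; apply/allP => j; rewrite mem_cat mem_run => /orP[|ij]; last by lia.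
by rewrite mem_nseq => /andP[_ /eqP->]; lia.
Qed.

Lemma run_partition z l d : (1 <= l)%N -> (l + d <= n - 1)%N ->
  is_colored_partition n (color_shape n z (run l d)).
Proof.
move=> l_gt0 ld; elim: d ld => // d IH ld; rewrite runS; split; last by apply: IH; lia.
  by rewrite ifF; [apply: valid_uncolored|]; lia.
by case: d ld {IH} => // d ld; rewrite runS /= /stackable /=; lia.
Qed.

Lemma spiral_ascending r l d : (1 <= l)%N -> (l + d <= n - 1)%N ->
  rows_ascending (low_rows (spiral_shape r l d)) base_point.
Proof.
move=> l_gt0 ld; rewrite -segments_color_b ?spiral_shape_bounds //.
apply: (partition_ascending hn); elim: r => [|r IH]; first exact: run_partition.
split=> //=; first by rewrite eqxx; exact: valid_mid.
case: r {IH} => [|r] /=; last by rewrite /stackable !eqxx /= leqnn ?orbT.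
by case: d ld => // d ld; rewrite runS /stackable /=; lia.
Qed.

Lemma spiral_point r k : (1 <= k <= n)%N -> rows_point (low_rows (nseq r (n - 1)%N)) base_point k =
  if k == 1%N then 1 + (r %/ n)%N%:Z else - ((r + k - 1) %/ n)%N%:Z.
Proof.
elim: r k => [|r IH] k kn.
  by rewrite /base_point /=; case: eqP => _; rewrite ?div0n // divn_small //; lia.
rewrite -addn1 nseqD /low_rows map_cat rows_point_cat /= row_point_run; try lia.
rewrite (_ : r + 1 + k - 1 = r + k)%N; last by lia.
case: (k =P 1%N) => [_|k_neq1].
  by rewrite IH /=; [rewrite (_ : r + 2 - 1 = r + 1)%N; split_ifs; lia | lia].
case: (k =P n) => [->|kN].
  rewrite IH; last by lia.
  by split_ifs; rewrite divnDr // divnn; case: (n) hn => //= n' _; lia.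
rewrite !IH; try lia.
by split_ifs; rewrite addnS subn1.
Qed.

Lemma spiral_coord c a k : (a < n)%N -> (1 <= k <= n)%N ->
  rows_point (low_rows (nseq (c * n + a) (n - 1)%N)) base_point k =
  if k == 1%N then 1 + c%:Z else if (a + k <= n)%N then - c%:Z else - c.+1%:Z.
Proof.
move=> an kn; have n0 : (0 < n)%N by lia.
rewrite spiral_point //; case: eqP => [_|k_neq1]; first by rewrite divnMDl // divn_small // addn0.
rewrite (_ : (c * n + a + k - 1 = c * n + (a + k - 1))%N); last by lia.
case: leqP => akn; rewrite divnMDl //; first by rewrite divn_small ?addn0 //; lia.
rewrite (_ : (a + k - 1 = 1 * n + (a + k - 1 - n))%N); last by lia.
by rewrite divnMDl // divn_small ?addn0 ?addn1 //; lia.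
Qed.

Lemma asc_run1 j x : (j <= n - 1)%N -> (forall k, (2 <= k <= j.+1)%N -> x k < x 1%N) ->
  asc (run 1 j) x.
Proof. by move=> jn below; apply/(asc_run hn) => [||k kj]; try apply: below; lia. Qed.

Lemma run_subseq_delete j m : (1 <= m <= j)%N ->
  subseq (run m.+1 (j - m) ++ run 1 (m - 1)) (run 1 j).
Proof.
move=> mj; rewrite (_ : run 1 j = run m.+1 (j - m) ++ run 1 m); last first.
  by rewrite -(add1n m) -run_cat subnKC //; lia.
by rewrite cat_subseq // run_subseq //; lia.
Qed.

(* The last entry -c can travel past the entries -(c+1) in place of x_1. *)
Lemma spiral_ge2_not_palindromic c a : (2 <= a < n)%N ->
  ~ palindromic (rows_prod n false (low_rows (nseq (c * n + a) (n - 1)%N))).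
Proof.
move=> an; pose x := rows_point (low_rows (nseq (c * n + (a - 1)) (n - 1)%N)) base_point.
have xE k : (1 <= k <= n)%N -> x k =
    if k == 1%N then 1 + c%:Z else if (a - 1 + k <= n)%N then - c%:Z else - c.+1%:Z.
  by apply: spiral_coord; lia.
have x_max k : (2 <= k <= n)%N -> x k < x 1%N by move=> kn; eval_at xE.
rewrite (_ : c * n + a = c * n + (a - 1) + 1)%N; last by lia.
have asc_ss := @spiral_ascending (c * n + (a - 1) + 1) 1 0 isT.
rewrite /spiral_shape cats0 nseqD low_rows_cat in asc_ss; rewrite nseqD low_rows_cat.
pose m := (n - a)%N.
apply: (@rows_not_palindromic 1 m _ [:: run 1 (n - 1)] [:: run 1 (n - 2)]
  [:: run m.+1 (n - 1 - m) ++ run 1 (m - 1)]); rewrite -/x //.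
- by apply: asc_ss; lia.
- by rewrite /= asc_run1; [|lia|move=> k kn; apply: x_max; lia].
- rewrite /= andbT affD_ascending_cat [X in _ && X]asc_run1; try lia; last first.
    by move=> k kn; apply: x_max; lia.
  rewrite andbT; apply/(asc_run hn) => [||k kn]; try lia.
  by rewrite !acts_run; try lia; eval_at xE.
- by rewrite /= run_subseq //; lia.
- by rewrite /= run_subseq_delete //; lia.
- by rewrite /= !size_run; lia.
- by rewrite /= size_cat !size_run; lia.
- by lia.
rewrite /= /row_point /swap_coords affD_acts_cat !acts_run; try lia.
by eval_at xE.
Qed.

Lemma spiral0_not_palindromic c :
  ~ palindromic (rows_prod n false (low_rows (nseq (c.+1 * n) (n - 1)%N))).
Proof.
pose x := rows_point (low_rows (nseq (c * n + (n - 2)) (n - 1)%N)) base_point.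
have xE k : (1 <= k <= n)%N -> x k =
    if k == 1%N then 1 + c%:Z else if k == 2%N then - c%:Z else - c.+1%:Z.
  by move=> kn; rewrite /x spiral_coord; try lia; split_ifs.
rewrite (_ : c.+1 * n = c * n + (n - 2) + 2)%N; last by rewrite mulSn; lia.
have asc_ss := @spiral_ascending (c * n + (n - 2) + 2) 1 0 isT.
rewrite /spiral_shape cats0 nseqD low_rows_cat in asc_ss; rewrite nseqD low_rows_cat.
pose y := row_point (run 1 (n - 1)) x.
have yE k : (1 <= k <= n)%N -> y k = if k == 1%N then 1 + c%:Z else - c.+1%:Z.
  by move=> kn; rewrite /y row_point_run; try lia; eval_at xE.
have asc_x : asc (run 1 (n - 1)) x by apply: asc_run1; [lia | move=> k kn; eval_at xE].
pose z := row_point (run 2 (n - 2)) x.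
have zE k : (1 <= k <= n)%N -> z k =
    if k == 1%N then - c%:Z else if k == n then c%:Z else - c.+1%:Z.
  by move=> kn; rewrite /z row_point_run; try lia; eval_at xE.
apply: (@rows_not_palindromic 2 (n - 1) _ _ [:: run 1 (n - 1); run 1 (n - 3)]
  [:: run 2 (n - 2); run 1 (n - 2)]); rewrite -/x //.
- by apply: asc_ss; lia.
- rewrite [rows_ascending _ _]/= -/y asc_x andbT.
  by apply: asc_run1; [lia | move=> k kn; eval_at yE].
- rewrite [rows_ascending _ _]/= -/z andbT; apply/andP; split.
    by apply/(asc_run hn) => [||k kn]; try lia; eval_at xE.
  by apply: asc_run1; [lia | move=> k kn; eval_at zE].
- by rewrite /= !run_subseq //; lia.
- have := @run_subseq_delete (n - 1) 1; rewrite cats0 (_ : n - 1 - 1 = n - 2)%N; last by lia.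
  by rewrite /= => ->; rewrite ?run_subseq //; lia.
- by rewrite /= !size_run; lia.
- by rewrite /= !size_run; lia.
- by lia.
rewrite -[_ <> _]/(row_point _ y _ <> row_point _ z _) !row_point_run; try lia.
by split_ifs; rewrite ?yE ?zE; try lia; split_ifs; lia.
Qed.

Lemma stairs_ascending l d x : (1 <= l)%N -> (l + d <= n - 1)%N ->
  (forall i, (2 <= i <= l + d)%N -> x i < x 1%N) ->
  (forall i j, (2 <= i < j)%N -> (j <= l + d)%N -> (i <= d)%N -> x i + x j <= 0) ->
  rows_ascending (low_rows (run l d)) x.
Proof.
elim: d x => // d IH x l_gt0 ld x_max sum_le0; rewrite runS /=; apply/andP; split.
  by apply: asc_run1; [lia | move=> k kn; apply: x_max; lia].
have [->//|d_gt0] := posnP d.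
apply: IH => //; first lia.
  by move=> i il; rewrite !row_point_run; try lia; split_ifs; have := sum_le0 2%N i.+1; lia.
by move=> i j ij jl id; rewrite !row_point_run; try lia; split_ifs; apply: sum_le0; lia.
Qed.

Lemma stairs_point l d x i : (1 <= l)%N -> (l + d <= n - 1)%N -> (1 <= i <= l)%N ->
  rows_point (low_rows (run l d)) x i =
  if i == 1%N then (if d == 0%N then x 1%N else 1 - x d.+1) else x (i + d)%N.
Proof.
elim: d x i => [|d IH] x i l_gt0 ld il; first by rewrite /= addn0; case: eqP => [->|].
rewrite runS /= IH; try lia.
by have [->|d_gt0] := posnP d; rewrite ?row_point_run; try lia; coords x.
Qed.

Lemma size_sum_low_rows sh : size_sum (low_rows sh) = sumn sh.
Proof. by rewrite -map_comp (eq_map (g := id)) ?map_id // => j; exact: size_run. Qed.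

Lemma subrows_refl ss : rowwise subseq ss ss.
Proof. exact: rowwise_refl (@subseq_refl _) ss. Qed.

(* The row 1 of a staircase is emptied rather than removed, so that the number
   of rows and hence the labels 0 and 1 are preserved. *)
Lemma stairs_empty_last d : (0 < d)%N -> let ss := low_rows (run 2 d.-1) ++ [:: [::]] in
  [/\ rowwise subseq ss (low_rows (run 1 d)), size ss = d & (size_sum ss + 1)%N = sumn (run 1 d)].
Proof.
case: d => // d _; rewrite run_rcons -cats1 low_rows_cat; split.
- by rewrite rowwise_catl //; exact: subseq_refl.
- by rewrite size_cat size_map size_run addn1.
- by rewrite map_cat !sumn_cat size_sum_low_rows addn0.
Qed.

Lemma rows_point_empty_last ss x :
  rows_point (ss ++ [:: [::]]) x 1%N = 1 - rows_point ss x 1%N.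
Proof. by rewrite rows_point_cat. Qed.

(* Here it is x_2 = -c that can travel past the entries -(c+1) in place of x_1. *)
Lemma stairs_not_palindromic c m ss0 (x := rows_point ss0 base_point) : (2 <= m <= n - 1)%N ->
  rows_ascending (ss0 ++ low_rows (run 1 m)) base_point ->
  (forall i, (1 <= i <= m.+1)%N -> x i =
     if i == 1%N then 1 + c%:Z else if i == 2%N then - c%:Z else - c.+1%:Z) ->
  ~ palindromic (rows_prod n false (ss0 ++ low_rows (run 1 m))).
Proof.
case: m => [|[|d]] mn; try lia; rewrite runS add1n => asc_ss xE.
pose x' := row_point (run 1 d.+2) x; pose y := row_point (run 2 d.+1) x.
have x'E i : (1 <= i <= d.+2)%N -> x' i = if i == 1%N then 1 + c%:Z else - c.+1%:Z.
  by move=> im; rewrite /x' row_point_run; try lia; eval_at xE.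
have yE i : (1 <= i <= d.+2)%N -> y i = if i == 1%N then - c%:Z else - c.+1%:Z.
  by move=> im; rewrite /y row_point_run; try lia; eval_at xE.
have [sub_empty size_empty sum_empty] := stairs_empty_last (ltn0Sn d).
apply: (@rows_not_palindromic 1 1 _ _ (run 2 d.+1 :: low_rows (run 1 d.+1))
  (run 1 d.+2 :: low_rows (run 2 d) ++ [:: [::]])); rewrite -/x //.
- rewrite [rows_ascending _ _]/= -/y; apply/andP; split.
    by apply/(asc_run hn) => [||k kn]; try lia; eval_at xE.
  by apply: stairs_ascending; try lia; move=> *; eval_at yE.
- rewrite [rows_ascending _ _]/= -/x'; apply/andP; split.
    by apply: asc_run1; [lia | move=> k kn; eval_at xE].
  rewrite rows_ascending_cat /= andbT.
  by apply: stairs_ascending; try lia; move=> *; eval_at x'E.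
- have := @run_subseq_delete d.+2 1; rewrite cats0 subSS subn0 /= => -> //.
  by rewrite subrows_refl.
- by rewrite /= run_subseq.
- by rewrite [RHS]/= size_empty /= size_map size_run.
- by rewrite /= !size_run; lia.
- by rewrite [size_sum _]/= [RHS]/= size_run -addnA sum_empty size_sum_low_rows.
- by lia.
rewrite -[_ <> _]/(rows_point _ y _ <> rows_point (_ ++ _) x' _).
rewrite rows_point_empty_last !stairs_point; try lia.
by split_ifs; rewrite ?x'E ?yE; try lia; split_ifs; lia.
Qed.

Lemma spiral_stairs_ge2_not_palindromic c a : (2 <= a < n)%N ->
  ~ palindromic (rows_prod n false (low_rows (spiral_shape (c * n + a) 1 (n - 2)))).
Proof.
move=> an; have [sh0 [shE x_coord]] : exists sh0,
    spiral_shape (c * n + a) 1 (n - 2) = sh0 ++ run 1 a /\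
    (forall i, (1 <= i <= a.+1)%N -> rows_point (low_rows sh0) base_point i =
       if i == 1%N then 1 + c%:Z else if i == 2%N then - c%:Z else - c.+1%:Z).
  have [->|ne_a] := eqVneq a (n - 1)%N.
    exists (nseq (c * n + (n - 2)) (n - 1)%N); split=> [|i ia].
      rewrite /spiral_shape (_ : c * n + (n - 1) = c * n + (n - 2) + 1)%N; last by lia.
      by rewrite nseqD -catA (_ : (n - 1)%N = (n - 2).+1) ?runS //; lia.
    by rewrite spiral_coord; try lia; split_ifs.
  exists (spiral_shape (c * n + a) a.+1 (n - 2 - a)); split=> [|i ia].
    by rewrite /spiral_shape -catA -(add1n a) -run_cat; congr (_ ++ run _ _); lia.
  rewrite low_rows_cat rows_point_cat stairs_point ?spiral_coord; try lia.
  by split_ifs; lia.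
have asc_sh := @spiral_ascending (c * n + a) 1 (n - 2) isT ltac:(lia).
rewrite shE low_rows_cat in asc_sh *.
by apply: (stairs_not_palindromic (c := c)) => //; lia.
Qed.

Section FullTurns.
Variable c : nat.

Let x := rows_point (low_rows (nseq (c * n + (n - 1)) (n - 1)%N)) base_point.
Let y j := row_point (run 1 j) x.

Let xE k : (1 <= k <= n)%N -> x k = if k == 1%N then 1 + c%:Z else - c.+1%:Z.
Proof. by move=> kn; rewrite /x spiral_coord; try lia; split_ifs. Qed.

Let yE j k : (n - 2 <= j <= n - 1)%N -> (1 <= k <= n)%N -> y j k =
  if k == 1%N then 2 + c%:Z else if (j <= n - 2)%N && (n - 1 <= k)%N then 1 + c%:Z
  else - c.+1%:Z.
Proof. by move=> jn kn; rewrite /y row_point_run; try lia; eval_at xE. Qed.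

Let asc_x j : (j <= n - 1)%N -> asc (run 1 j) x.
Proof. by move=> jn; apply: asc_run1 => // k kn; eval_at xE. Qed.

Let asc_y i j : (n - 2 <= i <= n - 1)%N -> (j <= n - 1)%N -> asc (run 1 j) (y i).
Proof. by move=> iN jn; apply: asc_run1 => // k kn; eval_at yE. Qed.

Let w := row_point (run 1 (n - 1)) (y (n - 1)).
Let v := row_point (run 1 (n - 1)) (y (n - 2)).
Let u := rows_point (low_rows (run 3 (n - 4))) w.

Let wE k : (1 <= k <= n - 1)%N -> w k = if k == 1%N then 2 + c%:Z else - c.+1%:Z.
Proof. by move=> kn; rewrite /w row_point_run; try lia; eval_at yE. Qed.

Let vE k : (1 <= k <= n - 1)%N -> v k =
  if k == 1%N then 2 + c%:Z else if (k <= n - 3)%N then - c.+1%:Z else 1 + c%:Z.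
Proof. by move=> kn; rewrite /v row_point_run; try lia; eval_at yE. Qed.

Let uE k : (1 <= k <= 3)%N -> u k = if k == 1%N then 2 + c%:Z else - c.+1%:Z.
Proof. by move=> kn; rewrite /u stairs_point; try lia; eval_at wE. Qed.

Lemma spiral1_not_palindromic :
  ~ palindromic (rows_prod n false (low_rows (nseq (c.+1 * n + 1) (n - 1)%N))).
Proof.
rewrite (_ : c.+1 * n + 1 = c * n + (n - 1) + 2)%N; last by rewrite mulSn; lia.
have asc_ss := @spiral_ascending (c * n + (n - 1) + 2) 1 0 isT.
rewrite /spiral_shape cats0 nseqD low_rows_cat in asc_ss; rewrite nseqD low_rows_cat.
apply: (@rows_not_palindromic 1 (n - 1) _ _ [:: run 1 (n - 1); run 1 (n - 2)]
  [:: run 1 (n - 2); run 1 (n - 1)]); rewrite -/x //.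
- by apply: asc_ss; lia.
- by rewrite [rows_ascending _ _]/= -/(y (n - 1)) asc_x ?asc_y; lia.
- by rewrite [rows_ascending _ _]/= -/(y (n - 2)) asc_x ?asc_y; lia.
- by rewrite /= !run_subseq //; lia.
- by rewrite /= !run_subseq //; lia.
- by rewrite /= !size_run; lia.
- by rewrite /= !size_run; lia.
- by lia.
rewrite -[_ <> _]/(row_point _ (y (n - 1)) _ <> row_point _ (y (n - 2)) _).
rewrite !row_point_run; try lia.
by eval_at yE.
Qed.

Lemma spiral_stairs0_not_palindromic :
  ~ palindromic (rows_prod n false (low_rows (spiral_shape (c.+1 * n) 1 (n - 2)))).
Proof.
have asc_ss := @spiral_ascending (c.+1 * n) 1 (n - 2) isT ltac:(lia).
have shE : spiral_shape (c.+1 * n) 1 (n - 2) =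
    nseq (c * n + (n - 1)) (n - 1)%N ++ (n - 1)%N :: run 1 (n - 2).
  rewrite /spiral_shape (_ : c.+1 * n = c * n + (n - 1) + 1)%N; last by rewrite mulSn; lia.
  by rewrite nseqD -catA.
rewrite shE low_rows_cat in asc_ss *.
have [sub_empty size_empty sum_empty] := @stairs_empty_last (n - 2) ltac:(lia).
apply: (@rows_not_palindromic 1 1 _ _
  (run 1 (n - 1) :: low_rows (run 2 (n - 2).-1) ++ [:: [::]])
  (run 1 (n - 2) :: low_rows (run 1 (n - 2)))); rewrite -/x //.
- rewrite [rows_ascending _ _]/= -/(y (n - 1)) asc_x // rows_ascending_cat /= andbT.
  by apply: stairs_ascending; try lia; move=> *; eval_at yE.
- rewrite [rows_ascending _ _]/= -/(y (n - 2)) asc_x; last by lia.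
  by apply: stairs_ascending; try lia; move=> *; eval_at yE.
- by rewrite /= subseq_refl.
- by rewrite /= subrows_refl run_subseq //; lia.
- by rewrite [LHS]/= size_empty /= size_map size_run.
- by rewrite [size_sum _]/= [RHS]/= size_run -addnA sum_empty size_sum_low_rows.
- by rewrite /= !size_run; lia.
- by lia.
rewrite -[_ <> _]/(rows_point (_ ++ _) (y (n - 1)) _ <> rows_point _ (y (n - 2)) _).
rewrite rows_point_empty_last !stairs_point; try lia.
by split_ifs; rewrite !yE; try lia; split_ifs; lia.
Qed.

Lemma spiral_stairs1_not_palindromic :
  ~ palindromic (rows_prod n false (low_rows (spiral_shape (c.+1 * n + 1) 1 (n - 2)))).
Proof.
have asc_ss := @spiral_ascending (c.+1 * n + 1) 1 (n - 2) isT ltac:(lia).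
have shE : spiral_shape (c.+1 * n + 1) 1 (n - 2) =
    nseq (c * n + (n - 1)) (n - 1)%N ++ [:: n - 1, n - 1 & run 1 (n - 2)]%N.
  rewrite /spiral_shape (_ : c.+1 * n + 1 = c * n + (n - 1) + 2)%N; last by rewrite mulSn; lia.
  by rewrite nseqD -catA.
rewrite shE low_rows_cat in asc_ss *.
have stairsE : run 1 (n - 2) = run 3 (n - 4) ++ [:: 2; 1]%N.
  by rewrite -[[:: 2; 1]%N]/(run 1 2) -(run_cat 1 2); congr run; lia.
have [sub_empty size_empty sum_empty] := @stairs_empty_last (n - 2) ltac:(lia).
apply: (@rows_not_palindromic 2 1 _ _
  [:: run 1 (n - 1), run 1 (n - 1) & (low_rows (run 3 (n - 4)) ++ [:: run 1 1]) ++ [:: [::]]]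
  [:: run 1 (n - 2), run 1 (n - 1) & low_rows (run 2 (n - 2).-1) ++ [:: [::]]]); rewrite -/x //.
- rewrite [rows_ascending _ _]/= -/(y (n - 1)) -/w asc_x // asc_y; try lia.
  rewrite !rows_ascending_cat -/u !andTb [rows_ascending [:: [::]] _]/= andbT; apply/andP; split.
    by apply: stairs_ascending; try lia; move=> *; eval_at wE.
  rewrite -[rows_ascending _ _]/(asc (run 1 1) u && true) andbT.
  by apply: asc_run1; [lia | move=> k kn; eval_at uE].
- rewrite [rows_ascending _ _]/= -/(y (n - 2)) -/v asc_x ?asc_y; try lia.
  rewrite rows_ascending_cat /= andbT.
  by apply: stairs_ascending; try lia; move=> *; eval_at vE.
- rewrite /= !subseq_refl stairsE low_rows_cat -catA rowwise_catl; last exact: subseq_refl.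
  by [].
- by rewrite /= subseq_refl run_subseq //; lia.
- by rewrite /= !size_cat /= !size_map !size_run; lia.
- by rewrite /= !map_cat !sumn_cat !size_sum_low_rows stairsE sumn_cat /= !size_run; lia.
- by move: sum_empty; rewrite /= !size_sum_low_rows !size_run; lia.
- by lia.
rewrite -[_ <> _]/(rows_point (_ ++ _) w _ <> rows_point (_ ++ _) v _).
rewrite !rows_point_empty_last rows_point_cat -/u [rows_point [:: _] _]/=.
rewrite row_point_run ?stairs_point; try lia.
by split_ifs; rewrite ?uE ?vE; try lia; split_ifs; lia.
Qed.

End FullTurns.

Lemma spiral_not_palindromic z r d : (2 <= r)%N -> d = 0%N \/ d = (n - 2)%N ->
  ~ palindromic (partition_elt n false (color_shape n z (spiral_shape r 1 d))).
Proof.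
move=> r_gt1 dE; have sh_bounds : all (fun j => 1 <= j <= n - 1)%N (spiral_shape r 1 d).
  by apply: spiral_shape_bounds; lia.
move/(palindromic_color_shape hn z sh_bounds).
rewrite /partition_elt segments_color_b //.
have rE := divn_eq r n; have lt_a : (r %% n < n)%N by rewrite ltn_mod; lia.
move: (r %/ n)%N (r %% n)%N rE lt_a => c a rE lt_a; rewrite {}rE in r_gt1 *.
have [le2a|lta2] := leqP 2 a.
  case: dE => ->; rewrite /spiral_shape ?cats0.
    by apply: spiral_ge2_not_palindromic; rewrite le2a.
  by apply: spiral_stairs_ge2_not_palindromic; rewrite le2a.
case: c r_gt1 => [|c] r_gt1; first by lia.
case: a lta2 {lt_a r_gt1} => [|[|a]] // _; rewrite ?addn0;
  case: dE => ->; rewrite /spiral_shape ?cats0.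
- exact: spiral0_not_palindromic.
- exact: spiral_stairs0_not_palindromic.
- exact: spiral1_not_palindromic.
- exact: spiral_stairs1_not_palindromic.
Qed.

End Spirals.

(** * Classification *)

Lemma cat_cons_neq (T : Type) (x y : T) (s t t' : seq T) :
  x <> y -> s ++ x :: t <> s ++ y :: t'.
Proof. by move=> ne_xy; elim: s => [|z s IH] /= []. Qed.

Section Classification.
Variables (n : nat) (hn : 4 <= n).
Implicit Types (p q : part) (ps qs : seq part) (z : color) (j k a r : nat) (sh : seq nat).

Local Notation elt := (partition_elt n false).
Local Notation is_cp := (is_colored_partition n).
Local Notation total ps := (sumn (map fst ps)).

Lemma colored_partition_catr ps qs : is_cp (ps ++ qs) -> is_cp qs.
Proof. by elim: ps => // p ps IH [_ _ /IH]. Qed.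

Lemma colored_partition_catl ps qs : is_cp (ps ++ qs) -> is_cp ps.
Proof. by elim: ps => // p ps IH [vp pq /IH cps]; split=> //; case: ps pq {IH cps}. Qed.

Lemma colored_partition_replace ps p q qs : is_cp (ps ++ p :: qs) -> valid_part n q ->
  q.1 < p.1 -> (if qs is q' :: _ then stackable n q q' else true) -> is_cp (ps ++ q :: qs).
Proof.
elim: ps => [|p' ps IH]; first by move=> [_ _ cqs] vq _ q_qs; split=> //; case: qs q_qs {cqs}.
move=> [vp' p'_ps cps] vq qp q_qs; split; [by [] | | exact: IH].
case: ps p'_ps {IH cps} => //=; rewrite /stackable => /orP[pp'|/andP[/eqP <- _]].
  by rewrite (ltn_trans qp).
by rewrite qp.
Qed.

Lemma part_pred p : valid_part n p -> 1 < p.1 -> exists2 q, valid_part n q & p.1 = q.1.+1.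
Proof.
move=> vp p_gt1; have pn := valid_part_leq vp; have [pN|pN] := eqVneq p.1 n.
  by exists (n - 1, Some color_b); [exact: valid_mid | rewrite /=; lia].
by exists (p.1 - 1, None); [apply: valid_uncolored; lia | rewrite /=; lia].
Qed.

Lemma remove_last_box ps qs : qs <> [::] -> is_cp (ps ++ qs) ->
  exists qs', [/\ is_cp (ps ++ qs'), rowwise part_le qs' qs & total qs' + 1 = total qs].
Proof.
case/lastP: qs => // qs q _; rewrite -cats1 catA => cqs.
have [vq _ _] := colored_partition_catr cqs.
have [q_le1|q_gt1] := leqP q.1 1.
  exists qs; split; first exact: colored_partition_catl cqs.
    by rewrite -{1}[qs]cats0 contained_catl.
  by rewrite map_cat sumn_cat /=; have := valid_part_ge1 vq; lia.
have [q' vq' qq'] := part_pred vq q_gt1; exists (qs ++ [:: q']); split.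
- by rewrite catA; apply: colored_partition_replace cqs vq' _ _; rewrite ?qq'.
- by rewrite lower_row_contained // qq'.
- by rewrite !map_cat !sumn_cat /= qq'; lia.
Qed.

(* Only the last row can lose a box. *)
Definition tight ps := forall ps1 p q ps2, ps = ps1 ++ [:: p, q & ps2] ->
  forall p', valid_part n p' -> p.1 = p'.1.+1 -> ~~ stackable n p' q.

Lemma tight_behead p ps : tight (p :: ps) -> tight ps.
Proof. by move=> t_ps ps1 p1 q ps2 psE; apply: (t_ps (p :: ps1) p1 q ps2); rewrite psE. Qed.

Lemma palindromic_tight ps : is_cp ps -> palindromic (elt ps) -> tight ps.
Proof.
move=> cps pal ps1 p q ps2 psE p' vp' pp'; rewrite {}psE in cps pal; apply/negP => p'q.
have cp' : is_cp (ps1 ++ [:: p', q & ps2]).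
  by apply: colored_partition_replace cps vp' _ _; rewrite ?pp'.
have [//||qs [cqs sub_qs total_qs]] := @remove_last_box (ps1 ++ [:: p]) (q :: ps2).
  by rewrite -catA.
rewrite -catA in cqs.
apply: (two_contained_not_palindromic hn (k := 1) _ cps cp' cqs) pal => //.
- by rewrite lower_row_contained // pp'.
- by rewrite contained_catl /= part_le_refl.
- by rewrite !map_cat !sumn_cat /= pp'; lia.
- by move: total_qs; rewrite !map_cat !sumn_cat /=; lia.
by apply: cat_cons_neq => p'E; move: pp'; rewrite p'E; lia.
Qed.

Lemma tight_pair p q : valid_part n p -> valid_part n q -> stackable n p q ->
  (forall p', valid_part n p' -> p.1 = p'.1.+1 -> ~~ stackable n p' q) ->
  if q.1 < n - 1 then p.1 = q.1.+1 else p = q.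
Proof.
move=> vp vq pq tight_pq; have q_gt0 := valid_part_ge1 vq.
have stackable_gt p' : q.1 < p'.1 -> stackable n p' q by rewrite /stackable => ->.
have pred_le : q.1 < p.1 -> p.1 <= q.1.+1.
  move=> qp; rewrite leqNgt; apply/negP => q_gap.
  have [|p' vp' pp'] := part_pred vp; first by lia.
  by have /negP := tight_pq p' vp' pp'; apply; apply: stackable_gt; lia.
case: ifP => qn; case/orP: pq => [qp|/andP[/eqP qpE pn]].
- by have := pred_le qp; lia.
- by move: qn; rewrite qpE; lia.
- have pE : p.1 = q.1.+1 by have := pred_le qp; lia.
  have /negP[] := tight_pq q vq pE.
  by rewrite /stackable eqxx /=; apply/orP; right; lia.
- by [].
Qed.

Lemma color_shape_low z z' sh : all (fun j => j < n - 1) sh ->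
  color_shape n z sh = color_shape n z' sh.
Proof.
move=> /allP sh_low; apply/eq_in_map => j /sh_low jn.
by rewrite (_ : (j == n - 1) = false) //; lia.
Qed.

Lemma tight_shape p ps : is_cp (p :: ps) -> tight (p :: ps) -> (last p ps).1 <= n - 1 ->
  exists z r a k, [/\ p :: ps = color_shape n z (spiral_shape n r a k), 1 <= a,
    a + k <= n - 1 & 0 < r -> a + k = n - 1].
Proof.
elim: ps p => [|q ps IH] p cps t_ps; have [vp pq cps'] := cps; have p_gt0 := valid_part_ge1 vp.
  move=> /= pn; have [pn'|pn'] := leqP p.1 (n - 2).
    exists color_b, 0, p.1, 1; split=> //; try lia.
    by rewrite /spiral_shape /= {1}(low_part hn vp pn') ifF //; lia.
  have [z pE] := mid_part hn vp ltac:(lia); exists z, 1, (n - 1), 0; split=> //; try lia.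
  by rewrite /spiral_shape /= eqxx pE.
move=> last_n; have [z [r [a [k [qE a1 akn r_full]]]]] := IH q cps' (tight_behead t_ps) last_n.
have [vq _ _] := cps'; have := tight_pair vp vq pq (t_ps [::] p q ps erefl).
case: r qE r_full => [|r] qE r_full.
  case: k qE akn {r_full} => // k qE akn; have := qE; rewrite /spiral_shape /= runS => -[q_eq _].
  have qn : q.1 = a + k by rewrite q_eq.
  rewrite ifT; last by lia.
  move=> pE; have [pn|pn] := leqP p.1 (n - 2).
    exists z, 0, a, k.+2; split=> //; try lia.
    rewrite /spiral_shape /= runS /= qE {1}(low_part hn vp pn) ifF; last by lia.
    by congr ((_, _) :: _); lia.
  have [z' pE'] := mid_part hn vp ltac:(lia); exists z', 1, a, k.+1; split=> //; try lia.
  rewrite qE pE' /spiral_shape /= eqxx; congr (_ :: _); apply: color_shape_low.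
  by apply/allP => j; rewrite mem_run; lia.
have qn : q.1 = n - 1 by case: qE => ->.
rewrite qn ltnn => ->; exists z, r.+2, a, k; split=> //.
by rewrite {1}qE /=; congr (_ :: _); case: qE.
Qed.

Lemma corner_not_palindromic ps p p' q q' : is_cp (ps ++ [:: p; q]) ->
  valid_part n p' -> p.1 = p'.1.+1 -> valid_part n q' -> q.1 = q'.1.+1 ->
  stackable n p' q' -> ~ palindromic (elt (ps ++ [:: p; q])).
Proof.
move=> cps vp' pp' vq' qq' p'q'; have catE u v : ps ++ [:: u; v] = (ps ++ [:: u]) ++ [:: v].
  by rewrite -catA.
have cpq' : is_cp (ps ++ [:: p; q']).
  by move: cps; rewrite !catE => cps; apply: colored_partition_replace cps vq' _ _; rewrite ?qq'.
have cp'q' : is_cp (ps ++ [:: p'; q']).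
  by apply: colored_partition_replace cpq' vp' _ _; rewrite ?pp'.
have [//||qs [cqs sub_qs total_qs]] := @remove_last_box (ps ++ [:: p]) [:: q'].
  by rewrite -catA.
rewrite -catA in cqs.
apply: (two_contained_not_palindromic hn (k := 2) _ cps cqs cp'q') => //.
- rewrite contained_catl /= part_le_refl.
  case: qs sub_qs {cqs total_qs} => [|q'' [|? ?]] //=; rewrite ?andbF // !andbT /part_le.
  by case/orP=> [|/eqP->]; rewrite qq'; lia.
- by rewrite contained_catl /= /part_le pp' qq' !ltnSn.
- by rewrite !map_cat !sumn_cat /=; move: total_qs; rewrite /=; lia.
- by rewrite !map_cat !sumn_cat /=; lia.
by apply: cat_cons_neq => p'E; move: pp'; rewrite p'E; lia.
Qed.

Lemma two_colors_not_palindromic ps p q : is_cp (ps ++ [:: p; q]) -> q.1 = n ->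
  ~ palindromic (elt (ps ++ [:: p; q])).
Proof.
move=> cps qn; have catE u v : ps ++ [:: u; v] = (ps ++ [:: u]) ++ [:: v] by rewrite -catA.
have cz z : is_cp (ps ++ [:: p; (n - 1, Some z)]).
  move: cps; rewrite !catE => cps.
  by apply: colored_partition_replace cps (valid_mid hn z) _ _ => //=; lia.
have sub z : rowwise part_le (ps ++ [:: p; (n - 1, Some z)]) (ps ++ [:: p; q]).
  by rewrite !catE lower_row_contained //= qn; lia.
have total_z z : total (ps ++ [:: p; (n - 1, Some z)]) + 1 = total (ps ++ [:: p; q]).
  by rewrite !map_cat !sumn_cat /=; lia.
apply: (two_contained_not_palindromic hn (k := 1) _ cps (cz color_b) (cz color_c)) => //.
by rewrite !catE; apply: cat_cons_neq => -[].
Qed.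

Lemma palindromic_last_row ps p q :
  is_cp (ps ++ [:: p; q]) -> palindromic (elt (ps ++ [:: p; q])) -> q.1 = 1 \/ q.1 = n - 1.
Proof.
move=> cps pal; have [vp pq [vq _ _]] := colored_partition_catr cps.
have q_gt0 := valid_part_ge1 vq; have tight_pq := palindromic_tight cps pal (erefl _).
have := tight_pair vp vq pq tight_pq.
have [q_eq1|q_neq1] := eqVneq q.1 1; first by left.
have [qn|qn] := eqVneq q.1 (n - 1); first by right.
have [qN|qN] := eqVneq q.1 n; first by case: (two_colors_not_palindromic cps qN).
have [q' vq' qq'] := part_pred vq ltac:(lia).
case: ifP => q_low pE; exfalso.
  have [p' vp' pp'] := part_pred vp ltac:(lia).
  apply: (corner_not_palindromic cps vp' pp' vq' qq') pal.
  by rewrite /stackable; apply/orP; left; lia.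
rewrite {}pE in cps pal; apply: (corner_not_palindromic cps vq' qq' vq' qq') pal.
by rewrite /stackable eqxx /=; lia.
Qed.

Lemma palindromic_rows_staircase ps p q :
  is_cp (ps ++ [:: p; q]) -> palindromic (elt (ps ++ [:: p; q])) ->
  exists2 k, k <= n - 1 & map fst (ps ++ [:: p; q]) = staircase k.
Proof.
move=> cps pal; have last_q := palindromic_last_row cps pal.
have t_ps := palindromic_tight cps pal.
have [z [r [a [k [psE a1 akn r_full]]]]] : exists z r a k,
    [/\ ps ++ [:: p; q] = color_shape n z (spiral_shape n r a k), 1 <= a,
        a + k <= n - 1 & 0 < r -> a + k = n - 1].
  case: (ps) cps t_ps => [|p' ps'] cps t_ps; apply: tight_shape => //=; first by lia.
  by rewrite last_cat /=; lia.
have shE : map fst (ps ++ [:: p; q]) = spiral_shape n r a k by rewrite psE color_shape_fst.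
have lastE : last 0 (spiral_shape n r a k) = q.1 by rewrite -shE map_cat last_cat.
have size_ge2 : 2 <= r + k.
  have := congr1 size shE; rewrite size_map !size_cat size_nseq size_run /=; lia.
rewrite psE in pal; rewrite shE {cps t_ps psE shE}.
case: k lastE akn r_full pal size_ge2 => [|k] lastE akn r_full pal size_ge2.
  case: (spiral_not_palindromic hn (z := z) (r := r) (d := 0)); [by lia | by left |].
  by move: pal; rewrite /spiral_shape.
have aE : a = 1 by move: lastE; rewrite /spiral_shape run_rcons last_cat last_rcons; lia.
rewrite {}aE in akn r_full pal *; case: r r_full pal {lastE size_ge2} => [|[|r]] r_full pal.
- by exists k.+1 => //; lia.
- exists (n - 1) => //.
  by rewrite /spiral_shape -(r_full isT) -[staircase _]/(run 1 k.+2) [in RHS]runS.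
case: (spiral_not_palindromic hn (z := z) (r := r.+2) (d := k.+1)) => //.
by right; have := r_full isT; lia.
Qed.

Lemma palindromic_shape ps : is_cp ps -> palindromic (elt ps) ->
  (exists2 j, 1 <= j <= n - 1 \/ j = 2 * n - 2 & map fst ps = [:: j]) \/
  (exists2 k, k <= n - 1 & map fst ps = staircase k).
Proof.
case/lastP: ps => [_ _|ps q]; first by right; exists 0.
case/lastP: ps => [|ps p]; rewrite -?cats1 -?catA => cps pal; last first.
  by right; exact: palindromic_rows_staircase.
have [vq _ _] := cps; left; exists q.1 => //.
have [q_gt0 qn] := (valid_part_ge1 vq, valid_part_leq vq).
have [le_q|gt_q] := leqP q.1 (n - 1); first by left; rewrite q_gt0.
right; have [//|ne_q] := eqVneq q.1 (2 * n - 2).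
by case: (row_not_palindromic hn vq _ pal); lia.
Qed.

Lemma shape_palindromic ps : is_cp ps ->
  (exists2 j, 1 <= j <= n - 1 \/ j = 2 * n - 2 & map fst ps = [:: j]) \/
  (exists2 k, k <= n - 1 & map fst ps = staircase k) -> palindromic (elt ps).
Proof.
move=> cps [[j jn psE]|[k kn psE]].
  case: ps cps psE => [|p [|]] // [vp _ _] [pE].
  by apply: row_palindromic => //; rewrite pE; case: jn; [case/andP; left | right].
have [|z ->] := strict_partition_colored hn kn cps; rewrite psE; first exact: strict_staircase.
exact: staircase_palindromic.
Qed.

End Classification.

Local Open Scope classical_set_scope.

Theorem theorem7p9 (n : nat) (hn : (4 <= n)%N) :
  (forall w : affD n, min_coset_rep (gens_but n 0) w ->
     (palindromic w <->
      ((exists2 j : nat, ((1 <= j <= n - 1)%N \/ j = (2 * n - 2)%N) &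
          underlying_shape (colored_partition w) = [:: j]) \/
       (exists2 k : nat, (k <= n - 1)%N &
          underlying_shape (colored_partition w) = staircase k)))) /\
  (forall sh : seq nat, sh = [:: (n - 1)%N] \/ sh = staircase (n - 1) ->
     exists wb wc : affD n,
       [/\ wb <> wc,
           colored_partition wb = color_shape n color_b sh,
           colored_partition wc = color_shape n color_c sh &
           [set w : affD n | [/\ min_coset_rep (gens_but n 0) w, palindromic w &
                                 underlying_shape (colored_partition w) = sh]]
           = [set wb; wc]]).
Proof.
split=> [w wJ|sh shE].
  have [wE cps] := colored_partitionP hn wJ; rewrite {1}wE.
  by split; [exact: palindromic_shape | exact: shape_palindromic].
have [sh_strict sh_head] : strict_shape (n - 1) sh /\ head 0 sh = n - 1.
  have n1E : (n - 1)%N = (n - 2).+1 by lia.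
  case: shE => ->; rewrite n1E; last by split; [exact: strict_staircase | rewrite staircaseS].
  by rewrite strict_shape_cons leqnn.
have cp z := color_shape_partition hn z (leqnn _) sh_strict.
have shapeE z : underlying_shape (color_shape n z sh) = sh by exact: color_shape_fst.
exists (partition_elt n false (color_shape n color_b sh)),
  (partition_elt n false (color_shape n color_c sh)).
rewrite !colored_partition_elt //; split=> //.
  move/(partition_elt_inj hn (cp _) (cp _)).
  by case: sh sh_head {shE sh_strict cp shapeE} => [|j sh] /= jE; [lia | rewrite jE eqxx].
apply/seteqP; split=> [w [wJ _ wsh]|w wE].
  have [wE cps] := colored_partitionP hn wJ.
  have [|z] := strict_partition_colored hn (leqnn _) cps; rewrite [map _ _]wsh // => zE.
  by rewrite wE zE; case: z {zE}; [left | right].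
have [z ->] : exists z, w = partition_elt n false (color_shape n z sh).
  by case: wE => ->; eexists.
rewrite /= colored_partition_elt //; split=> //; first exact: (partition_elt_min hn (e := false)).
apply: (shape_palindromic hn (cp z)); rewrite color_shape_fst.
by case: shE => ->; [left; exists (n - 1)%N; [left; lia|] | right; exists (n - 1)%N].
Qed.
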